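(* Let $\Bbbk$ be a field, let $m\le n$ be positive integers and $q\in\Bbbk^\ast$. For any pair $(\alpha,\beta)$ of elements of $\Pi_{m,n}$ such that $\alpha\le\beta$, the quantum Richardson variety $\mathcal O_q(G_{m,n}(\Bbbk))/\langle\Pi_\alpha^\beta\rangle$ is a symmetric quantum graded algebra with a straightening law on the ordered set $[\alpha,\beta]$, which satisfies condition (C). In particular, it is an integral domain.
   Context: $\mathcal O_q(M_{n,m}(\Bbbk))$ is the $\Bbbk$-algebra with generators $X_{ij}$, $1\le i\le n$, $1\le j\le m$, and the standard quantum matrix relations: $X_{ij}X_{il}=qX_{il}X_{ij}$ for $j<l$; $X_{ij}X_{kj}=qX_{kj}X_{ij}$ for $i<k$; $X_{il}X_{kj}=X_{kj}X_{il}$ for $i<k$, $j<l$; $X_{ij}X_{kl}-X_{kl}X_{ij}=(q-q^{-1})X_{il}X_{kj}$ for $i<k$, $j<l$. $\Pi_{m,n}\subseteq\mathbb N^m$ is the set of $(i_1,\dots,i_m)$ with $1\le i_1<\dots<i_m\le n$, with the product order of $\mathbb N^m$ (a distributive sublattice of $\mathbb N^m$). For $I=(i_1,\dots,i_m)\in\Pi_{m,n}$, $[I]=\sum_{\sigma\in S_m}(-q)^{\ell(\sigma)}X_{i_{1}\sigma(1)}\cdots X_{i_{m}\sigma(m)}$ is the quantum minor on rows $i_1,\dots,i_m$ and columns $1,\dots,m$. $\mathcal O_q(G_{m,n}(\Bbbk))$ is the $\Bbbk$-subalgebra generated by all $[I]$, $I\in\Pi_{m,n}$; it is $\mathbb N$-graded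 with each $[I]$ of degree $1$; $\Pi_{m,n}$ is identified with $\{[I]\}$ via the injective map $I\mapsto[I]$. For $\alpha\le\beta$ in $\Pi_{m,n}$, $[\alpha,\beta]=\{\gamma\in\Pi_{m,n}\mid\alpha\le\gamma\le\beta\}$, $\Pi_\alpha^\beta=\Pi_{m,n}\setminus[\alpha,\beta]$, and $\langle\Pi_\alpha^\beta\rangle$ is the two-sided ideal of $\mathcal O_q(G_{m,n}(\Bbbk))$ generated by $\{[K]\mid K\in\Pi_\alpha^\beta\}$. The structure map of the quotient is $[\alpha,\beta]\subseteq\Pi_{m,n}\to\mathcal O_q(G_{m,n}(\Bbbk))\to\mathcal O_q(G_{m,n}(\Bbbk))/\langle\Pi_\alpha^\beta\rangle$, and the quotient carries the induced grading. An integral domain is a nonzero (not necessarily commutative) ring without zero divisors. Standard monomials: given a map $\iota:\Pi\to A$ from an ordered set (poset) to a ring, the standard monomial attached to a finite increasing sequence $\alpha_1\le\dots\le\alpha_t$ ($t\ge1$) is $\iota(\alpha_1)\cdots\iota(\alpha_t)$; to the empty sequence one attaches $1_A$. Linear independence of standard monomials means that of the family indexed by finite increasing sequences. Symmetric quantum graded algebra with a straightening law (A.S.L.): an $\mathbb N$-graded $\Bbbk$-algebra $A$ with a finite ordered set $(\Pi,\le)$ and a map $\Pi\to A$ whose image consists of homogeneous elements of positive degree generating $A$ as a $\Bbbk$-algebra, such that (i) standard monomials on $\Pi$ are linearly independent (so $\Pi$ is identified with its image in $A$); (ii) for any pair $(\alpha,\beta)$ of incomparable elements of $\Pi$ there is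 a (necessarily unique) relation, the straightening relation, $\alpha\beta=\sum_{(\lambda,\mu)}c_{\lambda,\mu}^{\alpha,\beta}\lambda\mu$, the sum being over pairs $(\lambda,\mu)\in\Pi^2$ with $\lambda<\alpha,\beta<\mu$ (i.e. $\lambda<\alpha$, $\lambda<\beta$, $\alpha<\mu$, $\beta<\mu$), with $c_{\lambda,\mu}^{\alpha,\beta}\in\Bbbk$; (iii) for any pair $(\alpha,\beta)$ of elements of $\Pi$ there is a relation, called a commutation relation, $\alpha\beta-q_{\alpha\beta}\beta\alpha=\sum_{(\lambda,\mu)}d_{\lambda,\mu}^{\alpha,\beta}\lambda\mu$, the sum being over pairs $(\lambda,\mu)\in\Pi^2$ with $\lambda<\alpha,\beta<\mu$, with $d_{\lambda,\mu}^{\alpha,\beta}\in\Bbbk$ and $q_{\alpha\beta}\in\Bbbk^\ast$. Condition (C): let $\mathcal C_p=\{1,\dots,p\}$. An element $(i_1,\dots,i_d)\in\mathbb N^d$ is increasing if $i_1\le\dots\le i_d$; $\mathbb N^d$ has the product order. For $I,J\in\mathbb N^d$, $I\sqcup J$ denotes the multiset union of the coordinates of $I$ and of $J$. $A$ satisfies condition (C) if (iv) $(\Pi,\le)$ is a distributive lattice and there exist $d\ge1$, integers $n_1,\dots,n_d\ge2$ and an injective lattice morphism $\iota:\Pi\to\mathcal C_{n_1}\times\dots\times\mathcal C_{n_d}$ whose images are all increasing elements of $\mathbb N^d$; (v) for any incomparable $\alpha,\beta$, in the straightening relation one has $c_{\alpha\wedge\beta,\alpha\vee\beta}^{\alpha,\beta}\ne0$,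 and $c_{\lambda,\mu}^{\alpha,\beta}\ne0$ implies $\alpha\sqcup\beta=\lambda\sqcup\mu$ (elements of $\Pi$ being identified with their images under $\iota$); (vi) for any $(\alpha,\beta)\in\Pi^2$ there is a commutation relation with $d_{\alpha\wedge\beta,\alpha\vee\beta}^{\alpha,\beta}=0$ and such that $d_{\lambda,\mu}^{\alpha,\beta}\ne0$ implies $\alpha\sqcup\beta=\lambda\sqcup\mu$. *)

(* Defs.v *)
From HB Require Import structures.
From mathcomp Require Import all_boot all_order all_algebra perm.
From mathcomp.multinomials Require Import monalg.
From mathcomp Require Import boolp classical_sets.

Set Implicit Arguments.
Unset Strict Implicit.
Unset Printing Implicit Defensive.

Import Order.TTheory GRing.Theory.

Local Open Scope ring_scope.
Local Open Scope quotient_scope.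
Local Open Scope classical_set_scope.

(* Noncommutative polynomials.  {malg k[{fmonom I}]} only comes with a
   left-algebra structure in the library, hence the alias. *)
Section FreeAlgebra.
Variables (k : fieldType) (I : choiceType).

Definition freeAlg : Type := {malg k[{fmonom I}]}.
HB.instance Definition _ := GRing.Lalgebra.on freeAlg.

Fact freeAlg_scalerAr (c : k) (x y : freeAlg) : c *: (x * y) = x * (c *: y).
Proof.
have malgCC (d : k) (g : {malg k[{fmonom I}]}) : g * d%:MP = d *: g.
  rewrite malgM_def malgZ_def fgmulgU.
  by apply: eq_bigr => /= w _; rewrite mulm1 mulrC.
change (c *: ((x : {malg k[{fmonom I}]}) * y) =
  (x : {malg k[{fmonom I}]}) * (c *: (y : {malg k[{fmonom I}]}))).
by rewrite -[in RHS]malgCC mulrA malgCC.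
Qed.
HB.instance Definition _ :=
  GRing.Lalgebra_isAlgebra.Build k freeAlg freeAlg_scalerAr.

Definition freeGen (i : I) : freeAlg := << fmu i >>.

Definition freeAug (x : freeAlg) : k := mcoeff mone x.
HB.instance Definition _ := GRing.RMorphism.copy freeAug
  (mcoeff mone : {malg k[{fmonom I}]} -> k).

Lemma freeAug_gen i : freeAug (freeGen i) = 0.
Proof.
rewrite /freeAug /freeGen mcoeffU1; case: eqP => // /(congr1 val) /=.
by rewrite fmuE /= /mone /= fmoneE.
Qed.

Lemma freeAugZ c x : freeAug (c *: x) = c * freeAug x.
Proof. exact: mcoeffZ. Qed.

Lemma freeAug_gen2 i j : freeAug (freeGen i * freeGen j) = 0.
Proof. by rewrite [LHS]rmorphM /= freeAug_gen mul0r. Qed.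

Lemma freeAugB x y : freeAug (x - y) = freeAug x - freeAug y.
Proof. exact: rmorphB. Qed.
End FreeAlgebra.

Section GeneratedSubalgebra.
Variables (k : fieldType) (A : algType k) (S : set A).

Definition genSubalg : {pred A} := fun x =>
  `[< forall B : {pred A}, subalg_closed B -> (forall s, S s -> s \in B) ->
      x \in B >].

Fact genSubalg_closed : subalg_closed genSubalg.
Proof.
split=> [|c x y /asboolP Bx /asboolP By|x y /asboolP Bx /asboolP By];
  apply/asboolP => B Bc SB; case: (Bc) => B1 BZ BM.
- exact: B1.
- by apply: BZ; [apply: Bx | apply: By].
- by apply: BM; [apply: Bx | apply: By].
Qed.
HB.instance Definition _ := GRing.isSubalgClosed.Build k A genSubalg
  (GRing.subalg_closed_semi genSubalg_closed).

Lemma mem_genSubalg x : S x -> x \in genSubalg.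
Proof. by move=> Sx; apply/asboolP => B _; apply. Qed.

Definition subalg : Type := {x : A | x \in genSubalg}.
HB.instance Definition _ := SubChoice.on subalg.
HB.instance Definition _ := [SubChoice_isSubAlgebra of subalg by <:].

Definition subalgGen (x : A) (Sx : S x) : subalg := Sub x (mem_genSubalg Sx).
End GeneratedSubalgebra.

Definition two_sided_ideal (A : nzRingType) (J : {pred A}) : Prop :=
  [/\ 0 \in J, {in J &, forall x y, x + y \in J},
      forall a, {in J, forall x, a * x \in J}
    & forall a, {in J, forall x, x * a \in J}].

(* An algType is nonzero by definition, so the quotient by the ideal generated
   by S is only formed from a proof that this ideal is proper. *)
Section Quotient.
Variables (k : fieldType) (A : algType k) (S : set A).

Definition genIdeal : {pred A} := fun x =>
  `[< forall J : {pred A}, two_sided_ideal J -> (forall s, S s -> s \in J) ->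
      x \in J >].

Lemma genIdeal_ideal : two_sided_ideal genIdeal.
Proof.
split=> [|x y /asboolP Jx /asboolP Jy|a x /asboolP Jx|a x /asboolP Jx];
  apply/asboolP => J JI SJ; case: (JI) => J0 JD Jl Jr //.
- by apply: JD; [apply: Jx | apply: Jy].
- by apply: Jl; apply: Jx.
- by apply: Jr; apply: Jx.
Qed.

Lemma mem_genIdeal x : S x -> x \in genIdeal.
Proof. by move=> Sx; apply/asboolP => J _; apply. Qed.

Fact genIdeal_zmod : zmod_closed genIdeal.
Proof.
case: genIdeal_ideal => J0 JD Jl _; split=> // x y Jx Jy.
by rewrite -mulN1r JD ?Jl.
Qed.
HB.instance Definition _ := GRing.isZmodClosed.Build A genIdeal genIdeal_zmod.

Lemma genIdeal_proper (B : nzRingType) (f : {rmorphism A -> B}) :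
  (forall s, S s -> f s = 0) -> 1 \notin genIdeal.
Proof.
move=> fS; apply/negP => /asboolP /(_ (fun x => f x == 0)) H.
suff /eqP : f 1 == 0 by rewrite rmorph1; apply/eqP/oner_neq0.
apply: H => [|s Ss]; last exact/eqP/fS.
split; rewrite ?unfold_in ?rmorph0 //.
- by move=> x y /eqP fx /eqP fy; rewrite unfold_in rmorphD fx fy addr0.
- by move=> a x /eqP fx; rewrite unfold_in rmorphM fx mulr0.
- by move=> a x /eqP fx; rewrite unfold_in rmorphM fx mul0r.
Qed.

Definition quotAlg of 1 \notin genIdeal : Type := Quotient.quot genIdeal.

Hypothesis S1 : 1 \notin genIdeal.
Local Notation Q := (quotAlg S1).

HB.instance Definition _ := GRing.Zmodule.copy Q (Quotient.quot genIdeal).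

Definition qproj (x : A) : Q := \pi_(Quotient.quot genIdeal) x.
Definition qrepr (x : Q) : A := repr (x : Quotient.quot genIdeal).

Lemma qreprK x : qproj (qrepr x) = x. Proof. exact: reprK. Qed.

Lemma qproj_eq x y : (qproj x == qproj y) = (x - y \in genIdeal).
Proof. by rewrite Quotient.idealrBE. Qed.

Fact qproj_zmod : zmod_morphism qproj.
Proof. exact: raddfB. Qed.
HB.instance Definition _ :=
  GRing.isZmodMorphism.Build A Q qproj qproj_zmod.

Definition qmul (x y : Q) : Q := qproj (qrepr x * qrepr y).
Definition qscale (c : k) (x : Q) : Q := qproj (c *: qrepr x).

Fact qprojM_subproof x y : qmul (qproj x) (qproj y) = qproj (x * y).
Proof.
case: genIdeal_ideal => _ JD Jl Jr; apply/eqP; rewrite qproj_eq.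
set x' := qrepr _; set y' := qrepr _.
have -> : x' * y' - x * y = (x' - x) * y' + x * (y' - y).
  by rewrite mulrBl mulrBr addrA subrK.
by apply: JD; [apply: Jr | apply: Jl]; rewrite -qproj_eq qreprK.
Qed.

Fact qprojZ_subproof c x : qscale c (qproj x) = qproj (c *: x).
Proof.
case: genIdeal_ideal => _ _ Jl _; apply/eqP; rewrite qproj_eq.
rewrite -scalerBr -mulr_algl; apply: Jl.
by rewrite -qproj_eq qreprK.
Qed.

Let qP (P : Q -> Prop) : (forall x, P (qproj x)) -> forall x, P x.
Proof. by move=> H x; rewrite -[x]qreprK. Qed.

Fact qmulA : associative qmul.
Proof.
by elim/qP=> x; elim/qP=> y; elim/qP=> z; rewrite !qprojM_subproof mulrA.
Qed.
Fact qmul1 : left_id (qproj 1) qmul.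
Proof. by elim/qP=> x; rewrite qprojM_subproof mul1r. Qed.
Fact qmulr1 : right_id (qproj 1) qmul.
Proof. by elim/qP=> x; rewrite qprojM_subproof mulr1. Qed.
Fact qmulDl : left_distributive qmul +%R.
Proof.
elim/qP=> x; elim/qP=> y; elim/qP=> z.
by rewrite -raddfD !qprojM_subproof -raddfD mulrDl.
Qed.
Fact qmulDr : right_distributive qmul +%R.
Proof.
elim/qP=> x; elim/qP=> y; elim/qP=> z.
by rewrite -raddfD !qprojM_subproof -raddfD mulrDr.
Qed.
Fact qone_neq0 : qproj 1 != 0.
Proof. by rewrite -(raddf0 qproj) qproj_eq subr0. Qed.
HB.instance Definition _ := GRing.Zmodule_isNzRing.Build Q
  qmulA qmul1 qmulr1 qmulDl qmulDr qone_neq0.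

Fact qscaleA a b x : qscale a (qscale b x) = qscale (a * b) x.
Proof. by elim/qP: x => x; rewrite !qprojZ_subproof scalerA. Qed.
Fact qscale1 : left_id 1 qscale.
Proof. by elim/qP=> x; rewrite qprojZ_subproof scale1r. Qed.
Fact qscaleDr : right_distributive qscale +%R.
Proof.
move=> a; elim/qP=> x; elim/qP=> y.
by rewrite -raddfD !qprojZ_subproof -raddfD scalerDr.
Qed.
Fact qscaleDl x : {morph qscale^~ x : a b / a + b}.
Proof.
by elim/qP: x => x a b; rewrite !qprojZ_subproof -raddfD scalerDl.
Qed.
HB.instance Definition _ := GRing.Zmodule_isLmodule.Build k Q
  qscaleA qscale1 qscaleDr qscaleDl.

Fact qscaleAl (c : k) (x y : Q) : c *: (x * y) = c *: x * y.
Proof.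
elim/qP: x => x; elim/qP: y => y.
change (qscale c (qmul (qproj x) (qproj y)) =
        qmul (qscale c (qproj x)) (qproj y)).
by rewrite !(qprojM_subproof, qprojZ_subproof) scalerAl.
Qed.
HB.instance Definition _ := GRing.Lmodule_isLalgebra.Build k Q qscaleAl.
Fact qscaleAr (c : k) (x y : Q) : c *: (x * y) = x * (c *: y).
Proof.
elim/qP: x => x; elim/qP: y => y.
change (qscale c (qmul (qproj x) (qproj y)) =
        qmul (qproj x) (qscale c (qproj y))).
by rewrite !(qprojM_subproof, qprojZ_subproof) scalerAr.
Qed.
HB.instance Definition _ := GRing.Lalgebra_isAlgebra.Build k Q qscaleAr.

Fact qproj_monoid : monoid_morphism qproj.
Proof. by split=> // x y; rewrite -qprojM_subproof. Qed.
HB.instance Definition _ :=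
  GRing.isMonoidMorphism.Build A Q qproj qproj_monoid.
Fact qproj_scalable : scalable qproj.
Proof. by move=> c x; rewrite -qprojZ_subproof. Qed.
HB.instance Definition _ :=
  GRing.isScalable.Build k A Q *:%R qproj qproj_scalable.

Lemma qproj_eq0 x : (qproj x == 0) = (x \in genIdeal).
Proof. by rewrite -(raddf0 qproj) qproj_eq subr0. Qed.

Section Lift.
Variables (B : nzRingType) (f : {rmorphism A -> B}).

Definition qlift of (forall s, S s -> f s = 0) := fun x : Q => f (qrepr x).

Hypothesis fS : forall s, S s -> f s = 0.

Lemma qliftE x : qlift fS (qproj x) = f x.
Proof.
apply/eqP; rewrite -subr_eq0 /qlift -raddfB; set y := _ - x.
have : y \in genIdeal by rewrite -qproj_eq qreprK.
move=> /asboolP /(_ (fun z => f z == 0)); apply=> [|s Ss]; last exact/eqP/fS.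
split; rewrite ?unfold_in ?rmorph0 //.
- by move=> u v /eqP fu /eqP fv; rewrite unfold_in rmorphD fu fv addr0.
- by move=> a u /eqP fu; rewrite unfold_in rmorphM fu mulr0.
- by move=> a u /eqP fu; rewrite unfold_in rmorphM fu mul0r.
Qed.

Fact qlift_zmod : zmod_morphism (qlift fS).
Proof. by elim/qP=> x; elim/qP=> y; rewrite -raddfB !qliftE raddfB.
Qed.
HB.instance Definition _ := GRing.isZmodMorphism.Build Q B (qlift fS) qlift_zmod.
Fact qlift_monoid : monoid_morphism (qlift fS).
Proof.
split; first by rewrite -(rmorph1 qproj) qliftE rmorph1.
by elim/qP=> x; elim/qP=> y; rewrite -rmorphM !qliftE rmorphM.
Qed.
HB.instance Definition _ :=
  GRing.isMonoidMorphism.Build Q B (qlift fS) qlift_monoid.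
End Lift.
End Quotient.

(* Strictly increasing m-tuples with the product order; entries are 0-based. *)
Definition rowset (m n : nat) : Type :=
  {t : m.-tupleprod 'I_n | sorted <%O (t : seq 'I_n)}.
HB.instance Definition _ m n := SubFinite.on (rowset m n).
HB.instance Definition _ m n := [SubChoice_isSubPOrder of rowset m n by <:
  with Order.seqprod_display Order.OrdinalOrder.ord_display].

Definition row_of m n (I : rowset m n) (r : 'I_m) : 'I_n :=
  tnth (val I : m.-tuple 'I_n) r.

Lemma rowset_leE m n (I J : rowset m n) :
  (I <= J)%O = [forall r, row_of I r <= row_of J r]%N.
Proof. by rewrite leEsub leEtprod. Qed.

Section OrderInterval.
Variables (disp : Order.disp_t) (P : finPOrderType disp) (a b : P).

Definition order_interval : Type := {c : P | (a <= c <= b)%O}.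
HB.instance Definition _ := SubFinite.on order_interval.
HB.instance Definition _ :=
  [SubChoice_isSubPOrder of order_interval by <: with disp].
End OrderInterval.

Section QuantumGrassmannian.
Variables (k : fieldType) (n m : nat) (q : k).

Local Notation x i j := (freeGen k (i, j) : freeAlg k ('I_n * 'I_m)%type).

Variant qmat_rel : freeAlg k ('I_n * 'I_m)%type -> Prop :=
| QRow (i : 'I_n) (j l : 'I_m) of (j < l)%N :
    qmat_rel (x i j * x i l - q *: (x i l * x i j))
| QCol (i h : 'I_n) (j : 'I_m) of (i < h)%N :
    qmat_rel (x i j * x h j - q *: (x h j * x i j))
| QAnti (i h : 'I_n) (j l : 'I_m) of (i < h)%N & (j < l)%N :
    qmat_rel (x i l * x h j - x h j * x i l)
| QDiag (i h : 'I_n) (j l : 'I_m) of (i < h)%N & (j < l)%N :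
    qmat_rel (x i j * x h l - x h l * x i j
              - (q - q^-1) *: (x i l * x h j)).

Lemma freeAug_qmat_rel s : qmat_rel s -> freeAug s = 0.
Proof.
have augB u v : freeAug u = 0 -> freeAug v = 0 ->
    freeAug (u - v : freeAlg k ('I_n * 'I_m)%type) = 0.
  by move=> u0 v0; rewrite freeAugB u0 v0 subr0.
have augZ c (i j : 'I_n * 'I_m) :
    freeAug (c *: (freeGen k i * freeGen k j)) = 0.
  by rewrite freeAugZ freeAug_gen2 mulr0.
case=> [i j l _|i h j _|i h j l _ _|i h j l _ _].
- by apply: (augB); [apply: freeAug_gen2 | exact: augZ].
- by apply: (augB); [apply: freeAug_gen2 | exact: augZ].
- by apply: (augB); apply: freeAug_gen2.
- by apply: (augB); [apply: (augB); apply: freeAug_gen2 | exact: augZ].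
Qed.

Definition OqM : algType k := quotAlg (genIdeal_proper freeAug_qmat_rel).

Definition qX (i : 'I_n) (j : 'I_m) : OqM := qproj _ (freeGen k (i, j)).

Definition OqM_aug (x : OqM) : k := qlift freeAug_qmat_rel x.
HB.instance Definition _ :=
  GRing.RMorphism.copy OqM_aug (qlift freeAug_qmat_rel).

Lemma OqM_augX i j : OqM_aug (qX i j) = 0.
Proof. by rewrite /OqM_aug /qX qliftE; exact: freeAug_gen. Qed.

(* Number of inversions. *)
Definition perm_length (s : 'S_m) : nat :=
  #|[set p : 'I_m * 'I_m | (p.1 < p.2)%N && (s p.2 < s p.1)%N]%SET|.

Definition qminor (I : rowset m n) : OqM :=
  \sum_(s : 'S_m)
     (- q) ^+ perm_length s *: \prod_(r < m) qX (row_of I r) (s r).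

Definition OqG : algType k := subalg (range qminor).

Definition gminor (I : rowset m n) : OqG :=
  subalgGen (imageT qminor I).

(* The only grading of OqG for which every minor has degree 1: in degree d, the
   span of the products of d minors. *)
Definition OqG_deg (d : nat) : set OqG :=
  [set x | exists r : seq (k * d.-tuple (rowset m n)),
     x = \sum_(p <- r) p.1 *: \prod_(I <- p.2) gminor I].

(* [genIdeal (minors_off a b)] is the ideal generated by the minors indexed by
   the complement of the interval from a to b. *)
Definition minors_off (a b : rowset m n) : set OqG :=
  [set gminor K | K in [set K : rowset m n | ~~ (a <= K <= b)%O]].

(* OqG_aug is only used to see that the quotient below is nonzero. *)
Definition OqG_aug (x : OqG) : k := OqM_aug (val x).
Fact OqG_aug_zmod : zmod_morphism OqG_aug.
Proof. by move=> x y; rewrite /OqG_aug !raddfB. Qed.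
HB.instance Definition _ :=
  GRing.isZmodMorphism.Build OqG k OqG_aug OqG_aug_zmod.
Fact OqG_aug_monoid : monoid_morphism OqG_aug.
Proof. by split=> [|x y]; rewrite /OqG_aug ?rmorph1 ?rmorphM. Qed.
HB.instance Definition _ :=
  GRing.isMonoidMorphism.Build OqG k OqG_aug OqG_aug_monoid.

Lemma OqG_aug_minor (I : rowset m n) : (0 < m)%N -> OqG_aug (gminor I) = 0.
Proof.
move=> m_gt0; rewrite /OqG_aug /= /qminor raddf_sum big1 // => s _.
rewrite -mulr_algl [LHS]rmorphM /= rmorph_prod (bigD1 (Ordinal m_gt0)) //=.
by rewrite OqM_augX mul0r mulr0.
Qed.

Lemma minors_off_proper (a b : rowset m n) :
  (0 < m)%N -> 1 \notin genIdeal (minors_off a b).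
Proof.
by move=> m_gt0; apply: (genIdeal_proper (f := OqG_aug)) => s [K _ <-];
  apply: OqG_aug_minor.
Qed.

Variables (m_gt0 : (0 < m)%N) (a b : rowset m n).

Definition richardson : algType k := quotAlg (minors_off_proper a b m_gt0).

Definition richardson_proj : OqG -> richardson := @qproj _ _ _ _.

Definition richardson_deg (d : nat) : set richardson :=
  richardson_proj @` OqG_deg d.

Definition richardson_map (c : order_interval a b) : richardson :=
  richardson_proj (gminor (val c)).
End QuantumGrassmannian.
Arguments richardson_deg {k n m} q m_gt0 a b d _.
Arguments richardson_map {k n m} q m_gt0 a b c.

Definition algebra_grading (k : fieldType) (A : algType k)
    (D : nat -> set A) : Prop :=
  [/\ forall d, D d 0 /\ (forall c x y, D d x -> D d y -> D d (c *: x + y)),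
      D 0%N 1 /\ (forall d e x y, D d x -> D e y -> D (d + e)%N (x * y)),
      (forall x, exists (N : nat) (f : nat -> A),
         (forall i, D i (f i)) /\ x = \sum_(i < N) f i)
    & (forall (N : nat) (f : nat -> A), (forall i, D i (f i)) ->
         \sum_(i < N) f i = 0 -> forall i, (i < N)%N -> f i = 0)].

Section ASL.
Variables (k : fieldType) (A : algType k) (disp : Order.disp_t)
  (P : finPOrderType disp) (iota : P -> A).

Definition std_monomial (s : seq P) : A := \prod_(c <- s) iota c.

Definition std_monomials_free : Prop :=
  forall (S : seq (seq P)) (c : seq P -> k),
    uniq S -> all (sorted <=%O) S ->
    \sum_(s <- S) c s *: std_monomial s = 0 -> {in S, forall s, c s = 0}.

Definition outer (a b : P) : pred (P * P) :=
  fun p => [&& p.1 < a, p.1 < b, a < p.2 & b < p.2]%O.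

Definition outer_sum (a b : P) (c : P * P -> k) : A :=
  \sum_(p | outer a b p) c p *: (iota p.1 * iota p.2).

Definition straightening (a b : P) (c : P * P -> k) : Prop :=
  iota a * iota b = outer_sum a b c.

Definition commutation (a b : P) (t : k) (c : P * P -> k) : Prop :=
  t != 0 /\ iota a * iota b - t *: (iota b * iota a) = outer_sum a b c.

(* D is the grading of A and iota the structure map. *)
Record symmetric_quantum_graded_ASL (D : nat -> set A) : Prop := SQGASL {
  asl_grading : algebra_grading D;
  asl_homogeneous : forall c, exists2 d, (0 < d)%N & D d (iota c);
  asl_generate : forall x, x \in genSubalg (range iota);
  asl_free : std_monomials_free;
  asl_straightening : forall a b, ~~ (a >=< b)%O ->
    exists c, straightening a b c;
  asl_commutation : forall a b, exists t c, commutation a b t c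
}.

Definition distributive_lattice (meet join : P -> P -> P) : Prop :=
  [/\ forall x y z, (z <= meet x y)%O = (z <= x)%O && (z <= y)%O,
      forall x y z, (join x y <= z)%O = (x <= z)%O && (y <= z)%O
    & left_distributive meet join].

Definition chain_embedding (meet join : P -> P -> P) (d : nat)
    (ns : d.-tuple nat) (e : P -> d.-tuple nat) : Prop :=
  [/\ injective e,
      forall x j, (1 <= tnth (e x) j <= tnth ns j)%N,
      forall x y j, tnth (e (meet x y)) j = minn (tnth (e x) j) (tnth (e y) j),
      forall x y j, tnth (e (join x y)) j = maxn (tnth (e x) j) (tnth (e y) j)
    & forall x, sorted leq (e x)].

(* The straightening relation of (a, b) is unique when standard monomials are
   free, hence the universal quantification over c in condC_straightening.
   Coefficients outside [outer a b] do not enter the relations. *)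
Record conditionC_for (meet join : P -> P -> P) (d : nat) (ns : d.-tuple nat)
    (e : P -> d.-tuple nat) : Prop := ConditionC {
  condC_lattice : distributive_lattice meet join;
  condC_dim : (0 < d)%N;
  condC_chains : all (leq 2) ns;
  condC_embedding : chain_embedding meet join ns e;
  condC_straightening : forall a b c, ~~ (a >=< b)%O -> straightening a b c ->
    c (meet a b, join a b) != 0 /\
    (forall p, outer a b p -> c p != 0 ->
       perm_eq (e a ++ e b) (e p.1 ++ e p.2));
  (* For comparable a and b the pair (meet a b, join a b) is not in the range
     outer a b, so the second clause is then no constraint on the relation. *)
  condC_commutation : forall a b, exists t c,
    [/\ commutation a b t c, c (meet a b, join a b) = 0
      & forall p, outer a b p -> c p != 0 ->
          perm_eq (e a ++ e b) (e p.1 ++ e p.2)]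
}.

Definition conditionC : Prop :=
  exists (meet join : P -> P -> P) (d : nat) (ns : d.-tuple nat)
    (e : P -> d.-tuple nat), conditionC_for meet join ns e.
End ASL.

Definition integral_domain (A : nzRingType) : Prop :=
  (1 : A) != 0 /\ (forall x y : A, x * y = 0 -> x = 0 \/ y = 0).

(* Main.v *)
(* Everything is read off from homomorphisms phi from O_q(M_{n,m}) to a quantum
   torus, one for each interval [gamma, delta] of row sets.  Such a phi sends
   X_ij to a sum over lattice paths, and to 0 unless gamma_j <= i <= delta_j, so
   that it kills the minors outside [gamma, delta].  For a suitable weight the
   diagonal term of phi([I]) is the leading one when I lies in [gamma, delta]; so
   the standard monomials on [gamma, delta] have images with distinct leading
   exponents, hence linearly independent ones.

   A q-antisymmetrised product over m + 1 rows vanishes, as there are only m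
   columns.  This Garnir relation writes [I][J], for I not below J, through
   products [I'][J'] of the same content with a smaller row sum of I'; hence
   standard monomials span.  If [lambda][mu] occurs in the standard expression of
   [I][J], then the phi of [lambda, mu] does not kill [I][J], that is, I and J lie
   in [lambda, mu].  With the conservation of content this gives the shape of the
   straightening and commutation relations.

   Finally the phi of [alpha, beta] factors through the quotient by the minors
   outside [alpha, beta], where it is injective because standard monomials span
   and have independent images; and a quantum torus is a domain. *)

From HB Require Import structures.
From mathcomp Require Import all_boot all_order all_algebra perm zify.
From mathcomp Require Import finmap boolp classical_sets.
From mathcomp.multinomials Require Import monalg.
Require Import Defs.

Set Implicit Arguments.
Unset Strict Implicit.
Unset Printing Implicit Defensive.

Import Order.TTheory GRing.Theory Num.Theory.
Local Open Scope ring_scope.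

(** * Quantum minors and Garnir relations *)

(** The torus model is built row by row: adding a row multiplies the matrix found so far, suitably
    bordered, by a block of monomials. By comultiplication the quantum matrix relations reduce to
    those of one block, where they are identities between powers of [q]. The bounds gamma and delta
    enter only through the mask of a block: delta being nondecreasing makes the mask respect the
    relations, gamma being nondecreasing confines the paths. The straight path for X_ij weighs i *
    j, so the rearrangement inequality singles out the diagonal term of a minor. Equal weights
    occur, so the weight gives only a partial order; words of equal weight are told apart by their
    exponents, which record how often each row index occurs in each column. The total order that
    makes the torus a domain is the lexicographic one. Both kinds of relations come from one
    expansion of [I][J], for comparable pairs too. Its coefficient at the meet and join is nonzero:
    under the homomorphism of the interval between them only this product survives, while the image
    of [I][J] is not 0. The commutation relation subtracts the multiple of [J][I] that cancels this
    term. *)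

Section SignedSums.
Variables (k : fieldType) (A : algType k) (q : k).

Section Picks.
Variable U : Type.
Implicit Types (f g : U -> seq U -> A) (t : seq U).

(* The sum over the ways to remove one entry from [t], with sign and power of [q]
   given by the number of entries before it. *)
Fixpoint picksum f t : A :=
  if t is c :: t' then f c t' - q *: picksum (fun x u => f x (c :: u)) t' else 0.

Lemma eq_picksum f g t : (forall c u, f c u = g c u) -> picksum f t = picksum g t.
Proof.
elim: t f g => //= c t IH f g fg; rewrite fg; congr (_ - _ *: _).
by apply: IH => ? ?; apply: fg.
Qed.

Lemma eq_picksum_all (P : pred U) f g t :
  all P t -> (forall c u, P c -> f c u = g c u) -> picksum f t = picksum g t.
Proof.
elim: t f g => //= c t IH f g /andP[Pc Pt] fg; rewrite fg //.
by congr (_ - _ *: _); apply: IH => // ? ? ?; apply: fg.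
Qed.

Lemma picksumD f g t : picksum (fun c u => f c u + g c u) t = picksum f t + picksum g t.
Proof.
elim: t f g => [|c t IH] f g /=; first by rewrite addr0.
by rewrite IH scalerDr opprD addrACA.
Qed.

Lemma picksumZ a f t : picksum (fun c u => a *: f c u) t = a *: picksum f t.
Proof.
elim: t f => [|c t IH] f /=; first by rewrite scaler0.
by rewrite IH scalerBr !scalerA mulrC.
Qed.

(** Every remainder [u] is one entry shorter than [t], so the power is constant. It is written with
    [size u] because it arises in this form from the signs of [splitsum]. *)
Lemma picksum_size f t :
  picksum (fun c u => (- q) ^+ (size u).+1 *: f c u) t = (- q) ^+ size t *: picksum f t.
Proof.
elim: t f => [|c t IH] f /=; first by rewrite scaler0.
rewrite scalerBr; congr (_ - _).
rewrite [RHS]scalerA mulrC -scalerA exprS -scalerA.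
rewrite -(IH (fun x u => f x (c :: u))) -!picksumZ; apply: eq_picksum => x u.
by rewrite !scalerA exprS mulrA.
Qed.

Lemma picksumN f t : picksum (fun c u => - f c u) t = - picksum f t.
Proof.
by rewrite -scaleN1r -picksumZ; apply: eq_picksum => c u; rewrite scaleN1r.
Qed.

Lemma picksumB f g t : picksum (fun c u => f c u - g c u) t = picksum f t - picksum g t.
Proof. by rewrite picksumD picksumN. Qed.

Lemma picksum0 t : picksum (fun _ _ => 0) t = 0.
Proof. by elim: t => //= c t ->; rewrite scaler0 subr0. Qed.

Lemma picksumMl a f t : picksum (fun c u => a * f c u) t = a * picksum f t.
Proof.
elim: t f => [|c t IH] f /=; first by rewrite mulr0.
by rewrite IH mulrBr scalerAr.
Qed.

Lemma picksumMr a f t : picksum (fun c u => f c u * a) t = picksum f t * a.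
Proof.
elim: t f => [|c t IH] f /=; first by rewrite mul0r.
by rewrite IH mulrBl scalerAl.
Qed.
End Picks.

Lemma exchange_picksum U V (f : U -> seq U -> V -> seq V -> A) s t :
  picksum (fun a u => picksum (fun c v => f a u c v) t) s =
  picksum (fun c v => picksum (fun a u => f a u c v) s) t.
Proof.
elim: s f => [|a s IH] f /=; first by rewrite picksum0.
by rewrite IH picksumB picksumZ.
Qed.

(** For [c] in front of [d], removing [d] and then [c] costs one factor [- q] more than the other
    order, since removing [c] first shortens the list in front of [d]. With the hypothesis on [f]
    the two terms cancel. *)
Lemma picksum2 U (f : U -> U -> seq U -> A) (r : rel U) t :
  pairwise r t -> (forall c d u, r c d -> f c d u = q *: f d c u) ->
  picksum (fun c u => picksum (fun d v => f c d v) u) t = 0.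
Proof.
elim: t f => //= c t IH f /andP[ct rt] fr.
have -> : picksum (fun x u => picksum (fun d v => f x d v) (c :: u)) t =
    picksum (fun x u => f x c u) t
    - q *: picksum (fun x u => picksum (fun d v => f x d (c :: v)) u) t.
  by rewrite -picksumZ -picksumB.
rewrite IH // => [|? ? ? /fr //]; rewrite scaler0 subr0 -picksumZ -picksumB.
rewrite -[RHS](picksum0 t); apply: eq_picksum_all ct _ => d u /fr ->.
by rewrite subrr.
Qed.

Section Splits.
Variable U : Type.
Implicit Types (F G : seq U -> seq U -> A) (t : seq U).

(* The sum over the ways to split [t] into two complementary subsequences, the
   exponent counting the pairs that the splitting puts out of order. *)
Fixpoint splitsum F t : A :=
  if t is c :: t' then
    splitsum (fun u v => F (c :: u) v) t'
    + splitsum (fun u v => (- q) ^+ size u *: F u (c :: v)) t'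
  else F [::] [::].

Lemma eq_splitsum F G t : (forall u v, F u v = G u v) -> splitsum F t = splitsum G t.
Proof.
elim: t F G => //= c t IH F G FG.
by congr (_ + _); apply: IH => u v; rewrite FG.
Qed.

Lemma splitsumD F G t : splitsum (fun u v => F u v + G u v) t = splitsum F t + splitsum G t.
Proof.
elim: t F G => //= c t IH F G; rewrite IH addrACA; congr (_ + _).
by rewrite -IH; apply: eq_splitsum => u v; rewrite scalerDr.
Qed.

Lemma splitsumZ a F t : splitsum (fun u v => a *: F u v) t = a *: splitsum F t.
Proof.
elim: t F => //= c t IH F; rewrite IH scalerDr; congr (_ + _).
by rewrite -IH; apply: eq_splitsum => u v; rewrite !scalerA mulrC.
Qed.

Lemma splitsum0 t : splitsum (fun _ _ => 0) t = 0.
Proof.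
elim: t => //= c t ->; rewrite add0r -[RHS](scale0r (splitsum (fun _ _ => 0) t)).
by rewrite -splitsumZ; apply: eq_splitsum => u v; rewrite !scaler0.
Qed.

Lemma splitsumMl a F t : splitsum (fun u v => a * F u v) t = a * splitsum F t.
Proof.
elim: t F => //= c t IH F; rewrite IH mulrDr; congr (_ + _).
by rewrite -IH; apply: eq_splitsum => u v; rewrite scalerAr.
Qed.

Lemma splitsumMr a F t : splitsum (fun u v => F u v * a) t = splitsum F t * a.
Proof.
elim: t F => //= c t IH F; rewrite IH mulrDl; congr (_ + _).
by rewrite -IH; apply: eq_splitsum => u v; rewrite scalerAl.
Qed.

(** An entry of [w] in front of the picked [c] is counted on the left by the pick, and on the right
    as a pair that the splitting puts out of order. *)
Lemma picksum_splitsum (f : U -> seq U -> seq U -> A) t :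
  picksum (fun c u => splitsum (fun v w => f c v w) u) t =
  splitsum (fun v w => picksum (fun c u => f c u w) v) t.
Proof.
elim: t f => //= c t IH f.
have -> : splitsum (fun u v => f c u v - q *: picksum (fun x w => f x (c :: w) v) u) t
    = splitsum (fun u v => f c u v) t
      - q *: splitsum (fun u v => picksum (fun x w => f x (c :: w) v) u) t.
  rewrite -splitsumZ -[- splitsum _ t]scaleN1r -splitsumZ -splitsumD.
  by apply: eq_splitsum => u v; rewrite scaleN1r.
rewrite picksumD scalerDr opprD addrA IH; congr (_ + _).
rewrite IH -scaleNr -splitsumZ; apply: eq_splitsum => u v.
by rewrite -picksum_size -picksumZ; apply: eq_picksum => x w; rewrite scalerA -exprS.
Qed.

Lemma splitsum_nil (g : seq U -> A) t :
  splitsum (fun u v => (nilp u)%:R * g v) t = g t.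
Proof.
elim: t g => [|c t IH] g /=; first by rewrite mul1r.
rewrite (@eq_splitsum _ (fun _ _ => 0)) => [|u v]; last by rewrite mul0r.
rewrite splitsum0 add0r -[RHS](IH (fun v => g (c :: v))).
by apply: eq_splitsum => -[|d u] v; rewrite ?scale1r //= !mul0r scaler0.
Qed.
End Splits.

Lemma exchange_splitsum U V (f : seq U -> seq U -> seq V -> seq V -> A) s t :
  splitsum (fun a u => splitsum (fun c v => f a u c v) t) s =
  splitsum (fun c v => splitsum (fun a u => f a u c v) s) t.
Proof.
elim: s f => [|a s IH] f //=; rewrite IH splitsumD; congr (_ + _).
by rewrite -IH; apply: eq_splitsum => u v; rewrite splitsumZ.
Qed.

Lemma eq_picksum_in (U : eqType) (f g : U -> seq U -> A) t :
  (forall c u, c \in t -> subseq u t -> size t = (size u).+1 -> f c u = g c u) ->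
  picksum f t = picksum g t.
Proof.
elim: t f g => [//|c t IH] f g fg.
rewrite [LHS]/= [RHS]/= fg ?mem_head ?subseq_cons //.
congr (_ - _ *: _); apply: IH => d u dt ut tu.
by apply: fg; rewrite ?inE ?dt ?orbT //= ?eqxx ?tu.
Qed.

Lemma eq_splitsum_in (U : eqType) (F G : seq U -> seq U -> A) t :
  (forall u v, subseq u t -> subseq v t -> F u v = G u v) ->
  splitsum F t = splitsum G t.
Proof.
elim: t F G => [|c t IH] F G FG; first exact: FG.
have sub u : subseq u t -> subseq u (c :: t).
  by move=> ut; apply: subseq_trans ut (subseq_cons _ _).
have subc u : subseq u t -> subseq (c :: u) (c :: t) by rewrite /= eqxx.
by congr (_ + _); apply: IH => u v ut vt; rewrite FG; auto.
Qed.

Section Minors.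
Variables (T U : Type).
Implicit Types (x : T -> U -> A) (s : seq T) (t : seq U).

(* The quantum minor of [x] on rows [s] and columns [t], by expansion along the
   first row.  It is 0 when [s] and [t] have different sizes. *)
Fixpoint qdet x s t : A :=
  if s is i :: s' then picksum (fun j u => x i j * qdet x s' u) t else (nilp t)%:R.

(** Laplace expansion along the rows [s1]; splittings of the wrong sizes contribute 0. *)
Lemma qdet_cat x s1 s2 t :
  qdet x (s1 ++ s2) t = splitsum (fun u v => qdet x s1 u * qdet x s2 v) t.
Proof.
elim: s1 t => [|i s1 IH] t /=; first by rewrite splitsum_nil.
under eq_picksum => j u do rewrite IH -splitsumMl.
rewrite picksum_splitsum; apply: eq_splitsum => u v; rewrite -picksumMr.
by apply: eq_picksum => j w; rewrite mulrA.
Qed.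
End Minors.

Lemma qdet_size (T U : eqType) (x : T -> U -> A) s t :
  size s != size t -> qdet x s t = 0.
Proof.
elim: s t => [|i s IH] t /=; first by rewrite eq_sym => /negPf; rewrite /nilp => ->.
move=> st; rewrite -[RHS](picksum0 t); apply: eq_picksum_in => j u _ _ tu.
by rewrite IH ?mulr0 // -eqSS -tu.
Qed.

(** The index types are arbitrary total orders, so that one record serves for ordinals, for [nat] in
    the path model and for transposes. *)
Record qmat dT dU (T : orderType dT) (U : orderType dU) (x : T -> U -> A) :
    Prop := QMat {
  qrow : forall i j l, (j < l)%O -> x i j * x i l = q *: (x i l * x i j);
  qcol : forall i h j, (i < h)%O -> x i j * x h j = q *: (x h j * x i j);
  qanti : forall i h j l, (i < h)%O -> (j < l)%O -> x i l * x h j = x h j * x i l;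
  qdiag : forall i h j l, (i < h)%O -> (j < l)%O ->
    x i j * x h l = x h l * x i j + (q - q^-1) *: (x i l * x h j)
}.

Lemma qmat_tr dT dU (T : orderType dT) (U : orderType dU) (x : T -> U -> A) :
  qmat x -> qmat (fun j i => x i j).
Proof.
move=> qx; split=> [j i h ih|j l i jl|j l i h jl ih|j l i h jl ih].
- exact: qcol.
- exact: qrow.
- by rewrite [RHS](qanti qx).
- by rewrite (qdiag qx) // [x i l * _](qanti qx).
Qed.

Section QuantumMatrix.
Context {dT dU : Order.disp_t}.
Variables (T : orderType dT) (U : orderType dU).

(* Expanding the left side along its first row and then along the first column,
   and the right side in the other order, gives the same double sum because
   [x a l] and [x h c] commute for [a < h] and [c < l]. *)
Lemma qdet_tr (x : T -> U -> A) s t : qmat x -> sorted <%O s -> sorted <%O t ->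
  qdet x s t = qdet (fun j i => x i j) t s.
Proof.
move=> qx; have [n] := ubnP (size s); elim: n s t => // n IH [|a s] [|c t] //.
rewrite ltnS => ssz srt trt /=.
have srt' := path_sorted srt; have trt' := path_sorted trt.
have sa := order_path_min lt_trans srt; have tc := order_path_min lt_trans trt.
rewrite IH //; congr (_ - _ *: _).
transitivity (picksum (fun l u => picksum (fun h v =>
    x a l * (x h c * qdet (fun j i => x i j) u v)) s) t).
  apply: eq_picksum_in => l u lt ut _; rewrite picksumMl IH //.
  by apply: subseq_lt_sorted trt; rewrite /= eqxx.
rewrite exchange_picksum; apply: eq_picksum_in => h v hs vs sv.
have <- : qdet x (a :: v) t = qdet (fun j i => x i j) t (a :: v).
  apply: IH => //; first by rewrite /= -sv.
  by apply: subseq_lt_sorted srt; rewrite /= eqxx.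
rewrite /= -picksumMl; apply: eq_picksum_in => l u lt ut _.
rewrite !mulrA (qanti qx) ?(allP sa) ?(allP tc) //.
by rewrite IH ?(subseq_lt_sorted ut) ?(subseq_lt_sorted vs) //; apply: leq_trans ssz; rewrite /= sv ltnS ltnW.
Qed.

Hypothesis q_neq0 : q != 0.

(** Expanding the first two rows leaves the factors [x b c * x a d + q *: (x a c * x b d)]. For
    [c < d] the quantum relations make this [q] times the same expression with [c] and [d]
    exchanged, so [picksum2] applies. *)
Lemma qdet_swap_lt (x : T -> U -> A) a b s t : qmat x -> sorted <%O t ->
  (a < b)%O -> qdet x (b :: a :: s) t = - q *: qdet x (a :: b :: s) t.
Proof.
move=> qx; rewrite lt_sorted_pairwise => tt ab; apply/eqP; rewrite -subr_eq0 scaleNr opprK.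
rewrite /= -picksumZ -picksumD; apply/eqP.
transitivity (picksum (fun c u => picksum (fun d v =>
   (x b c * x a d + q *: (x a c * x b d)) * qdet x s v) u) t).
  apply: eq_picksum => c u; rewrite -!picksumMl -picksumZ -picksumD.
  by apply: eq_picksum => d v; rewrite mulrDl -scalerAl !mulrA.
pose f c d v := (x b c * x a d + q *: (x a c * x b d)) * qdet x s v.
apply: (picksum2 (f := f)) tt _ => c d u cd; rewrite /f.
rewrite [RHS]scalerAl; congr (_ * _); rewrite [RHS]scalerDr scalerA.
rewrite (qanti qx ab cd) (qdiag qx ab cd) (qanti qx ab cd).
rewrite scalerDr scalerA mulrBr divff // scalerBl scale1r addrCA; congr (_ + _).
by rewrite addrCA subrr addr0.
Qed.

Lemma qdet_dup (x : T -> U -> A) a s t : qmat x -> sorted <%O t ->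
  qdet x (a :: a :: s) t = 0.
Proof.
move=> qx; rewrite lt_sorted_pairwise => tt /=.
transitivity (picksum (fun c u => picksum (fun d v =>
   (x a c * x a d) * qdet x s v) u) t).
  by apply: eq_picksum => c u; rewrite -picksumMl; apply: eq_picksum => d v; rewrite mulrA.
pose f c d v := x a c * x a d * qdet x s v.
by apply: (picksum2 (f := f)) tt _ => c d u cd; rewrite /f (qrow qx) // [RHS]scalerAl.
Qed.

Lemma qdet_swap (x : T -> U -> A) a b : qmat x -> exists2 c, c != 0 &
  forall s t, sorted <%O t -> qdet x (a :: b :: s) t = c *: qdet x (b :: a :: s) t.
Proof.
move=> qx; case: (ltgtP a b) => [ab|ba|->].
- exists (- q^-1) => [|s t tt]; first by rewrite oppr_eq0 invr_eq0.
  by rewrite (qdet_swap_lt _ qx tt ab) scalerA mulrNN mulVf // scale1r.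
- exists (- q) => [|s t tt]; first by rewrite oppr_eq0.
  by rewrite (qdet_swap_lt _ qx tt ba).
- by exists 1 => [|s t tt]; rewrite ?oner_eq0 // scale1r.
Qed.

Lemma qdet_catl (x : T -> U -> A) c p s s' :
  (forall t, sorted <%O t -> qdet x s t = c *: qdet x s' t) ->
  forall t, sorted <%O t -> qdet x (p ++ s) t = c *: qdet x (p ++ s') t.
Proof.
move=> H; elim: p => // i p IH t tt /=; rewrite -picksumZ.
apply: eq_picksum_in => j u _ ut _; rewrite IH ?(subseq_lt_sorted ut) //.
by rewrite scalerAr.
Qed.

Lemma qdet_move (x : T -> U -> A) a p : qmat x -> exists2 c, c != 0 &
  forall s t, sorted <%O t -> qdet x (p ++ a :: s) t = c *: qdet x (a :: p ++ s) t.
Proof.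
move=> qx; elim: p => [|b p [c c0 IH]].
  by exists 1; rewrite ?oner_eq0 // => s t _; rewrite scale1r.
have [d d0 ba] := qdet_swap b a qx.
exists (c * d) => [|s t tt]; first by rewrite mulf_neq0.
rewrite -scalerA -ba //.
exact: (@qdet_catl x c [:: b] _ _ (IH s)).
Qed.

(** The scalar is, up to sign, a power of [q]. It is left unspecified, as only linear spans matter
    later. *)
Lemma qdet_perm (x : T -> U -> A) s s' : qmat x -> perm_eq s s' ->
  exists2 c, c != 0 & forall t, sorted <%O t -> qdet x s t = c *: qdet x s' t.
Proof.
move=> qx; elim: s' s => [|a s' IH] s.
  move=> /perm_nilP ->.
  by exists 1; rewrite ?oner_eq0 // => t _; rewrite scale1r.
move=> ss'; have as_ : a \in s by rewrite (perm_mem ss') mem_head.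
move: ss'; case/splitPr: as_ => p1 p2.
rewrite perm_catC /= perm_cons perm_catC.
move=> /IH [c c0 H]; have [d d0 mv] := qdet_move a p1 qx.
exists (d * c) => [|t tt]; first by rewrite mulf_neq0.
rewrite mv // -scalerA; congr (_ *: _).
exact: (@qdet_catl x c [:: a] _ _ H).
Qed.

(** The second copy of a repeated row is moved next to the first, where [qdet_dup] applies. *)
Lemma qdet_nonuniq (x : T -> U -> A) s t : qmat x -> sorted <%O t ->
  ~~ uniq s -> qdet x s t = 0.
Proof.
move=> qx; elim: s t => //= a s IH t tt; rewrite negb_and negbK => /orP[|us].
  case/splitPr => p1 p2; have [c _ mv] := qdet_move a p1 qx.
  have := @qdet_catl x c [:: a] _ _ (mv p2) t tt; rewrite /= => ->.
  by have /= -> := qdet_dup a (p1 ++ p2) qx tt; rewrite scaler0.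
rewrite -[RHS](picksum0 t); apply: eq_picksum_in => j u _ ut _.
by rewrite IH ?mulr0 // (subseq_lt_sorted ut).
Qed.
End QuantumMatrix.

Section Garnir.
Context {dT dU : Order.disp_t}.
Variables (T : orderType dT) (U : orderType dU).
Hypothesis q_neq0 : q != 0.

(* Laplace expansion along rows reduces the sum to quantum minors of the rows [s]
   whose columns, all taken in [t], outnumber [t] and so repeat. *)
Lemma garnir (x : T -> U -> A) s1 s2 s t : qmat x -> sorted <%O t ->
  sorted <%O s -> (size t < size s)%N ->
  splitsum (fun u v => qdet x (s1 ++ u) t * qdet x (v ++ s2) t) s = 0.
Proof.
move=> qx tt ss ts.
(* [t1] and [t2] are the columns given to [s1] and [u], [t3] and [t4] those given to [v] and
   [s2]. *)
transitivity (splitsum (fun t1 t2 => splitsum (fun t3 t4 => qdet x s1 t1 *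
   (splitsum (fun u v => qdet x u t2 * qdet x v t3) s) * qdet x s2 t4) t) t).
  under eq_splitsum => u v do rewrite !qdet_cat -splitsumMr.
  rewrite exchange_splitsum; apply: eq_splitsum => t1 t2.
  under eq_splitsum => u v do rewrite -splitsumMl.
  rewrite exchange_splitsum; apply: eq_splitsum => t3 t4.
  rewrite -splitsumMl -splitsumMr; apply: eq_splitsum => u v.
  by rewrite !mulrA.
rewrite -[RHS](splitsum0 t); apply: eq_splitsum_in => t1 t2 _ t2t.
rewrite -[RHS](splitsum0 t); apply: eq_splitsum_in => t3 t4 t3t _.
suff -> : splitsum (fun u v => qdet x u t2 * qdet x v t3) s = 0 by rewrite mulr0 mul0r.
transitivity (qdet (fun j i => x i j) (t2 ++ t3) s).
  rewrite qdet_cat; apply: eq_splitsum_in => u v us vs.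
  by congr (_ * _); apply: qdet_tr => //;
    [exact: subseq_lt_sorted us ss | exact: subseq_lt_sorted t2t tt
    |exact: subseq_lt_sorted vs ss | exact: subseq_lt_sorted t3t tt].
have [szs|] := eqVneq (size (t2 ++ t3)) (size s); last exact: qdet_size.
apply: (qdet_nonuniq q_neq0 (qmat_tr qx) ss).
apply/negP => ut; move: ts; rewrite ltnNge -szs => /negP; apply.
apply: uniq_leq_size ut _.
by move=> j; rewrite mem_cat => /orP[] /(mem_subseq _) ->.
Qed.

Section SplitIsolation.
Variable S : A -> Prop.
Hypotheses (S0 : S 0) (SD : forall a b, S a -> S b -> S (a + b))
  (SZ : forall c a, S a -> S (c *: a)).

Lemma splitsum_closed (V : eqType) (F : seq V -> seq V -> A) t :
  (forall u v, subseq u t -> perm_eq (u ++ v) t -> S (F u v)) -> S (splitsum F t).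
Proof.
elim: t F => [|c t IH] F FS; first exact: FS.
apply: SD; apply: IH => u v ut uvt; last apply: SZ; apply: FS.
- by rewrite /= eqxx.
- by rewrite perm_cons.
- exact: subseq_trans ut (subseq_cons _ _).
- by rewrite perm_catC /= perm_cons perm_catC.
Qed.

(** With distinct entries, [u = s2] arises from exactly one splitting, and its coefficient, a power
    of [- q], is invertible. [S] stands for a linear subspace that contains all the other terms. *)
Lemma splitsum_extract (V : eqType) (F : seq V -> seq V -> A) s1 s2 :
  uniq (s1 ++ s2) ->
  (forall u v, u <> s2 -> subseq u (s1 ++ s2) -> perm_eq (u ++ v) (s1 ++ s2) ->
     S (F u v)) ->
  exists2 c, c != 0 & S (splitsum F (s1 ++ s2) - c *: F s2 s1).
Proof.
elim: s1 F => [|a s1 IH] F /= us FS.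
  exists 1; rewrite ?oner_eq0 // scale1r.
  elim: s2 F {us} FS => [|c s2 IH] F FS /=; first by rewrite subrr.
  rewrite addrAC; apply: SD.
    apply: (IH (fun u v => F (c :: u) v)) => u v us2 us pu; apply: FS.
    - by case.
    - by rewrite /= eqxx.
    - by rewrite /= perm_cons.
  apply: splitsum_closed => u v us pu; apply/SZ/FS.
  - by move=> uc; move: (size_subseq us); rewrite uc /= ltnn.
  - exact: subseq_trans us (subseq_cons _ _).
  - by rewrite perm_catC /= perm_cons perm_catC.
move: us => /andP[as12 us].
have [|c c0 H] := IH (fun u v => (- q) ^+ size u *: F u (a :: v)) us.
  move=> u v us2 uss pu; apply/SZ/FS => //.
  - exact: subseq_trans uss (subseq_cons _ _).
  - by rewrite perm_catC /= perm_cons perm_catC.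
exists (c * (- q) ^+ size s2); first by rewrite mulf_neq0 // expf_neq0 // oppr_eq0.
rewrite -addrA -scalerA; apply: SD => //.
apply: splitsum_closed => u v us' pu; apply: FS.
- by move=> us2; move: as12; rewrite -us2 mem_cat mem_head orbT.
- by rewrite /= eqxx.
- by rewrite /= perm_cons.
Qed.

(** The Garnir relation over [r1 ++ r2], solved for the term with [u = r2]. *)
Lemma plucker (x : T -> U -> A) s1 s2 r1 r2 t : qmat x -> sorted <%O t ->
  sorted <%O (r1 ++ r2) -> (size t < size (r1 ++ r2))%N ->
  (forall u v, u <> r2 -> subseq u (r1 ++ r2) -> perm_eq (u ++ v) (r1 ++ r2) ->
     S (qdet x (s1 ++ u) t * qdet x (v ++ s2) t)) ->
  S (qdet x (s1 ++ r2) t * qdet x (r1 ++ s2) t).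
Proof.
move=> qx tt rr tr /splitsum_extract[].
  by apply: sorted_uniq rr; [apply: lt_trans | apply: ltxx].
move=> c c0; rewrite garnir // sub0r => /(SZ (- c^-1)).
by rewrite scalerN scaleNr opprK scalerA mulVf // scale1r.
Qed.
End SplitIsolation.
End Garnir.
End SignedSums.

(** * Expansion of quantum minors over permutations *)

Lemma perm_lengthE m (s : 'S_m) :
  perm_length s = (\sum_(a < m) \sum_(b < m) ((a < b) && (s b < s a)))%N.
Proof.
rewrite pair_bigA /= /perm_length -sum1dep_card [RHS]big_mkcond /= big_mkcond.
by apply: eq_bigr => p _; case: (_ && _).
Qed.

Lemma sum_lift_lt p (j : 'I_p.+1) : (\sum_(v < p) (lift j v < j) = j)%N.
Proof.
transitivity (\sum_(v < p) (v < j))%N.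
  apply: eq_bigr => v _; congr nat_of_bool; rewrite /= /bump.
  by lia.
rewrite -[RHS]card_ord -sum1_card.
have jp : (j <= p)%N by rewrite -ltnS.
rewrite (big_ord_widen p (fun=> 1%N) jp) [RHS]big_mkcond /=.
by apply: eq_bigr => v _; case: (_ < _)%N.
Qed.

(** The [j] values below [j] all sit to the right of position 0 and give its inversions; [lift] is
    increasing, so the others are those of [s]. *)
Lemma perm_length_lift p (j : 'I_p.+1) (s : 'S_p) :
  perm_length (lift_perm ord0 j s) = (j + perm_length s)%N.
Proof.
rewrite !perm_lengthE big_ord_recl; congr (_ + _)%N.
  rewrite big_ord_recl /= add0n lift_perm_id.
  under eq_bigr => b _ do rewrite lift_perm_lift.
  by rewrite -[RHS]sum_lift_lt [RHS](reindex_perm s).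
apply: eq_bigr => a _; rewrite big_ord_recl /= add0n; apply: eq_bigr => b _.
rewrite !lift_perm_lift; congr nat_of_bool; congr andb.
by rewrite /= /bump; lia.
Qed.

Section PermExpansion.
Variables (k : fieldType) (A : algType k) (q : k).

Lemma picksum_enum (V : Type) p (f : V -> seq V -> A) (C : 'I_p.+1 -> V) :
  picksum q f [seq C r | r <- enum 'I_p.+1] =
  \sum_(j < p.+1) (- q) ^+ j *: f (C j) [seq C (lift j r) | r <- enum 'I_p].
Proof.
elim: p f C => [|p IH] f C; rewrite enum_ordSl /= big_ord_recl expr0 scale1r.
  rewrite big_ord0 addr0 -map_comp.
  have -> : enum 'I_0 = [::] by apply/size0nil; rewrite size_enum_ord.
  by rewrite /= scaler0 subr0.
rewrite -[in LHS]map_comp IH -scaleNr scaler_sumr; congr (_ + _).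
apply: eq_bigr => j _; rewrite scalerA -exprS; congr (_ *: f _ _).
rewrite enum_ordSl /= -map_comp; congr (_ :: _).
  by congr C; apply: val_inj.
apply: eq_map => r /=; congr C; apply: val_inj => /=.
by rewrite /bump; lia.
Qed.

(** Links the recursive minor to the defining sum of [qminor]. Through [lift_perm], a permutation of
    [p.+1] indices is its first value together with a permutation of the rest. *)
Lemma qdet_perm_sum (T U : Type) p (x : T -> U -> A) (R : 'I_p -> T) (C : 'I_p -> U) :
  qdet q x [seq R r | r <- enum 'I_p] [seq C r | r <- enum 'I_p] =
  \sum_(s : 'S_p) (- q) ^+ perm_length s *: \prod_(r < p) x (R r) (C (s r)).
Proof.
elim: p R C => [|p IH] R C.
  have -> : enum 'I_0 = [::] by apply/size0nil; rewrite size_enum_ord.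
  rewrite /= (big_pred1 (1%g : 'S_0)) => [|s]; last by apply/esym/eqP/permP => -[].
  by rewrite perm_lengthE !big_ord0 expr0 scale1r.
rewrite [enum _ in X in qdet _ _ X _]enum_ordSl /= picksum_enum.
pose h (z : 'I_p.+1 * 'S_p) := lift_perm ord0 z.1 z.2.
have h_inj : injective h.
  move=> [j s] [j' s'] /permP eqh.
  have := eqh ord0; rewrite /h !lift_perm_id /= => ejj; subst j'.
  congr (_, _); apply/permP => r; have := eqh (lift ord0 r).
  by rewrite /h !lift_perm_lift => /lift_inj.
have h_bij : bijective h.
  apply: inj_card_bij h_inj _.
  by rewrite card_prod card_ord !card_Sn factS.
rewrite [RHS](reindex h) /=; last exact/onW_bij.
rewrite -(pair_bigA _ (fun j s => (- q) ^+ perm_length (lift_perm ord0 j s) *: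
   \prod_(r < p.+1) x (R r) (C (lift_perm ord0 j s r)))) /=.
apply: eq_bigr => j _; rewrite -map_comp IH mulr_sumr scaler_sumr.
apply: eq_bigr => s _; rewrite perm_length_lift exprD -scalerA; congr (_ *: _).
rewrite -scalerAr; congr (_ *: _).
rewrite big_ord_recl lift_perm_id; congr (_ * _).
by apply: eq_bigr => r _; rewrite lift_perm_lift.
Qed.
End PermExpansion.

(** * Twisted group algebras and leading exponents *)

Section LinearExtension.
Variables (k : fieldType) (G : choiceType).
Implicit Types (x y : {malg k[G]}).

Definition lin (V : lmodType k) (f : G -> V) x : V :=
  \sum_(a <- msupp x) x@_a *: f a.

Lemma linw (V : lmodType k) (f : G -> V) x (D : {fset G}) :
  (msupp x `<=` D)%fset -> lin f x = \sum_(a <- D) x@_a *: f a.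
Proof.
move=> xD; apply: (big_fset_incl _ xD) => a _ /mcoeff_outdom ->.
exact: scale0r.
Qed.

Lemma lin_is_linear (V : lmodType k) (f : G -> V) : linear (lin f).
Proof.
move=> c x y; pose D := (msupp x `|` msupp y)%fset.
rewrite (linw f (D := D) (x := x)) ?fsubsetUl //.
rewrite (linw f (D := D) (x := y)) ?fsubsetUr //.
rewrite (linw f (D := D)); last first.
  apply: fsubset_trans (msuppD_le _ _) _.
  by rewrite fsetSU // msuppZ_le.
rewrite scaler_sumr -big_split; apply: eq_bigr => a _ /=.
by rewrite mcoeffD mcoeffZ scalerDl scalerA.
Qed.
HB.instance Definition _ (V : lmodType k) (f : G -> V) :=
  GRing.isLinear.Build k {malg k[G]} V *:%R (lin f) (lin_is_linear f).

Lemma eq_lin (V : lmodType k) (f g : G -> V) x : f =1 g -> lin f x = lin g x.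
Proof. by move=> fg; apply: eq_bigr => a _; rewrite fg. Qed.

Lemma linU (V : lmodType k) (f : G -> V) a : lin f << a >> = f a.
Proof. by rewrite (linw f msuppU_le) big_seq_fset1 mcoeffUU scale1r. Qed.

Lemma linUid x : lin (fun a => << a >>) x = x.
Proof.
rewrite [RHS]monalgE; apply: eq_bigr => a _.
by apply/malgP => b; rewrite mcoeffZ !mcoeffU mulr_natr.
Qed.

Lemma lin_comp (V W : lmodType k) (g : {linear V -> W}) (f : G -> V) x :
  g (lin f x) = lin (g \o f) x.
Proof. by rewrite linear_sum; apply: eq_bigr => a _; rewrite /= linearZ_LR. Qed.

Lemma linD (V : lmodType k) (f g : G -> V) x :
  lin (fun a => f a + g a) x = lin f x + lin g x.
Proof. by rewrite -big_split; apply: eq_bigr => a _; rewrite scalerDr. Qed.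

Lemma linZ (V : lmodType k) c (f : G -> V) x :
  lin (fun a => c *: f a) x = c *: lin f x.
Proof.
by rewrite scaler_sumr; apply: eq_bigr => a _; rewrite !scalerA mulrC.
Qed.
End LinearExtension.

Section TwistedGroupAlgebra.
Variables (k : fieldType) (G : zmodType).

Record bicharacter := Bicharacter {
  bichar :> G -> G -> k;
  bicharDl : forall a b c, bichar (a + b) c = bichar a c * bichar b c;
  bicharDr : forall a b c, bichar a (b + c) = bichar a b * bichar a c;
  bichar_neq0 : forall a b, bichar a b != 0
}.

Variable chi : bicharacter.

Lemma bichar0r a : chi a 0 = 1.
Proof.
apply: (mulfI (bichar_neq0 chi a 0)).
by rewrite -bicharDr addr0 mulr1.
Qed.

Lemma bichar0l a : chi 0 a = 1.
Proof.
apply: (mulfI (bichar_neq0 chi 0 a)).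
by rewrite -bicharDl addr0 mulr1.
Qed.

(** A quantum torus when [G] is a lattice. The bicharacter is an argument so that the product can be
    inferred from the type. *)
Definition twalg of bicharacter : Type := {malg k[G]}.
Local Notation B := (twalg chi).
HB.instance Definition _ := GRing.Lmodule.on B.

Definition twmono (a : G) : B := << a >>.

Definition twmul (x y : B) : B :=
  lin (fun a => lin (fun b => chi a b *: twmono (a + b)) y) x.

Lemma twmulUU a b : twmul (twmono a) (twmono b) = chi a b *: twmono (a + b).
Proof. by rewrite /twmul !linU. Qed.

(** A bicharacter is a 2-cocycle: both sides carry the factor chi(a,b) chi(a,c) chi(b,c). *)
Fact twmulA : associative twmul.
Proof.
move=> x y z; rewrite /twmul [in RHS]lin_comp; apply: eq_lin => a /=.
rewrite [in RHS]lin_comp [in LHS]lin_comp; apply: eq_lin => b /=.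
rewrite linearZ /= linU lin_comp -linZ; apply: eq_lin => c /=.
rewrite linearZ /= linU !scalerA; congr (_ *: _); last by rewrite addrA.
by rewrite bicharDr bicharDl mulrC -!mulrA; congr (_ * _); rewrite mulrC.
Qed.

Fact twmul1 : left_id (twmono 0) twmul.
Proof.
move=> x; rewrite /twmul linU -[RHS]linUid; apply: eq_lin => a.
by rewrite bichar0l scale1r add0r.
Qed.

Fact twmulr1 : right_id (twmono 0) twmul.
Proof.
move=> x; rewrite /twmul -[RHS]linUid; apply: eq_lin => a.
by rewrite linU bichar0r scale1r addr0.
Qed.

Fact twmulDl : left_distributive twmul +%R.
Proof. by move=> x y z; rewrite /twmul linearD. Qed.

Fact twmulDr : right_distributive twmul +%R.
Proof.
by move=> x y z; rewrite /twmul -linD; apply: eq_lin => a; rewrite linearD.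
Qed.

Fact twone_neq0 : twmono 0 != 0.
Proof. by rewrite monalgU_eq0 oner_eq0. Qed.

HB.instance Definition _ := GRing.Zmodule_isNzRing.Build B
  twmulA twmul1 twmulr1 twmulDl twmulDr twone_neq0.

Fact twscaleAl (c : k) (x y : B) : c *: (x * y) = c *: x * y.
Proof. by rewrite [RHS]/GRing.mul /= /twmul linearZ. Qed.
HB.instance Definition _ := GRing.Lmodule_isLalgebra.Build k B twscaleAl.
Fact twscaleAr (c : k) (x y : B) : c *: (x * y) = x * (c *: y).
Proof.
rewrite /GRing.mul /= /twmul -linZ; apply: eq_lin => a.
by rewrite linearZ.
Qed.
HB.instance Definition _ := GRing.Lalgebra_isAlgebra.Build k B twscaleAr.

Definition twcoef (a : G) (x : B) : k := mcoeff a x.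

Lemma twmonoM a b : twmono a * twmono b = chi a b *: twmono (a + b).
Proof. exact: twmulUU. Qed.

Lemma twcoefU a b : twcoef a (twmono b) = (b == a)%:R.
Proof. exact: mcoeffU. Qed.

Fact twcoef_is_linear a : linear_for *%R (twcoef a).
Proof. by move=> c x y; rewrite /twcoef mcoeffD mcoeffZ. Qed.
HB.instance Definition _ a :=
  GRing.isLinear.Build k B k *%R (twcoef a) (twcoef_is_linear a).

Lemma twcoefM (x y : B) c :
  twcoef c (x * y) =
  \sum_(a <- msupp (x : {malg k[G]}))
    twcoef a x * (twcoef (c - a) y * chi a (c - a)).
Proof.
rewrite {1}/GRing.mul /= /twmul linear_sum; apply: eq_bigr => a _.
rewrite linearZ_LR; congr (_ * _).
rewrite linear_sum /=.
under eq_bigr => b _ do rewrite !linearZ_LR /= twcoefU.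
have [cy|cy] := boolP (c - a \in msupp (y : {malg k[G]})).
  rewrite (big_fsetD1 _ cy) /= big1_fset ?addr0.
    by rewrite [a + _]addrC subrK eqxx mulr1.
  move=> b; rewrite !inE => /andP[bc _] _.
  case: eqP => [ab|]; last by rewrite !mulr0.
  by case/eqP: bc; rewrite -ab addrC addKr.
rewrite /twcoef (mcoeff_outdom cy) mul0r big1_fset // => b yb _.
case: eqP => [ab|]; last by rewrite !mulr0.
by case/negP: cy; rewrite -ab addrC addKr.
Qed.

(** Only a strict partial order, since comparison by weight leaves distinct exponents of equal
    weight incomparable. Totality is a separate hypothesis where a leading exponent has to be
    found. *)
Record translation_order (lt : G -> G -> Prop) : Prop := TranslationOrder {
  tr_irr : forall a, ~ lt a a;
  tr_trans : forall a b c, lt a b -> lt b c -> lt a c;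
  tr_add : forall c a b, lt a b -> lt (a + c) (b + c)
}.

Definition lead (lt : G -> G -> Prop) (x : B) (a : G) : Prop :=
  twcoef a x != 0 /\ forall b, twcoef b x != 0 -> b = a \/ lt b a.

Section Lead.
Variable lt : G -> G -> Prop.
Hypothesis lt_order : translation_order lt.

Lemma lead_neq0 x a : lead lt x a -> x != 0.
Proof. by case=> xa _; apply: contraNneq xa => ->; rewrite linear0. Qed.

Lemma leadU a : lead lt (twmono a) a.
Proof.
split=> [|b]; rewrite twcoefU ?eqxx ?oner_eq0 //.
by case: (a =P b) => [->|_]; [left | rewrite eqxx].
Qed.

Lemma leadZ c x a : c != 0 -> lead lt x a -> lead lt (c *: x) a.
Proof.
move=> c0 [xa xlt]; split=> [|b]; rewrite linearZ /= mulf_eq0 negb_or.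
  by rewrite c0.
by case/andP=> _ /xlt.
Qed.

Lemma leadD x y a : lead lt x a -> (forall b, twcoef b y != 0 -> lt b a) ->
  lead lt (x + y) a.
Proof.
move=> [xa xlt] ylt; have ya : twcoef a y = 0.
  by apply/eqP/negPn/negP => /ylt; apply: tr_irr lt_order _.
split=> [|b]; rewrite linearD /=; first by rewrite ya addr0.
have [->|/xlt //] := eqVneq (twcoef b x) 0.
by rewrite add0r => /ylt; right.
Qed.

Lemma twcoefM_neq0 x y c : twcoef c (x * y) != 0 ->
  exists2 a, twcoef a x != 0 & twcoef (c - a) y != 0.
Proof.
rewrite twcoefM => H; apply: contrapT => nH; case/eqP: H.
rewrite big1_fset // => a _ _; have [->|xa] := eqVneq (twcoef a x) 0.
  by rewrite mul0r.
have [->|ya] := eqVneq (twcoef (c - a) y) 0; first by rewrite mul0r mulr0.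
by case: nH; exists a.
Qed.

(** If exponents a' of [x] and b' of [y] have the sum [a + b], neither can be strictly smaller; so
    the coefficient at [a + b] is a single product of nonzero scalars. *)
Lemma leadM x y a b : lead lt x a -> lead lt y b -> lead lt (x * y) (a + b).
Proof.
move=> [xa xlt] [yb ylt]; split=> [|c /twcoefM_neq0[a' xa' ya']].
  have ax : a \in msupp (x : {malg k[G]}) by rewrite -mcoeff_neq0.
  rewrite twcoefM (big_fsetD1 _ ax) /= addrAC subrr add0r big1_fset ?addr0.
    by rewrite !mulf_neq0 // bichar_neq0.
  move=> a'; rewrite in_fsetD1 -mcoeff_neq0 => /andP[aa' xa'] _.
  have [->|ya'] := eqVneq (twcoef (a + b - a') y) 0; first by rewrite mul0r mulr0.
  have [aa''|la'] := xlt _ xa'; first by rewrite aa'' eqxx in aa'.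
  have [eqb|lb] := ylt _ ya'.
    by case/eqP: aa'; apply: (addIr b); rewrite -{1}eqb addrC subrK.
  have := tr_add lt_order a' lb; rewrite subrK [b + _]addrC => lab.
  have := tr_add lt_order b la' => lba.
  by case: (tr_irr lt_order (tr_trans lt_order lab lba)).
have -> : c = a' + (c - a') by rewrite addrC subrK.
case: (xlt _ xa') (ylt _ ya') => [->|la] [->|lb]; [by left|right..].
- by rewrite ![a + _]addrC; apply: tr_add.
- exact: tr_add.
- apply: tr_trans lt_order _ _ _ (tr_add lt_order _ la) _.
  by rewrite ![a + _]addrC; apply: tr_add.
Qed.

Lemma exists_max (s : seq G) : (forall a b, a <> b -> lt a b \/ lt b a) ->
  s <> [::] ->
  exists2 a, a \in s & forall b, b \in s -> b = a \/ lt b a.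
Proof.
move=> tot; elim: s => // c [|d s] IH _.
  by exists c; rewrite ?mem_head // => b; rewrite inE => /eqP; left.
have [//|a sa as_] := IH.
have [->|/eqP/tot [ca|ac]] := eqVneq c a.
- exists a; rewrite ?mem_head // => b.
  by rewrite inE => /orP[/eqP|/as_]; [left|].
- exists a; first by rewrite inE sa orbT.
  by move=> b; rewrite inE => /orP[/eqP->|/as_ //]; right.
- exists c; first exact: mem_head.
  move=> b; rewrite inE => /orP[/eqP|/as_[->|ba]]; [by left|by right|right].
  exact: (tr_trans lt_order) ba ac.
Qed.

Lemma twcoef_sum_neq0 (J : finType) (P : pred J) (F : J -> B) e :
  twcoef e (\sum_(i | P i) F i) != 0 -> exists2 i, P i & twcoef e (F i) != 0.
Proof.
rewrite linear_sum /= => H; apply: contrapT => nH; case/eqP: H.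
rewrite big1 // => i Pi; apply: contrapT => /eqP Fi.
by apply: nH; exists i.
Qed.

Lemma lead_exists x : (forall a b, a <> b -> lt a b \/ lt b a) -> x != 0 ->
  exists a, lead lt x a.
Proof.
move=> tot x0.
have [|a xa ax] := exists_max (s := msupp (x : {malg k[G]})) tot.
  move=> s0; case/eqP: x0; apply/(@malgP G k) => a.
  rewrite mcoeff0; apply: mcoeff_outdom; apply/negP => ax.
  by have : a \in (msupp (x : {malg k[G]}) : seq G) by []; rewrite s0.
exists a; split; first by rewrite /twcoef mcoeff_neq0.
by move=> b; rewrite /twcoef mcoeff_neq0 => /ax.
Qed.

Lemma twalg_domain (x y : B) : (forall a b, a <> b -> lt a b \/ lt b a) ->
  x * y = 0 -> x = 0 \/ y = 0.
Proof.
move=> tot xy0; have [->|x0] := eqVneq x 0; first by left.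
have [->|y0] := eqVneq y 0; first by right.
have [a xa] := lead_exists tot x0; have [b yb] := lead_exists tot y0.
by have := lead_neq0 (leadM xa yb); rewrite xy0 eqxx.
Qed.
End Lead.
End TwistedGroupAlgebra.

Section LexicographicOrder.
Variable I : finType.
Implicit Types a b c : {ffun I -> int}.

(** This supplies the totality that the weight lacks, in order to show that the torus is a
    domain. *)
Definition lexlt a b : Prop := exists2 i, a i < b i &
  forall j, (enum_rank j < enum_rank i)%N -> a j = b j.

Lemma lexlt_order : translation_order lexlt.
Proof.
split=> [a [i]|a b c [i abi abj] [j bcj bck]|c a b [i abi abj]].
- by rewrite ltxx.
- case: (ltngtP (enum_rank i) (enum_rank j)) => ij.
  + exists i => [|l li]; first by rewrite -bck.
    by rewrite abj // bck // (ltn_trans li).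
  + exists j => [|l lj]; first by rewrite abj.
    by rewrite abj ?bck // (ltn_trans lj).
  + have {}ij : i = j by apply/enum_rank_inj/val_inj.
    subst j; exists i => [|l li]; first exact: lt_trans abi bcj.
    by rewrite abj ?bck.
- by exists i => [|j ji]; rewrite !ffunE ?ltrD2r // abj.
Qed.

Lemma lexlt_total a b : a <> b -> lexlt a b \/ lexlt b a.
Proof.
move=> ab; have [i abi] : exists i, a i != b i.
  apply: contrapT => nab; apply: ab; apply/ffunP => i; apply/eqP.
  by apply: contraT => abi; case: nab; exists i.
case: (@arg_minnP _ i (fun i => a i != b i) (fun i => enum_rank i) abi) => j abj jm.
have min l : (enum_rank l < enum_rank j)%N -> a l = b l.
  by move=> lj; apply/eqP; apply: contraTT lj => /jm; rewrite -leqNgt.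
have [lt_ab|lt_ba|eq_ab] := ltgtP (a j) (b j).
- by left; exists j.
- by right; exists j => // l /min.
- by rewrite eq_ab eqxx in abj.
Qed.
End LexicographicOrder.

(** * A path model of quantum matrices *)

Section Coproduct.
Variables (k : fieldType) (A : algType k) (q : k).
Hypothesis q_neq0 : q != 0.

(** In a product of two sums the quantum relations match the terms at (a, b) and (b, a) together,
    not one by one. *)
Lemma eq_sum_pairs (V : zmodType) (M : nat) (f g : nat -> nat -> V) :
  (forall a, f a a = g a a) ->
  (forall a b, (a < b)%N -> f a b + f b a = g a b + g b a) ->
  \sum_(a < M) \sum_(b < M) f a b = \sum_(a < M) \sum_(b < M) g a b.
Proof.
move=> fg1 fg2; elim: M => [|M IH]; first by rewrite !big_ord0.
have split (h : nat -> nat -> V) : \sum_(a < M.+1) \sum_(b < M.+1) h a b =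
    \sum_(a < M) \sum_(b < M) h a b + \sum_(a < M) (h a M + h M a) + h M M.
  rewrite big_ord_recr [\sum_(b < M.+1) h M b]big_ord_recr /= addrA.
  congr (_ + _); under eq_bigr => a _ do rewrite big_ord_recr.
  by rewrite !big_split /= addrA.
rewrite !split IH fg1; congr (_ + _ + _).
by apply: eq_bigr => a _; apply: fg2.
Qed.

(** A row relation involves one row of the left factor, so [y] is just a q-commuting sequence. Read
    on transposes, with the commuting factors exchanged, the lemma also gives the column relation of
    a product. *)
Lemma qmat_mul_row d (U : orderType d) M (y : nat -> A) (z : nat -> U -> A) j l :
  (j < l)%O -> (forall a b, (a < b)%N -> y a * y b = q *: (y b * y a)) ->
  qmat q z -> (forall a b j, y a * z b j = z b j * y a) ->
  (\sum_(a < M) y a * z a j) * (\sum_(a < M) y a * z a l) =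
  q *: ((\sum_(a < M) y a * z a l) * (\sum_(a < M) y a * z a j)).
Proof.
move=> jl yy qz yz.
have mulE j' l' : (\sum_(a < M) y a * z a j') * (\sum_(a < M) y a * z a l') =
    \sum_(a < M) \sum_(b < M) (y a * y b) * (z a j' * z b l').
  rewrite mulr_suml; apply: eq_bigr => a _; rewrite mulr_sumr.
  by apply: eq_bigr => b _; rewrite mulrA -[y a * _ * _]mulrA -yz !mulrA.
rewrite !mulE scaler_sumr; under [RHS]eq_bigr => a _ do rewrite scaler_sumr.
pose f a b := y a * y b * (z a j * z b l).
pose g a b := q *: (y a * y b * (z a l * z b j)).
apply: (@eq_sum_pairs _ M f g) => [a|a b ab]; rewrite /f /g.
  by rewrite (qrow qz) // -scalerAr.
rewrite (yy _ _ ab) (qdiag qz _ jl) ?ltEnat // (qanti qz (i := a)) ?ltEnat //.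
rewrite -!scalerAl mulrDr -!scalerAr !scalerDr !scalerA mulrBr divff //.
rewrite scalerBl scale1r.
by rewrite -addrA subrK addrC.
Qed.

(* The comultiplication of quantum matrices: a product of two quantum matrices
   whose entries commute with each other is again one. *)
Lemma qmat_mul d d' (T : orderType d) (U : orderType d') M
    (y : T -> nat -> A) (z : nat -> U -> A) :
  qmat q y -> qmat q z -> (forall i a b j, y i a * z b j = z b j * y i a) ->
  qmat q (fun i j => \sum_(a < M) y i a * z a j).
Proof.
move=> qy qz yz.
have mulE i h j l : (\sum_(a < M) y i a * z a j) * (\sum_(a < M) y h a * z a l) =
    \sum_(a < M) \sum_(b < M) (y i a * y h b) * (z a j * z b l).
  rewrite mulr_suml; apply: eq_bigr => a _; rewrite mulr_sumr.
  by apply: eq_bigr => b _; rewrite mulrA -[y i a * _ * _]mulrA -yz !mulrA.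
split=> [i j l jl|i h j ih|i h j l ih jl|i h j l ih jl].
- by apply: qmat_mul_row => // a b ab; apply: (qrow qy); rewrite ltEnat.
- have sumC i' : \sum_(a < M) y i' a * z a j = \sum_(a < M) z a j * y i' a.
    by apply: eq_bigr => a _; rewrite yz.
  rewrite !sumC.
  apply: (@qmat_mul_row _ T M (z^~ j) (fun a i => y i a)) => //.
    by move=> a b ab; apply: (qcol qz); rewrite ltEnat.
  exact: qmat_tr.
- rewrite !mulE.
  pose f a b := y i a * y h b * (z a l * z b j).
  pose g a b := y h a * y i b * (z a j * z b l).
  apply: (@eq_sum_pairs _ M f g) => [a|a b ab]; rewrite /f /g.
    by rewrite [y i a * _](qcol qy) // [z a j * _](qrow qz) // -scalerAl -scalerAr.
  rewrite (qdiag qy ih (j := a)) ?ltEnat // (qdiag qz _ jl (i := a)) ?ltEnat //.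
  rewrite (qanti qy ih (j := a)) ?ltEnat // (qanti qz _ jl (i := a)) ?ltEnat //.
  rewrite !mulrDl !mulrDr -!scalerAl -!scalerAr -!addrA.
  by rewrite !addrA [LHS](ACl (3*2*1)).
- rewrite !mulE scaler_sumr.
  under [X in _ = _ + X]eq_bigr => a _ do rewrite scaler_sumr.
  rewrite -big_split /=; under [RHS]eq_bigr => a _ do rewrite -big_split /=.
  pose f a b := y i a * y h b * (z a j * z b l).
  pose g a b := y h a * y i b * (z a l * z b j)
    + (q - q^-1) *: (y i a * y h b * (z a l * z b j)).
  apply: (@eq_sum_pairs _ M f g) => [a|a b ab]; rewrite /f /g.
    rewrite [y i a * _](qcol qy) // [z a j * _](qrow qz) //.
    rewrite -!scalerAl -!scalerAr !scalerA mulrBl.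
    by rewrite mulVf // scalerBl scale1r addrC subrK.
  rewrite (qdiag qy ih (j := a)) ?ltEnat // (qdiag qz _ jl (i := a)) ?ltEnat //.
  rewrite (qanti qy ih (j := a)) ?ltEnat // (qanti qz _ jl (i := a)) ?ltEnat //.
  rewrite !mulrDl !mulrDr -!scalerAl -!scalerAr !scalerDr -!addrA.
  by rewrite !addrA [LHS](ACl (5*2*4*1*3)).
Qed.
End Coproduct.

Section Block.
Variables (k : fieldType) (A : algType k) (q : k).
Hypothesis q_neq0 : q != 0.
Variables (m : nat) (s t : nat -> A) (lo hi : pred nat).

(* Row [h] of a lattice path model: a path that comes into this row in column [a]
   and leaves it in column [j <= a] contributes [s a * t j], and [a = m] is for the
   paths that start in this row.  With [lo j] for gamma_j <= h and [hi j] for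
   h <= delta_j, the mask confines the paths so that the sum for X_ij is empty
   unless gamma_j <= i <= delta_j. *)
Definition blk_mask a j :=
  [&& j <= a, a <= m, j < m, lo j, lo a || (a == m) & hi j || (j == a)]%N.

Definition blk a j : A := if blk_mask a j then s a * t j else 0.

Hypotheses (ss : forall a b, (a < b <= m)%N -> s a * s b = q *: (s b * s a))
  (tt : forall j l, (j < l < m)%N -> t j * t l = q *: (t l * t j))
  (st_ge : forall a l, (l <= a <= m)%N -> t l * s a = q^-1 *: (s a * t l))
  (st_lt : forall a l, (a < l < m)%N -> t l * s a = q *: (s a * t l))
  (hi_up : forall j l, (j <= l)%N -> hi j -> hi l).

Lemma blk_mul_ge a j b l : (j <= b <= m)%N ->
  (s a * t j) * (s b * t l) = q^-1 *: ((s a * s b) * (t j * t l)).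
Proof.
by move=> jb; rewrite mulrA -[s a * _ * _]mulrA st_ge // -scalerAr -scalerAl !mulrA.
Qed.

Lemma blk_mul_lt a j b l : (b < j < m)%N ->
  (s a * t j) * (s b * t l) = q *: ((s a * s b) * (t j * t l)).
Proof.
by move=> jb; rewrite mulrA -[s a * _ * _]mulrA st_lt // -scalerAr -scalerAl !mulrA.
Qed.

(** The mask treats [a] and [j] separately except for their order and the straight steps [j == a].
    Here [j] lies strictly left of both [a] and [b], so either side forces [hi j], and with it
    [hi l]. *)
Lemma blk_maskX a b j l : (a < b)%N -> (j < l <= a)%N ->
  (blk_mask a j && blk_mask b l) = (blk_mask a l && blk_mask b j).
Proof.
move=> ab /andP[jl la].
apply/idP/idP => /andP[/and5P[? ? ? ? /andP[? A1]] /and5P[? ? ? ? /andP[? A2]]].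
  have hj : hi j by case/orP: A1 => // /eqP ?; lia.
  have hl : hi l by apply: hi_up hj; lia.
  by apply/andP; split; apply/and5P; split; rewrite ?hl ?hj ?andbT //=; lia.
have hj : hi j by case/orP: A2 => // /eqP ?; lia.
have hl : hi l by apply: hi_up hj; lia.
by apply/andP; split; apply/and5P; split; rewrite ?hl ?hj ?andbT //=; lia.
Qed.

Lemma blk_qmat : qmat q blk.
Proof.
split=> [a j l jl|a b j ab|a b j l ab jl|a b j l ab jl]; rewrite /blk.
- case: ifP => [/and5P[ja am jm _ _]|_]; last by rewrite mul0r mulr0 scaler0.
  case: ifP => [/and5P[la _ lm _ _]|_]; last by rewrite mul0r mulr0 scaler0.
  move: jl; rewrite ltEnat /= => jl.
  rewrite !blk_mul_ge ?ja ?la // tt ?jl //.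
  by rewrite -!scalerAr !scalerA mulrC.
- case: ifP => [/and5P[ja am jm _ _]|_]; last by rewrite mul0r mulr0 scaler0.
  case: ifP => [/and5P[jb bm _ _ _]|_]; last by rewrite mul0r mulr0 scaler0.
  move: ab; rewrite ltEnat /= => ab.
  rewrite !blk_mul_ge ?ja ?jb // ss ?ab //.
  by rewrite -!scalerAl !scalerA mulrC.
- case: ifP => [/and5P[la am lm _ _]|_]; last by rewrite mul0r mulr0.
  case: ifP => [/and5P[jb bm jm _ _]|_]; last by rewrite mul0r mulr0.
  move: ab jl; rewrite !ltEnat /= => ab jl.
  rewrite !blk_mul_ge; try lia.
  rewrite ss; last by lia.
  rewrite [t j * t l]tt; last by lia.
  by rewrite -scalerAl -scalerAr.
- move: ab jl; rewrite !ltEnat /= => ab jl.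
  (* If [a < l], the entry at [(a, l)] is 0 and the two factors must commute: moving [t j] past
     [s b] gives [q^-1], moving [t l] past [s a] gives [q], and [ss] and [tt] make up for the
     difference. *)
  have [la|al] := leqP l a; last first.
    have -> : blk_mask a l = false by rewrite /blk_mask leqNgt al.
    rewrite mul0r scaler0 addr0.
    case: ifP => [/and5P[ja am jm _ _]|_]; last by rewrite mul0r mulr0.
    case: ifP => [/and5P[lb bm lm _ _]|_]; last by rewrite mul0r mulr0.
    rewrite blk_mul_ge ?blk_mul_lt; try lia.
    rewrite ss; last by lia.
    rewrite tt; last by lia.
    by rewrite -scalerAl -scalerAr !scalerA mulVf // mul1r.
  have := blk_maskX ab (introT andP (conj jl la)).
  have [M1|] := boolP (blk_mask a j && blk_mask b l); last first.
    rewrite negb_and => M1 /esym/negbT; rewrite negb_and => M2.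
    have -> : (if blk_mask a j then s a * t j else 0) *
       (if blk_mask b l then s b * t l else 0) = 0.
      by case/orP: M1 => /negbTE ->; rewrite ?mul0r ?mulr0.
    have -> : (if blk_mask b l then s b * t l else 0) *
       (if blk_mask a j then s a * t j else 0) = 0.
      by case/orP: M1 => /negbTE ->; rewrite ?mul0r ?mulr0.
    have -> : (if blk_mask a l then s a * t l else 0) *
       (if blk_mask b j then s b * t j else 0) = 0.
      by case/orP: M2 => /negbTE ->; rewrite ?mul0r ?mulr0.
    by rewrite scaler0 addr0.
  move=> /esym/andP[-> ->]; case/andP: M1 => M1 M2; rewrite M1 M2.
  move: M1 M2 => /and5P[ja am jm _ _] /and5P[lb bm lm _ _].
  rewrite !blk_mul_ge; try lia.
  rewrite ss; last by lia.
  rewrite [t j * t l]tt; last by lia.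
  rewrite -!scalerAl -!scalerAr !scalerA -scalerDl; congr (_ *: _).
  (* After reordering, the scalars are compared by q = q^-1 + (q - q^-1). *)
  by rewrite mulVf // mul1r mulfVK // addrC subrK.
Qed.
End Block.

Section Paths.
Variables (k : fieldType) (A : algType k) (q : k).
Hypothesis q_neq0 : q != 0.
Variables (n m : nat) (s t : nat -> nat -> A) (gam del : nat -> nat).

Definition path_blk h : nat -> nat -> A :=
  blk m (s h) (t h) (fun j => gam j <= h)%N (fun j => h <= del j)%N.

(** The entry at (i, j) sums over the paths that start in row [i] at the extra column [m], go down
    through the rows i, ..., h - 1, moving weakly to the left in each, and leave in column [j]. *)
Fixpoint path_mx h : nat -> nat -> A :=
  if h is h'.+1 then
    fun i j => if i == h' then path_blk h' m j
               else \sum_(a < m) path_mx h' i a * path_blk h' a j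
  else fun _ _ => 0.

Hypotheses
  (ss : forall h a b, (a < b <= m)%N -> s h a * s h b = q *: (s h b * s h a))
  (tt : forall h j l, (j < l < m)%N -> t h j * t h l = q *: (t h l * t h j))
  (st_ge : forall h a l, (l <= a <= m)%N ->
    t h l * s h a = q^-1 *: (s h a * t h l))
  (st_lt : forall h a l, (a < l < m)%N -> t h l * s h a = q *: (s h a * t h l))
  (ssC : forall h g a b, (h < g <= n)%N -> GRing.comm (s h a) (s g b))
  (ttC : forall h g a b, (h < g <= n)%N -> GRing.comm (t h a) (t g b))
  (stC : forall h g a b, (h < g <= n)%N -> GRing.comm (s h a) (t g b))
  (tsC : forall h g a b, (h < g <= n)%N -> GRing.comm (t h a) (s g b))
  (del_homo : {homo del : i j / (i <= j)%N}).

Lemma path_blk_qmat h : qmat q (path_blk h).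
Proof.
apply: blk_qmat => //; [exact: ss|exact: tt|exact: st_ge|exact: st_lt|].
by move=> j l /del_homo jl hj /=; apply: leq_trans hj jl.
Qed.

Lemma path_mx_row0 h i j : (h <= i)%N -> path_mx h i j = 0.
Proof.
elim: h i j => //= h IH i j hi; rewrite ifN; last by lia.
by rewrite big1 // => a _; rewrite IH ?mul0r //; lia.
Qed.

Lemma path_blk_col0 h a j : (m <= j)%N -> path_blk h a j = 0.
Proof. by move=> mj; rewrite /path_blk /blk ifN // /blk_mask; lia. Qed.

Lemma path_mx_col0 h i j : (m <= j)%N -> path_mx h i j = 0.
Proof.
case: h => //= h mj; rewrite path_blk_col0 //; case: eqP => // _.
by rewrite big1 // => a _; rewrite path_blk_col0 ?mulr0.
Qed.

Lemma path_mx_comm h i j x :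
  (forall g a, (g < h)%N -> GRing.comm (s g a) x /\ GRing.comm (t g a) x) ->
  GRing.comm (path_mx h i j) x.
Proof.
elim: h i j => [|h IH] i j /= Hx; first exact: commr_sym (commr0 _).
have cb a : GRing.comm (path_blk h a j) x.
  rewrite /path_blk /blk; case: ifP => _; last exact: commr_sym (commr0 _).
  by have [] := Hx h a (ltnSn _); have [] := Hx h j (ltnSn _); move=> _ h2 h1 _;
    apply/commr_sym/commrM; apply: commr_sym.
case: ifP => _; first exact: cb.
apply/commr_sym/commr_sum => a _; apply: commrM; apply: commr_sym => //.
by apply: IH => g b gh; apply: Hx; lia.
Qed.

Lemma path_mx_qmat h : (h <= n.+1)%N -> qmat q (path_mx h).
Proof.
elim: h => [|h IH] hn.
  by split=> *; rewrite /= ?mulr0 ?scaler0 ?addr0.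
have {}IH : qmat q (path_mx h) by apply: IH; lia.
(* [path_mx h] bordered by a 1 at [(h, m)], the start of the new row. Its row [h] and column [m]
   were 0, so the bordered matrix is still a quantum matrix. *)
pose y i a : A := if i == h then (a == m)%:R else path_mx h i a.
have yE i j : path_mx h.+1 i j = \sum_(a < m.+1) y i a * path_blk h a j.
  rewrite big_ord_recr /y /=; case: eqP => _.
    rewrite big1 ?add0r ?eqxx ?mul1r // => a _.
    by rewrite ltn_eqF ?mul0r.
  by rewrite path_mx_col0 // mul0r addr0.
have -> : path_mx h.+1 = fun i j => \sum_(a < m.+1) y i a * path_blk h a j.
  by apply/funext => i; apply/funext => j.
apply: qmat_mul => //; last 2 first.
- exact: path_blk_qmat.
- move=> i a b j; rewrite /y; case: eqP => _.
    by case: (a == m); rewrite ?mul1r ?mulr1 ?mul0r ?mulr0.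
  apply: path_mx_comm => g c gh; rewrite /path_blk /blk.
  case: ifP => _; last by split; apply: commr0.
  have ghn : (g < h <= n)%N by lia.
  by split; apply: commrM; auto.
split=> [i a c|i g a|i g a c|i g a c]; rewrite !ltEnat /= /y.
- move=> ac; case: eqP => _; last exact: (qrow IH).
  by case: (a =P m) => [am|_]; case: (c =P m) => [cm|_];
    rewrite ?mul0r ?mulr0 ?scaler0 //; lia.
- move=> ig; case: eqP => [ih|_].
    by rewrite ifN ?path_mx_row0 ?mulr0 ?mul0r ?scaler0 //; lia.
  case: eqP => _; last exact: (qcol IH).
  case: (a =P m) => [->|_]; last by rewrite mulr0 mul0r scaler0.
  by rewrite path_mx_col0 // mul0r mulr0 scaler0.
- move=> ig ac; case: eqP => [ih|_].
    by rewrite ifN ?path_mx_row0 ?mulr0 ?mul0r //; lia.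
  case: eqP => _; last exact: (qanti IH).
  by case: (a == m); rewrite ?mul1r ?mulr1 ?mul0r ?mulr0.
- move=> ig ac; case: eqP => [ih|_].
    by rewrite !ifN ?path_mx_row0 ?mulr0 ?mul0r ?scaler0 ?addr0 //; lia.
  case: eqP => _; last exact: (qdiag IH).
  (* If [a = m], then [c > m] lies beyond the last column. *)
  have -> : path_mx h i c * (a == m)%:R = 0.
    by case: (a =P m) => [am|_]; rewrite ?mulr0 // path_mx_col0 ?mul0r //; lia.
  by rewrite scaler0 addr0; case: (c == m); rewrite ?mul1r ?mulr1 ?mul0r ?mulr0.
Qed.

Hypothesis gam_homo : {homo gam : i j / (i <= j)%N}.

(** A step to the left in row [h], from [a] to [j < a], needs [h <= del j], hence [i <= del j]; the
    lower bound passes from [a] to [j] because [gam j <= gam a]. A straight step keeps the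
    column. *)
Lemma path_mx_zero h i j : ~~ (gam j <= i <= del j)%N -> path_mx h i j = 0.
Proof.
elim: h i j => //= h IH i j out; case: eqP => [ih|_].
  rewrite /path_blk /blk ifN // /blk_mask; apply: contra out.
  by case/and5P=> _ _ jm lo /andP[_ /orP[hi|/eqP]]; rewrite -?ih ?lo //; lia.
have [hi|ih] := leqP h i.
  by rewrite big1 // => a _; rewrite path_mx_row0 ?mul0r.
rewrite big1 // => a _; rewrite /path_blk /blk; case: ifP; last by rewrite mulr0.
case/and5P=> ja _ jm lo /andP[_ /orP[hi|/eqP <-]]; last by rewrite IH ?mul0r.
rewrite IH ?mul0r //; apply: contra out => /andP[ga id].
have := gam_homo ja; lia.
Qed.
End Paths.

(** * Exponents and weights in the quantum torus *)

Section Exponents.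
Variables n m : nat.

(** [(false, h, a)] is the variable [s] of row [h] and entering column [a], [(true, h, j)] the
    variable [t] of leaving column [j]; paths start in column [m]. *)
Definition tgen : finType := (bool * 'I_n.+1 * 'I_m.+1)%type.
Definition texp : zmodType := {ffun tgen -> int}.

(** Commutation depends on the differences [tpair g h - tpair h g]. Within a row they are 1 for two
    [s] or two [t] with [g] left of [h]; for [t] against [s] they are -1 if the column of [t] is at
    most that of [s], and 1 otherwise. Different rows commute. *)
Definition tpair (g h : tgen) : int :=
  if g.1.2 == h.1.2 then
    match g.1.1, h.1.1 with
    | false, true => if (h.2 <= g.2)%N then 1 else -1
    | true, false => 0
    | _, _ => Posz (g.2 < h.2)%N
    end
  else 0.

Definition tform (a b : texp) : int := \sum_g \sum_h a g * b h * tpair g h.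

Definition tunit (g : tgen) : texp := [ffun h => (h == g)%:R].

Lemma tformU g h : tform (tunit g) (tunit h) = tpair g h.
Proof.
rewrite /tform (bigD1 g) //= (bigD1 h) //= !ffunE !eqxx !mul1r.
rewrite !big1 ?addr0 // => [g' g'g|h' h'h].
  by rewrite big1 // => h' _; rewrite ffunE (negbTE g'g) !mul0r.
by rewrite !ffunE (negbTE h'h) mulr0 mul0r.
Qed.

Definition tidx (b : bool) (i j : nat) : tgen := (b, inord i, inord j).

(* The weights make a straight step down weigh 0, so that among the paths for X_ij
   the straight one has weight i * j and every other one strictly less. *)
Definition tweight (g : tgen) : int :=
  if g.1.1 then Posz (g.1.2 * g.2)
  else if g.2 == m :> nat then 0 else - Posz (g.1.2 * g.2).

Definition twt (a : texp) : int := \sum_g a g * tweight g.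

Lemma twtD a b : twt (a + b) = twt a + twt b.
Proof.
rewrite /twt -big_split; apply: eq_bigr => g _.
by rewrite /= ffunE mulrDl.
Qed.

Lemma twtU g : twt (tunit g) = tweight g.
Proof.
rewrite /twt (bigD1 g) //= ffunE eqxx mul1r big1 ?addr0 // => h hg.
by rewrite ffunE (negbTE hg) mul0r.
Qed.

Lemma twt_order : translation_order (fun a b => twt a < twt b).
Proof.
split=> [a|a b c|c a b]; rewrite ?ltxx //; first exact: lt_trans.
by rewrite !twtD ltrD2r.
Qed.

(* On the leading exponent of a monomial in the X_ij, the number of factors X_ij. *)
Definition tcount (i j : nat) (a : texp) : int :=
  a (tidx true i j) - a (tidx false i j).

Lemma tcountD i j a b : tcount i j (a + b) = tcount i j a + tcount i j b.
Proof. by rewrite /tcount !ffunE opprD addrACA. Qed.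

Definition tblkexp h a j : texp := tunit (tidx false h a) + tunit (tidx true h j).

(** The exponent of the straight path: in row [i] it goes from column [m] to column [j], and it
    stays there in all later rows. *)
Fixpoint tdiag h i j : texp :=
  if h is h'.+1 then
    if i == h' then tblkexp h' m j else tdiag h' i j + tblkexp h' j j
  else 0.

Lemma twt_blkexp h a j : (h <= n)%N -> (a <= m)%N -> (j < m)%N ->
  twt (tblkexp h a j) = Posz (h * j) - Posz (if a == m then 0%N else h * a)%N.
Proof.
move=> hn am jm; rewrite twtD !twtU /tweight /= !inordK ?ltnS //; last by lia.
by case: eqP => _; lia.
Qed.

Lemma twt_diag h i j : (i < h <= n.+1)%N -> (j < m)%N ->
  twt (tdiag h i j) = Posz (i * j).
Proof.
elim: h => // h IH /andP[ih hn] jm /=; case: eqP => [->|/eqP ih'].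
  by rewrite twt_blkexp ?eqxx ?subr0.
rewrite twtD IH ?twt_blkexp //; try lia.
by rewrite ltn_eqF // subrr addr0.
Qed.

Lemma tcount_blkexp h a j i' j' : (h <= n)%N -> (i' <= n)%N -> (a <= m)%N ->
  (j < m)%N -> (j' < m)%N ->
  tcount i' j' (tblkexp h a j) =
  (if h == i' then (j == j')%:R - (a == j')%:R else 0).
Proof.
move=> hn i'n am jm j'm; rewrite /tcount /tblkexp !ffunE /tidx !xpair_eqE /=.
rewrite -!val_eqE /= !inordK ?ltnS //; try lia.
case: (h =P i') => [->|hi].
  by rewrite eqxx /= add0r addr0 ![j' == _]eq_sym.
by rewrite (_ : (i' == h) = false) //= ?addr0 ?subrr //; apply/eqP => e; case: hi.
Qed.

(** A straight step contributes [s] and [t] in the same column, which cancel in [tcount]; the [t] of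
    row [i] remains. *)
Lemma tcount_diag h i j i' j' : (i < h <= n.+1)%N -> (i' <= n)%N ->
  (j < m)%N -> (j' < m)%N ->
  tcount i' j' (tdiag h i j) = ((i == i') && (j == j'))%:R.
Proof.
elim: h => // h IH /andP[ih hn] i'n jm j'm /=; case: eqP => [->|/eqP ih'].
  rewrite tcount_blkexp // [(m == j')]gtn_eqF // subr0.
  by case: eqP.
rewrite tcountD IH ?tcount_blkexp //; try lia.
by rewrite subrr if_same addr0.
Qed.
End Exponents.

Section Torus.
Variables (k : fieldType) (q : k) (n m : nat).
Hypothesis q_neq0 : q != 0.

Local Notation texp := (texp n m).
Local Notation tidx := (tidx n m).
Local Notation tblkexp := (tblkexp n m).
Local Notation tdiag := (tdiag n m).

Definition tbichar (a b : texp) : k := q ^ tform a b.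

Fact tbicharDl a b c : tbichar (a + b) c = tbichar a c * tbichar b c.
Proof.
rewrite /tbichar -expfzDr //; congr (_ ^ _).
rewrite -big_split; apply: eq_bigr => g _; rewrite -big_split.
by apply: eq_bigr => h _; rewrite /= ffunE !mulrDl.
Qed.

Fact tbicharDr a b c : tbichar a (b + c) = tbichar a b * tbichar a c.
Proof.
rewrite /tbichar -expfzDr //; congr (_ ^ _).
rewrite -big_split; apply: eq_bigr => g _; rewrite -big_split.
by apply: eq_bigr => h _; rewrite /= ffunE mulrDr !mulrDl.
Qed.

Fact tbichar_neq0 a b : tbichar a b != 0.
Proof. exact: expfz_neq0. Qed.

Definition torus : algType k :=
  twalg (Bicharacter tbicharDl tbicharDr tbichar_neq0).

Definition tmono (a : texp) : torus := twmono _ a.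
Definition tor_s (i a : nat) : torus := tmono (tunit (tidx false i a)).
Definition tor_t (i j : nat) : torus := tmono (tunit (tidx true i j)).

Lemma tmonoC a b : tmono a * tmono b = q ^ (tform a b - tform b a) *: (tmono b * tmono a).
Proof.
rewrite /tmono !twmonoM /= addrC scalerA; congr (_ *: _).
by rewrite /tbichar -expfzDr // subrK.
Qed.

Lemma tvarC b c i h j l z : tpair (tidx b i j) (tidx c h l)
   - tpair (tidx c h l) (tidx b i j) = z ->
  tmono (tunit (tidx b i j)) * tmono (tunit (tidx c h l)) =
  q ^ z *: (tmono (tunit (tidx c h l)) * tmono (tunit (tidx b i j))).
Proof. by move=> <-; rewrite tmonoC !tformU. Qed.

Lemma tss i a b : (a < b <= m)%N -> tor_s i a * tor_s i b = q *: (tor_s i b * tor_s i a).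
Proof.
move=> /andP[ab bm]; rewrite /tor_s (@tvarC _ _ _ _ _ _ 1) ?expr1z //.
by rewrite /tpair /= eqxx !inordK ?ltnS //; lia.
Qed.

Lemma ttt i j l : (j < l < m)%N -> tor_t i j * tor_t i l = q *: (tor_t i l * tor_t i j).
Proof.
move=> /andP[jl lm]; rewrite /tor_t (@tvarC _ _ _ _ _ _ 1) ?expr1z //.
by rewrite /tpair /= eqxx !inordK ?ltnS //; lia.
Qed.

Lemma tst_ge i a l : (l <= a <= m)%N ->
  tor_t i l * tor_s i a = q^-1 *: (tor_s i a * tor_t i l).
Proof.
move=> /andP[la am]; rewrite /tor_t (@tvarC _ _ _ _ _ _ (-1)) //.
by rewrite /tpair /= eqxx !inordK ?ltnS ?la //; lia.
Qed.

Lemma tst_lt i a l : (a < l < m)%N -> tor_t i l * tor_s i a = q *: (tor_s i a * tor_t i l).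
Proof.
move=> /andP[al lm]; rewrite /tor_t (@tvarC _ _ _ _ _ _ 1) ?expr1z //.
rewrite /tpair /= eqxx !inordK ?ltnS; [|lia..].
by have -> : (l <= a)%N = false by lia.
Qed.

Lemma tvarC0 b c i h j l : (h < i <= n)%N ->
  GRing.comm (tmono (tunit (tidx b h j))) (tmono (tunit (tidx c i l))).
Proof.
move=> /andP[hi i_n]; rewrite /GRing.comm (@tvarC _ _ _ _ _ _ 0) ?expr0z ?scale1r //.
have hi' : (inord h == inord i :> 'I_n.+1) = false.
  by apply/negbTE/eqP => /(congr1 val) /=; rewrite !inordK ?ltnS //; lia.
by rewrite /tpair /= hi' eq_sym hi'.
Qed.

Section Paths.
Variables (gam del : nat -> nat).
Hypotheses (gam_homo : {homo gam : i j / (i <= j)%N})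
  (del_homo : {homo del : i j / (i <= j)%N}).

Definition tpath : nat -> nat -> nat -> torus := path_mx m tor_s tor_t gam del.

Lemma tpath_qmat h : (h <= n.+1)%N -> qmat q (tpath h).
Proof.
move=> hn; apply: (@path_mx_qmat k torus q q_neq0 n m tor_s tor_t gam del
  tss ttt tst_ge tst_lt _ _ _ _ del_homo h hn).
- exact: (fun g i a b => @tvarC0 false false i g a b).
- exact: (fun g i a b => @tvarC0 true true i g a b).
- exact: (fun g i a b => @tvarC0 false true i g a b).
- exact: (fun g i a b => @tvarC0 true false i g a b).
Qed.

Lemma tpath_zero h i j : ~~ (gam j <= i <= del j)%N -> tpath h i j = 0.
Proof. exact: (path_mx_zero q_neq0 m tor_s tor_t gam_homo). Qed.

Lemma tblk_coef h a j e :
  twcoef e (path_blk m tor_s tor_t gam del h a j) != 0 ->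
  blk_mask m (fun j => gam j <= h)%N (fun j => h <= del j)%N a j /\
  e = tblkexp h a j.
Proof.
rewrite /path_blk /blk; case: ifP => [_|_]; last by rewrite linear0 eqxx.
rewrite /tor_s /tor_t /tmono twmonoM linearZ /= twcoefU => H; split=> //.
by apply/eqP; apply: contraNT H => /negbTE; rewrite eq_sym => ->; rewrite mulr0.
Qed.

(** A step from column [a] to [j <= a] in a row [h > i] changes the weight by h * (j - a), which is
    at most i * (j - a). *)
Lemma tpath_bound h i j e : (i < h <= n.+1)%N -> (j < m)%N ->
  twcoef e (tpath h i j) != 0 -> twt e <= Posz (i * j).
Proof.
rewrite /tpath; elim: h i j e => // h IH i j e /andP[ih hn] jm /=.
case: (i =P h) => [->|/eqP ih'].
  by move=> /tblk_coef[_ ->]; rewrite twt_blkexp // eqxx subr0.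
move=> /twcoef_sum_neq0[a _] /twcoefM_neq0[b xb /tblk_coef[/and5P[ja _ _ _ _] ebE]].
have -> : e = b + (e - b) by rewrite addrC subrK.
have ib : (i < h <= n.+1)%N by lia.
have := IH _ _ _ ib (ltn_ord a) xb.
have am := ltn_ord a.
by rewrite ebE twtD twt_blkexp ?(ltn_eqF am) //; nia.
Qed.

Lemma tpath_lead h i j : (i < h <= n.+1)%N -> (j < m)%N -> (gam j <= i <= del j)%N ->
  lead (fun a b => twt a < twt b) (tpath h i j) (tdiag h i j).
Proof.
rewrite /tpath; elim: h i j => // h IH i j /andP[ih hn] jm /andP[gi id] /=.
case: (i =P h) => [ihE|/eqP ih'].
  rewrite /path_blk /blk ifT.
    rewrite /tor_s /tor_t /tmono twmonoM; apply: leadZ; first exact: bichar_neq0.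
    exact: leadU.
  by rewrite /blk_mask -ihE gi id eqxx orbT leqnn jm ltnW.
rewrite (bigD1 (Ordinal jm)) //=; apply: leadD; first exact: twt_order.
  apply: leadM; first exact: twt_order.
    by apply: IH => //; rewrite ?gi //; lia.
  rewrite /path_blk /blk ifT; last by rewrite /blk_mask eqxx; lia.
  rewrite /tor_s /tor_t /tmono twmonoM; apply: leadZ; first exact: bichar_neq0.
  exact: leadU.
(* Here the last step is not straight: with [j < a] and [i < h] it loses h * (a - j), strictly more
   than i * (a - j). *)
move=> e /twcoef_sum_neq0[a aj] /twcoefM_neq0[b xb /tblk_coef[/and5P[ja _ _ _ _] ebE]].
have -> : e = b + (e - b) by rewrite addrC subrK.
have ib : (i < h <= n.+1)%N by lia.
have am := ltn_ord a.
have := tpath_bound ib am xb.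
have {}aj : (a : nat) != j by apply: contra aj => /eqP aj; apply/eqP/val_inj.
rewrite ebE (twtD b) (twtD (tdiag h i j)) !twt_blkexp ?(ltn_eqF am) ?(ltn_eqF jm) ?twt_diag //;
  try lia.
have : (j < a)%N by lia.
by nia.
Qed.
End Paths.
End Torus.

(** * Homomorphisms to the quantum torus *)

Section FreeEval.
Variables (k : fieldType) (I : choiceType) (A : algType k) (g : I -> A).

Definition word_eval (w : {fmonom I}) : A := \prod_(i <- (w : seq I)) g i.

Definition free_eval (x : freeAlg k I) : A := lin word_eval (x : {malg k[{fmonom I}]}).

Fact free_eval_linear : linear free_eval.
Proof. exact: lin_is_linear. Qed.
HB.instance Definition _ :=
  GRing.isLinear.Build k (freeAlg k I) A *:%R free_eval free_eval_linear.

Fact free_eval_monoid : monoid_morphism free_eval.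
Proof.
split=> [|x y].
  have -> : free_eval 1 = word_eval mone by exact: linU.
  by rewrite /word_eval fm1 big_nil.
have lincU c w : lin word_eval (<< c *g w >> : {malg k[{fmonom I}]}) = c *: word_eval w.
  by rewrite (linw _ msuppU_le) big_seq_fset1 mcoeffUU.
rewrite /free_eval.
rewrite [x * y](malgME (x : {malg k[{fmonom I}]}) (y : {malg k[{fmonom I}]})).
rewrite linear_sum mulr_suml; apply: eq_bigr => v _.
rewrite linear_sum mulr_sumr; apply: eq_bigr => w _ /=.
rewrite lincU -scalerAl -scalerAr scalerA; congr (_ *: _).
by rewrite /word_eval fmM big_cat.
Qed.
HB.instance Definition _ :=
  GRing.isMonoidMorphism.Build (freeAlg k I) A free_eval free_eval_monoid.

Lemma free_eval_gen i : free_eval (freeGen k i) = g i.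
Proof. by rewrite /free_eval linU /word_eval fmU big_seq1. Qed.
End FreeEval.

Section Specialization.
Variables (k : fieldType) (n m : nat) (q : k) (A : algType k).
Variable x : 'I_n -> 'I_m -> A.
Hypothesis qx : qmat q x.

Definition entry_eval (p : 'I_n * 'I_m) : A := x p.1 p.2.

Lemma free_eval_rel s : qmat_rel q s -> free_eval entry_eval s = 0.
Proof.
have f2 i j h l : free_eval entry_eval (freeGen k (i, j) * freeGen k (h, l)) =
    x i j * x h l.
  by rewrite [LHS]rmorphM /= !free_eval_gen.
have fZ c u : free_eval entry_eval (c *: u) = c *: free_eval entry_eval u.
  exact: linearZ.
have fB u v a b : free_eval entry_eval u = a -> free_eval entry_eval v = b ->
    a = b -> free_eval entry_eval (u - v) = 0.
  by move=> <- <- uv; apply: etrans (linearB _ _ _) _; apply/eqP; rewrite subr_eq0; apply/eqP.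
have fB' u v a b : free_eval entry_eval u = a -> free_eval entry_eval v = b ->
    free_eval entry_eval (u - v) = a - b.
  by move=> <- <-; apply: linearB.
have fZ2 c i j h l :
    free_eval entry_eval (c *: (freeGen k (i, j) * freeGen k (h, l))) =
    c *: (x i j * x h l).
  by rewrite -f2; apply: fZ.
case=> [i j l jl|i h j ih|i h j l ih jl|i h j l ih jl].
- exact: fB (f2 _ _ _ _) (fZ2 _ _ _ _ _) (qrow qx _ jl).
- exact: fB (f2 _ _ _ _) (fZ2 _ _ _ _ _) (qcol qx _ ih).
- exact: fB (f2 _ _ _ _) (f2 _ _ _ _) (qanti qx ih jl).
- apply: fB (fB' _ _ _ _ (f2 _ _ _ _) (f2 _ _ _ _)) (fZ2 _ _ _ _ _) _.
  by apply/eqP; rewrite subr_eq addrC; apply/eqP/(qdiag qx ih jl).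
Qed.

Definition special (y : OqM n m q) : A := qlift free_eval_rel y.
HB.instance Definition _ := GRing.RMorphism.copy special (qlift free_eval_rel).

Lemma specialX i j : special (qX q i j) = x i j.
Proof. by rewrite /special /qX qliftE; exact: free_eval_gen. Qed.

Lemma specialZ c y : special (c *: y) = c *: special y.
Proof.
rewrite -[y]qreprK -linearZ /special !qliftE; exact: (linearZ_LR (free_eval entry_eval)).
Qed.

Lemma special_minor (I : rowset m n) : special (qminor q I) =
  qdet q x (val I : m.-tuple 'I_n) (enum 'I_m).
Proof.
transitivity (qdet q x [seq row_of I r | r <- enum 'I_m] [seq id r | r <- enum 'I_m]).
  rewrite qdet_perm_sum /qminor [LHS]raddf_sum; apply: eq_bigr => s _.
  rewrite /= specialZ [special _]rmorph_prod; congr (_ *: _).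
  by apply: eq_bigr => r _; rewrite /= specialX.
by rewrite map_id /row_of map_tnth_enum.
Qed.
End Specialization.

(** * Leading exponents of minors *)

Fixpoint picks (U : Type) (t : seq U) : seq (U * seq U) :=
  if t is c :: t' then (c, t') :: [seq (p.1, c :: p.2) | p <- picks t'] else [::].

Definition diag_weight (s t : seq nat) : nat := (\sum_(p <- zip s t) p.1 * p.2)%N.

Lemma diag_weight_cons i s j t :
  diag_weight (i :: s) (j :: t) = (i * j + diag_weight s t)%N.
Proof. by rewrite /diag_weight big_cons. Qed.

Lemma picks_size (U : eqType) (t : seq U) p : p \in picks t -> size t = (size p.2).+1.
Proof.
elim: t p => // c t IH p; rewrite inE => /orP[/eqP-> //|/mapP[p' /IH /= -> ->]].
by [].
Qed.

Lemma picks_subseq (U : eqType) (t : seq U) p : p \in picks t ->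
  p.1 \in t /\ subseq p.2 t.
Proof.
elim: t p => // c t IH p; rewrite inE => /orP[/eqP->|/mapP[p' /IH[H1 H2] ->]].
  by split; [apply: mem_head | apply: subseq_cons].
by split; rewrite /= ?H1 ?orbT ?eqxx.
Qed.

(* The rearrangement inequality: among the ways to pair rows with columns, the
   diagonal one has strictly the largest sum of products. *)
Lemma diag_weight_picks i s c t p : path ltn i s -> path ltn c t ->
  size s = size t -> p \in picks t ->
  (i * p.1 + diag_weight s (c :: p.2) < i * c + diag_weight s t)%N.
Proof.
elim: t s c p => [|d t IH] [|r s] c p //= /andP[ir rs] /andP[cd dt] [st].
have is_ : path ltn i s.
  by case: s rs {st IH} => //= r' s /andP[rr' ->]; rewrite (ltn_trans ir).
rewrite inE => /orP[/eqP->|/mapP[[x u] xu ->]] /=; rewrite !diag_weight_cons.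
  by nia.
have := IH s d (x, u) is_ dt st xu => /=.
by nia.
Qed.

Section MinorLead.
Variables (k : fieldType) (q : k) (n m : nat).
Hypothesis q_neq0 : q != 0.

Section PsumCoef.
Variables (G : zmodType) (chi : bicharacter k G) (U : eqType).

Lemma twcoef_picksum (f : U -> seq U -> twalg chi) t e :
  twcoef e (picksum q f t) != 0 ->
  exists2 p, p \in picks t & twcoef e (f p.1 p.2) != 0.
Proof.
elim: t f => [|c t IH] f /=; first by rewrite linear0 eqxx.
rewrite linearB /= linearZ /=.
have [fe|fe] := eqVneq (twcoef e (f c t)) 0; last by exists (c, t); rewrite ?mem_head.
rewrite fe sub0r oppr_eq0 mulf_eq0 negb_or => /andP[_ /IH[p pt pe]].
by exists (p.1, c :: p.2) => //; rewrite inE map_f ?orbT.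
Qed.
End PsumCoef.

Variables gam del : nat -> nat.
Hypotheses (gam_homo : {homo gam : i j / (i <= j)%N})
  (del_homo : {homo del : i j / (i <= j)%N}).

Local Notation X := (tpath n m q_neq0 gam del n).

(** Each entry weighs at most row times column, and by [diag_weight_picks] no pairing of rows with
    columns outweighs the diagonal one. *)
Lemma qdet_bound s t e : all (fun i => i < n)%N s -> all (fun j => j < m)%N t ->
  sorted ltn s -> sorted ltn t -> size s = size t ->
  twcoef e (qdet q X s t) != 0 -> twt e <= Posz (diag_weight s t).
Proof.
elim: s t e => [|i s IH] [|c t] e //=.
  move=> _ _ _ _ _; rewrite /diag_weight big_nil.
  rewrite [1%:R](_ : _ = tmono q_neq0 0) // /tmono twcoefU.
  case: (0 =P e) => [<- _|_]; last by rewrite eqxx.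
  by rewrite /twt big1 // => g _; rewrite ffunE mul0r.
move=> /andP[i_n sn] /andP[cm tm] srt trt [st].
have srt' := path_sorted srt; have trt' := path_sorted trt.
have ih : (i < n <= n.+1)%N by rewrite i_n leqnSn.
rewrite diag_weight_cons linearB /= linearZ /= => H.
have [H1|H1] := eqVneq (twcoef e (X i c * qdet q X s t)) 0; last first.
  have [a xa] := twcoefM_neq0 H1; set b := e - a => yb.
  have -> : e = a + b by rewrite addrC subrK.
  have := tpath_bound ih cm xa; have := IH t b sn tm srt' trt' st yb.
  by rewrite twtD; move: (twt a) (twt b) => wa wb; clear; lia.
move: H; rewrite H1 sub0r oppr_eq0 mulf_eq0 negb_or => /andP[_ /twcoef_picksum[p pt]].
move=> /twcoefM_neq0[a xa]; set b := e - a => yb.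
have -> : e = a + b by rewrite addrC subrK.
have [p1 p2] := picks_subseq pt; have psz := picks_size pt.
have p1m : (p.1 < m)%N := allP tm _ p1.
have := tpath_bound ih p1m xa.
have p2m : all (fun j => j < m)%N (c :: p.2).
  by rewrite /= cm; apply/allP => z /(mem_subseq p2)/(allP tm).
have p2s : sorted ltn (c :: p.2).
  by apply: (@subseq_sorted _ ltn ltn_trans _ (c :: t)) => //; rewrite /= eqxx.
have := IH (c :: p.2) b sn p2m srt' p2s (etrans st psz) yb.
have := diag_weight_picks srt trt st pt.
by rewrite twtD; move: (twt a) (twt b) => wa wb; clear; lia.
Qed.

Definition diag_exp (s t : seq nat) : texp n m :=
  \sum_(p <- zip s t) tdiag n m n p.1 p.2.

Lemma diag_exp_cons i s j t :
  diag_exp (i :: s) (j :: t) = tdiag n m n i j + diag_exp s t.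
Proof. by rewrite /diag_exp big_cons. Qed.

Lemma twt_diag_exp s t : all (fun i => i < n)%N s -> all (fun j => j < m)%N t ->
  twt (diag_exp s t) = Posz (diag_weight s t).
Proof.
elim: s t => [|i s IH] [|j t]; try by
  rewrite /diag_exp /diag_weight !big_nil /twt big1 // => g _; rewrite ffunE mul0r.
move=> /andP[i_n sn] /andP[jm tm].
rewrite diag_exp_cons diag_weight_cons twtD IH // twt_diag //.
by rewrite i_n leqnSn.
Qed.

(** The bounds on the zipped pairs give each diagonal entry its leading exponent by [tpath_lead];
    the other terms of the expansion weigh strictly less by [diag_weight_picks]. *)
Lemma qdet_lead s t : all (fun i => i < n)%N s -> all (fun j => j < m)%N t ->
  sorted ltn s -> sorted ltn t -> size s = size t ->
  all (fun p => gam p.2 <= p.1 <= del p.2)%N (zip s t) ->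
  lead (fun a b => twt a < twt b) (qdet q X s t) (diag_exp s t).
Proof.
elim: s t => [|i s IH] [|c t] //=.
  by move=> _ _ _ _ _ _; rewrite /diag_exp big_nil; apply: leadU.
move=> /andP[i_n sn] /andP[cm tm] srt trt [st] /andP[gic gd].
have srt' := path_sorted srt; have trt' := path_sorted trt.
have ih : (i < n <= n.+1)%N by rewrite i_n leqnSn.
have ww := @twt_diag_exp (i :: s) (c :: t).
rewrite /= i_n sn cm tm in ww.
rewrite diag_exp_cons; apply: leadD; first exact: twt_order.
  apply: leadM; first exact: twt_order.
    exact: tpath_lead.
  exact: IH.
move=> e; rewrite -scaleNr linearZ /= mulf_eq0 negb_or => /andP[_ /twcoef_picksum[p pt]].
move=> /twcoefM_neq0[a xa]; set b := e - a => yb.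
have -> : e = a + b by rewrite addrC subrK.
have [p1 p2] := picks_subseq pt; have psz := picks_size pt.
have p1m : (p.1 < m)%N := allP tm _ p1.
have := tpath_bound ih p1m xa.
have p2m : all (fun j => j < m)%N (c :: p.2).
  by rewrite /= cm; apply/allP => z /(mem_subseq p2)/(allP tm).
have p2s : sorted ltn (c :: p.2).
  by apply: (@subseq_sorted _ ltn ltn_trans _ (c :: t)) => //; rewrite /= eqxx.
have := qdet_bound sn p2m srt' p2s (etrans st psz) yb.
have := diag_weight_picks srt trt st pt.
rewrite -diag_exp_cons ww // diag_weight_cons twtD.
by move: (twt a) (twt b) => wa wb; clear; lia.
Qed.
End MinorLead.

(** * Row sets and the homomorphism of an interval *)

Lemma row_of_lt m n (I : rowset m n) (r s : 'I_m) :
  (r < s)%N -> (row_of I r < row_of I s)%N.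
Proof.
pose t := val I : m.-tuple 'I_n.
have srt : sorted <%O (t : seq 'I_n) := valP I.
have E d (x : 'I_m) : nth d (t : seq 'I_n) x = row_of I x by rewrite -tnth_nth.
move=> rs; have := sorted_ltn_nth lt_trans (row_of I r) srt r s.
by rewrite !inE size_tuple !ltn_ord !E => /(_ isT isT rs); rewrite ltEord.
Qed.

Lemma row_of_le m n (I : rowset m n) (r s : 'I_m) :
  (r <= s)%N -> (row_of I r <= row_of I s)%N.
Proof.
rewrite leq_eqVlt => /orP[/eqP/val_inj-> //|/row_of_lt rs].
exact: ltnW (rs _ _).
Qed.

Lemma row_of_inj m n (I J : rowset m n) : row_of I =1 row_of J -> I = J.
Proof. by move=> IJ; apply/val_inj/eq_from_tnth => r; apply: IJ. Qed.

(** Pigeonhole: [s] cannot map the indices up to [r] into those below [r], nor the indices from [r]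
    on into those above [r]. *)
Lemma perm_no_squeeze m (s : 'S_m) (r : 'I_m) :
  (exists2 j : 'I_m, (j <= r)%N & (r <= s j)%N) /\
  (exists2 j : 'I_m, (r <= j)%N & (s j <= r)%N).
Proof.
have key (P Q : pred 'I_m) : (forall j, Q j -> P j) -> P r -> ~~ Q r ->
    exists2 j, P j & ~~ Q (s j).
  move=> QP Pr Qr; apply: contrapT => H.
  have : (#|[set j | P j]%SET| <= #|[set j | Q j]%SET|)%N.
    rewrite -(card_imset _ (@perm_inj _ s)) subset_leq_card //.
    apply/fintype.subsetP => x /imsetP[j]; rewrite !inE => Pj ->.
    by apply: contrapT => /negP Qj; apply: H; exists j.
  apply/negP; rewrite -ltnNge; apply: proper_card.
  apply/fintype.properP; split; last by exists r; rewrite inE.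
  by apply/fintype.subsetP => j; rewrite !inE; apply: QP.
split.
- have [] := key (fun j => j <= r)%N (fun j => j < r)%N.
  + by move=> j; apply: ltnW.
  + by [].
  + by rewrite ltnn.
  + by move=> j jr; rewrite -leqNgt => rj; exists j.
- have [] := key (fun j => r <= j)%N (fun j => r < j)%N.
  + by move=> j; apply: ltnW.
  + by [].
  + by rewrite ltnn.
  + by move=> j jr; rewrite -leqNgt => rj; exists j.
Qed.

(* The default [n] keeps [rowval I] nondecreasing beyond the last index. *)
Definition rowval m n (I : rowset m n) (j : nat) : nat :=
  nth n [seq val i | i <- (val I : m.-tuple 'I_n)] j.

Lemma rowvalE m n (I : rowset m n) (r : 'I_m) : rowval I r = row_of I r.
Proof.
by rewrite /rowval (nth_map (row_of I r)) ?size_tuple // /row_of -tnth_nth.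
Qed.

Lemma rowval_homo m n (I : rowset m n) : {homo rowval I : i j / (i <= j)%N}.
Proof.
move=> i j ij; have [jm|mj] := ltnP j m; last first.
  rewrite [rowval I j]nth_default ?size_map ?size_tuple //.
  have [im|mi] := ltnP i m; last by rewrite /rowval nth_default ?size_map ?size_tuple.
  by rewrite -[i]/(val (Ordinal im)) rowvalE ltnW.
have im := leq_ltn_trans ij jm.
rewrite -[i]/(val (Ordinal im)) -[j]/(val (Ordinal jm)) !rowvalE.
exact: row_of_le.
Qed.

Lemma prod_eq0 (R : nzRingType) (I : eqType) (s : seq I) (F : I -> R) i :
  i \in s -> F i = 0 -> \prod_(j <- s) F j = 0.
Proof.
move=> is_ Fi; case/splitPr: is_ => s1 s2.
by rewrite big_cat big_cons Fi /= mul0r mulr0.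
Qed.

Section Interval.
Variables (k : fieldType) (q : k) (n m : nat).
Hypothesis q_neq0 : q != 0.
Variables ga de : rowset m n.

Definition ivx (i : 'I_n) (j : 'I_m) : torus n m q_neq0 :=
  tpath n m q_neq0 (rowval ga) (rowval de) n i j.

Lemma ivx_qmat : qmat q ivx.
Proof.
have qX := tpath_qmat m q_neq0 (rowval ga) (@rowval_homo _ _ de) (leqnSn n).
split=> [i j l jl|i h j ih|i h j l ih jl|i h j l ih jl]; rewrite /ivx.
- exact: (qrow qX).
- exact: (qcol qX).
- exact: (qanti qX).
- exact: (qdiag qX).
Qed.

Definition ivphi (y : OqM n m q) : torus n m q_neq0 := special ivx_qmat y.
HB.instance Definition _ := GRing.RMorphism.copy ivphi (special ivx_qmat).

Lemma ivphiZ c y : ivphi (c *: y) = c *: ivphi y.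
Proof. exact: specialZ. Qed.

(** Every term of the permutation sum has a zero factor. If I_r < gamma_r, choose j <= r <= s(j);
    then I_j <= I_r < gamma_r <= gamma_{s(j)}. The bound delta is symmetric. *)
Lemma ivphi_zero (I : rowset m n) : ~~ (ga <= I <= de)%O -> ivphi (qminor q I) = 0.
Proof.
move=> out; rewrite /ivphi special_minor.
have -> : ((val I : m.-tuple 'I_n) : seq 'I_n) = [seq row_of I r | r <- enum 'I_m].
  by rewrite /row_of map_tnth_enum.
rewrite -[X in qdet _ _ _ X]map_id qdet_perm_sum big1 // => s _.
suff [r xr] : exists r, ivx (row_of I r) (s r) = 0.
  by rewrite (@prod_eq0 _ _ _ _ r) ?scaler0 // mem_index_enum.
suff [r Hr] : exists r, ~~ (row_of ga (s r) <= row_of I r <= row_of de (s r))%N.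
  by exists r; apply: tpath_zero; [exact: rowval_homo | rewrite !rowvalE].
move: out; rewrite negb_and !rowset_leE !negb_forall.
case/orP=> /existsP[r]; rewrite -ltnNge => Hr.
  have [[j jr rj] _] := perm_no_squeeze s r; exists j.
  have := row_of_le I jr; have := row_of_le ga rj; lia.
have [_ [j jr rj]] := perm_no_squeeze s r; exists j.
have := row_of_le I jr; have := row_of_le de rj; lia.
Qed.

Definition row_exp (I : rowset m n) : texp n m :=
  diag_exp n m [seq val i | i <- (val I : m.-tuple 'I_n)] (iota 0 m).

Lemma row_expE (I : rowset m n) :
  row_exp I = \sum_(r < m) tdiag n m n (row_of I r) r.
Proof.
rewrite /row_exp /diag_exp.
have -> : iota 0 m = [seq val r | r <- enum 'I_m] by rewrite val_enum_ord.
have -> : ((val I : m.-tuple 'I_n) : seq 'I_n) = [seq row_of I r | r <- enum 'I_m].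
  by rewrite /row_of map_tnth_enum.
by rewrite -map_comp zip_map big_map big_enum.
Qed.

Lemma qdet_map (A : algType k) (T T' U U' : Type) (f : T -> T') (g : U -> U')
   (x : T' -> U' -> A) s t :
  qdet q (fun i j => x (f i) (g j)) s t = qdet q x (map f s) (map g t).
Proof.
elim: s t => [|i s IH] t /=; first by case: t.
have picksum_map (F : U' -> seq U' -> A) : picksum q F (map g t) =
    picksum q (fun j u => F (g j) (map g u)) t.
  elim: t F => //= c t IHt F; congr (_ - _ *: _).
  by rewrite (IHt (fun x u => F x (g c :: u))).
by rewrite picksum_map; apply: eq_picksum => j u; rewrite IH.
Qed.

Lemma ivphi_lead (I : rowset m n) : (ga <= I <= de)%O ->
  lead (fun a b => twt a < twt b) (ivphi (qminor q I)) (row_exp I).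
Proof.
move=> /andP[gI Id]; rewrite /ivphi special_minor /ivx.
rewrite (@qdet_map _ _ _ _ _ val val (tpath n m q_neq0 (rowval ga) (rowval de) n)).
rewrite val_enum_ord; apply: qdet_lead.
- by apply/allP => _ /mapP[i _ ->]; apply: ltn_ord.
- by apply/allP => j; rewrite mem_iota.
- have := valP I; rewrite sorted_map; apply: sub_sorted => i j.
  by rewrite /= ltEord.
- exact: iota_ltn_sorted.
- by rewrite size_map size_tuple size_iota.
apply/allP => p.
have -> : iota 0 m = [seq val r | r <- enum 'I_m] by rewrite val_enum_ord.
have -> : ((val I : m.-tuple 'I_n) : seq 'I_n) = [seq row_of I r | r <- enum 'I_m].
  by rewrite /row_of map_tnth_enum.
rewrite -map_comp zip_map => /mapP[r _ ->] /=; rewrite !rowvalE.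
move: gI Id; rewrite !rowset_leE => /forallP/(_ r) -> /forallP/(_ r) ->.
by [].
Qed.

Lemma ivphi_neq0 (I : rowset m n) : (ga <= I <= de)%O -> ivphi (qminor q I) != 0.
Proof. by move=> /ivphi_lead /lead_neq0. Qed.

Lemma ivphi_prod (s : seq (rowset m n)) :
  all (fun I => ga <= I <= de)%O s ->
  lead (fun a b => twt a < twt b) (\prod_(I <- s) ivphi (qminor q I))
    (\sum_(I <- s) row_exp I).
Proof.
elim: s => [|I s IH] /=; first by rewrite !big_nil => _; apply: leadU.
move=> /andP[Is ss]; rewrite !big_cons; apply: leadM; first exact: twt_order.
  exact: ivphi_lead.
exact: IH.
Qed.

Lemma tcount_row_exp (I : rowset m n) (i : 'I_n) (j : 'I_m) :
  tcount i j (row_exp I) = (row_of I j == i)%:R.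
Proof.
have tcount_sum (J : Type) (r : seq J) (F : J -> texp n m) :
    tcount i j (\sum_(l <- r) F l) = \sum_(l <- r) tcount i j (F l).
  elim/big_rec2: _ => [|l a b _ <-]; last by rewrite tcountD.
  by rewrite /tcount !ffunE subrr.
rewrite row_expE tcount_sum (bigD1 j) //= big1 ?addr0 => [|r rj].
  by rewrite tcount_diag ?eqxx ?andbT //; [rewrite ltn_ord leqnSn|exact: ltnW].
rewrite tcount_diag //; [|by rewrite ltn_ord leqnSn|exact: ltnW].
by rewrite (negbTE rj : (r == j :> nat) = false) andbF.
Qed.

Hypothesis m_gt0 : (0 < m)%N.

(** The exponent determines the multiset of row indices in each column. Along a chain of row sets
    these indices are nondecreasing, so the multisets determine the chain; any one column, say the
    first, gives its length. *)
Lemma row_exp_inj (s s' : seq (rowset m n)) :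
  sorted <=%O s -> sorted <=%O s' ->
  \sum_(I <- s) row_exp I = \sum_(I <- s') row_exp I -> s = s'.
Proof.
move=> ss ss' eqE.
have eqr (j : 'I_m) : [seq row_of K j | K <- s] = [seq row_of K j | K <- s'].
  have srt (u : seq (rowset m n)) : sorted <=%O u -> sorted <=%O [seq row_of K j | K <- u].
    rewrite sorted_map; apply: sub_sorted => I J.
    by rewrite rowset_leE /= leEord => /forallP/(_ j).
  apply: (sorted_eq le_trans le_anti (srt _ ss) (srt _ ss')).
  apply/allP => i _; apply/eqP.
  have cnt (u : seq (rowset m n)) : tcount i j (\sum_(I <- u) row_exp I) =
      Posz (count_mem i [seq row_of K j | K <- u]).
    elim: u => [|I u IHu]; first by rewrite big_nil /tcount !ffunE subrr.
    by rewrite big_cons tcountD IHu tcount_row_exp /= PoszD natz.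
  by have := cnt s; rewrite eqE cnt => -[].
have szs : size s = size s' by have := congr1 size (eqr (Ordinal m_gt0)); rewrite !size_map.
case: s ss eqE eqr szs => [|I0 s] ss eqE eqr szs; first by case: s' szs {ss' eqE eqr}.
apply: (@eq_from_nth _ I0) => // l ls; apply: row_of_inj => j.
have := congr1 (fun u => nth (row_of I0 j) u l) (eqr j).
by rewrite !(nth_map I0) -?szs.
Qed.

(** Take a word [s] of largest weight among those with nonzero coefficient. Another word of that
    weight has a different leading exponent, so the coefficient at [E s] comes from [s] alone. *)
Lemma ivphi_free (S : seq (seq (rowset m n))) (c : seq (rowset m n) -> k) :
  uniq S -> all (sorted <=%O) S -> all (all (fun I => ga <= I <= de)%O) S ->
  \sum_(s <- S) c s *: \prod_(I <- s) ivphi (qminor q I) = 0 ->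
  {in S, forall s, c s = 0}.
Proof.
move=> uS sS aS sum0 s1 s1S; apply: contrapT => /eqP cs1.
pose E (s : seq (rowset m n)) : texp n m := \sum_(I <- s) row_exp I.
pose S' := [seq s <- S | c s != 0].
have s1S' : s1 \in S' by rewrite mem_filter cs1.
have [s [sS' smax]] : exists s, s \in S' /\
    forall s', s' \in S' -> twt (E s') <= twt (E s).
  clear -s1S'; move: s1S'; move: S' => S'; clear -E.
  elim: S' s1 => // u S0 IH s0 _.
  case: S0 IH => [|v S0] IH.
    by exists u; rewrite mem_head; split=> // s'; rewrite inE => /eqP->.
  have [s [sS0 sm]] := IH v (mem_head _ _).
  have [us|su] := leP (twt (E u)) (twt (E s)).
    exists s; split; first by rewrite inE sS0 orbT.
    by move=> s'; rewrite inE => /orP[/eqP->|/sm].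
  exists u; split; first exact: mem_head.
  move=> s'; rewrite inE => /orP[/eqP->//|/sm s's].
  exact: le_trans s's (ltW su).
move: sS'; rewrite mem_filter => /andP[cs sS1].
have /(congr1 (twcoef (E s))) := sum0.
rewrite linear0 linear_sum (bigD1_seq s) //= [X in _ + X]big1_seq ?addr0.
  rewrite linearZ /=; have [cE _] := ivphi_prod (allP aS _ sS1).
  by move/eqP; rewrite mulf_eq0 (negbTE cs) (negbTE cE).
move=> s' /andP[s's s'S]; rewrite linearZ /=.
have [->|cs'] := eqVneq (c s') 0; first by rewrite mul0r.
have [_ lt_s'] := ivphi_prod (allP aS _ s'S).
suff -> : twcoef (E s) (\prod_(I <- s') ivphi (qminor q I)) = 0 by rewrite mulr0.
apply: contrapT => /eqP /lt_s'[eqE|].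
  by case/eqP: s's; apply: row_exp_inj => //; apply: (allP sS).
rewrite ltNge => /negP; apply; apply: smax.
by rewrite mem_filter cs'.
Qed.
End Interval.

(** * Standard monomials span *)

Section Spanned.
Variables (k : fieldType) (A : lmodType k) (J : finType).
Implicit Types (P : J -> Prop) (v : J -> A).

(** The coefficients and their support are kept, rather than mere membership in a span, because the
    shape of the relations is read off from the support. *)
Definition spanned P v (x : A) : Prop :=
  exists2 c : J -> k, (forall j, c j != 0 -> P j) & x = \sum_j c j *: v j.

Lemma spanned0 P v : spanned P v 0.
Proof.
exists (fun=> 0) => [j|]; first by rewrite eqxx.
by rewrite big1 // => j _; rewrite scale0r.
Qed.

Lemma spannedD P v x y : spanned P v x -> spanned P v y -> spanned P v (x + y).
Proof.
move=> [c cP ->] [d dP ->]; exists (fun j => c j + d j) => [j|].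
  have [->|/cP //] := eqVneq (c j) 0.
  by rewrite add0r => /dP.
by rewrite -big_split; apply: eq_bigr => j _; rewrite scalerDl.
Qed.

Lemma spannedZ P v a x : spanned P v x -> spanned P v (a *: x).
Proof.
move=> [c cP ->]; exists (fun j => a * c j) => [j|].
  by rewrite mulf_eq0 negb_or => /andP[_ /cP].
by rewrite scaler_sumr; apply: eq_bigr => j _; rewrite scalerA.
Qed.

Lemma spanned_gen P v j : P j -> spanned P v (v j).
Proof.
move=> Pj; exists (fun i => (i == j)%:R) => [i|].
  by case: (i =P j) => [->|_] //; rewrite eqxx.
rewrite (bigD1 j) //= eqxx scale1r big1 ?addr0 // => i /negbTE ->.
by rewrite scale0r.
Qed.

Lemma spanned_sum P v (K : Type) (r : seq K) (F : K -> A) :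
  (forall i, spanned P v (F i)) -> spanned P v (\sum_(i <- r) F i).
Proof.
move=> FS; elim/big_rec: _ => [|i x _]; first exact: spanned0.
exact/spannedD.
Qed.
End Spanned.

Section QuantumMinors.
Variables (k : fieldType) (n m : nat) (q : k).

Lemma OqM_rel s : qmat_rel q s -> qproj (genIdeal_proper (freeAug_qmat_rel (q := q))) s = 0 :> OqM n m q.
Proof. by move=> qs; apply/eqP; rewrite qproj_eq0; apply: mem_genIdeal. Qed.

Lemma OqM_qmat : qmat q (@qX k n m q).
Proof.
pose pr := @qproj _ _ _ (genIdeal_proper (freeAug_qmat_rel (n := n) (m := m) (q := q))).
have prB u v : pr (u - v) = 0 -> pr u = pr v.
  by move=> H; apply/eqP; rewrite -subr_eq0 -H; apply/eqP/esym; apply: raddfB.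
have prM i j h l : pr (freeGen k (i, j) * freeGen k (h, l)) = qX q i j * qX q h l.
  exact: rmorphM.
have prZ c u : pr (c *: u) = c *: pr u by exact: linearZ.
split=> [i j l jl|i h j ih|i h j l ih jl|i h j l ih jl].
- rewrite -!prM -prZ; apply: prB; exact: OqM_rel (QRow q i jl).
- rewrite -!prM -prZ; apply: prB; exact: OqM_rel (QCol q j ih).
- rewrite -!prM; apply: prB; exact: OqM_rel (QAnti q ih jl).
- have /prB := OqM_rel (QDiag q ih jl).
  move=> H; apply/eqP; rewrite addrC -subr_eq; apply/eqP.
  rewrite -!prM -prZ -H; apply: esym; exact: raddfB.
Qed.

Lemma qminorE (I : rowset m n) :
  qminor q I = qdet q (@qX k n m q) (val I : m.-tuple 'I_n) (enum 'I_m).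
Proof.
transitivity (qdet q (@qX k n m q) [seq row_of I r | r <- enum 'I_m]
    [seq id r | r <- enum 'I_m]); first by rewrite qdet_perm_sum.
by rewrite map_id /row_of map_tnth_enum.
Qed.

Definition rsum (s : seq 'I_n) : nat := (\sum_(i <- s) i)%N.

Lemma rsum_cat s1 s2 : rsum (s1 ++ s2) = (rsum s1 + rsum s2)%N.
Proof. exact: big_cat. Qed.

Lemma rsum_perm s1 s2 : perm_eq s1 s2 -> rsum s1 = rsum s2.
Proof. exact: perm_big. Qed.

(** [u] drops some entries of [r2], all above [b], and takes as many from [r1], all at most [b];
    since [u <> r2], at least one entry is exchanged. *)
Lemma rsum_subseq_lt (b : nat) u r1 r2 :
  {in r1, forall i : 'I_n, (i <= b)%N} -> {in r2, forall i : 'I_n, (b < i)%N} ->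
  subseq u (r1 ++ r2) -> size u = size r2 -> u <> r2 -> (rsum u < rsum r2)%N.
Proof.
move=> r1b r2b /subseqP[mk szmk ->]; rewrite size_cat in szmk.
rewrite -[mk](cat_take_drop (size r1)) mask_cat; last first.
  by rewrite size_takel // szmk leq_addr.
set u1 := mask _ r1; set u2 := mask _ r2.
have u1r : subseq u1 r1 by apply: mask_subseq.
have u2r : subseq u2 r2 by apply: mask_subseq.
have [w pw] := perm_to_subseq u2r.
rewrite size_cat rsum_cat (rsum_perm pw) rsum_cat (perm_size pw) size_cat.
move=> szw ne.
have {}szw : size u1 = size w by lia.
have u1_gt0 : (0 < size u1)%N.
  rewrite lt0n; apply/eqP => /size0nil u10; apply: ne; rewrite u10 /=.
  have := size_subseq_leqif u2r => -[_ /esym]; rewrite (perm_size pw) size_cat.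
  by rewrite -szw u10 addn0 eqxx => /eqP.
have ub : (rsum u1 <= b * size u1)%N.
  have : {in u1, forall i : 'I_n, (i <= b)%N}.
    by move=> i /(mem_subseq u1r); apply: r1b.
  rewrite /rsum; elim: (u1) => [|i s IH] sb; first by rewrite big_nil.
  rewrite big_cons /= mulnS leq_add //; first by apply: sb; rewrite mem_head.
  by apply: IH => j js; apply: sb; rewrite inE js orbT.
have wb : (b.+1 * size w <= rsum w)%N.
  have : {in w, forall i : 'I_n, (b < i)%N}.
    by move=> i iw; apply: r2b; rewrite (perm_mem pw) mem_cat iw orbT.
  rewrite /rsum; elim: (w) => [|i s IH] sb; first by rewrite muln0.
  rewrite big_cons /= mulnS leq_add //; first by apply: sb; rewrite mem_head.
  by apply: IH => j js; apply: sb; rewrite inE js orbT.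
by move: wb; rewrite -szw; nia.
Qed.

Lemma rowset_of (s : seq 'I_n) : uniq s -> size s = m ->
  exists K : rowset m n, perm_eq (val K : m.-tuple 'I_n) s.
Proof.
move=> us szs.
have szt : size (sort <=%O s) == m by rewrite size_sort szs.
pose t : m.-tupleprod 'I_n := Tuple szt.
have st : sorted <%O (t : seq 'I_n).
  by rewrite /= lt_sorted_uniq_le sort_uniq us sort_le_sorted.
by exists (Sub t st); rewrite /= perm_sort.
Qed.
Hypothesis q_neq0 : q != 0.

Definition rows (I : rowset m n) : seq 'I_n := (val I : m.-tuple 'I_n).

Lemma size_rows I : size (rows I) = m.
Proof. exact: size_tuple. Qed.

Lemma rows_sorted I : sorted <%O (rows I).
Proof. exact: (valP I). Qed.

Lemma nth_rows I x0 (r : 'I_m) : nth x0 (rows I) r = row_of I r.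
Proof. by rewrite /rows -tnth_nth. Qed.

Lemma sorted_enum_ord : sorted <%O (enum 'I_m).
Proof.
have := iota_ltn_sorted 0 m; rewrite -val_enum_ord sorted_map.
by apply: sub_sorted => i j; rewrite ltEord.
Qed.

Lemma plucker_pair (I J : rowset m n) : ~~ (I <= J)%O ->
  spanned (fun p => (rsum (rows p.1) < rsum (rows I))%N /\
                    perm_eq (rows p.1 ++ rows p.2) (rows I ++ rows J))
    (fun p : rowset m n * rowset m n => qminor q p.1 * qminor q p.2 : OqM n m q)
    (qminor q I * qminor q J).
Proof.
rewrite rowset_leE negb_forall => /existsP[r]; rewrite -ltnNge => Jr.
(* J_0 < ... < J_r < I_r < ... < I_{m-1} is an increasing list of m + 1 rows, over which the Garnir
   relation is taken. *)
pose s1 := take r (rows I); pose r2 := drop r (rows I).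
pose r1 := take r.+1 (rows J); pose s2 := drop r.+1 (rows J).
have IE : rows I = s1 ++ r2 by rewrite cat_take_drop.
have JE : rows J = r1 ++ s2 by rewrite cat_take_drop.
have rm := ltn_ord r.
have sz1 : size r1 = r.+1 by rewrite size_takel // size_rows.
have sz2 : size r2 = (m - r)%N by rewrite size_drop size_rows.
have sz3 : size s1 = r by rewrite size_takel // size_rows ltnW.
have sz4 : size s2 = (m - r.+1)%N by rewrite size_drop size_rows.
have r1b : {in r1, forall i : 'I_n, (i <= row_of J r)%N}.
  move=> i /(nthP (row_of J r))[l]; rewrite sz1 ltnS => lr <-.
  have lm := leq_ltn_trans lr rm.
  rewrite nth_take // -[l]/(val (Ordinal lm)) nth_rows.
  exact: row_of_le.
have r2b : {in r2, forall i : 'I_n, (row_of J r < i)%N}.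
  move=> i /(nthP (row_of I r))[l]; rewrite sz2 => lr <-.
  apply: leq_trans Jr _; rewrite nth_drop.
  have lm : (r + l < m)%N by lia.
  rewrite -[(r + l)%N]/(val (Ordinal lm)) nth_rows.
  by apply: row_of_le; rewrite /= leq_addr.
rewrite !qminorE -/(rows I) -/(rows J) IE JE.
apply: (plucker q_neq0 (@spanned0 _ _ _ _ _) (@spannedD _ _ _ _ _)
  (@spannedZ _ _ _ _ _)).
- exact: OqM_qmat.
- exact: sorted_enum_ord.
- rewrite lt_sorted_pairwise pairwise_cat -!lt_sorted_pairwise.
  apply/and3P; split.
  + apply/allrelP => i j /r1b ib /r2b jb.
    by rewrite ltEord; apply: leq_ltn_trans jb.
  + exact: subseq_lt_sorted (take_subseq _ _) (rows_sorted J).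
  + exact: subseq_lt_sorted (drop_subseq _ _) (rows_sorted I).
- by rewrite size_enum_ord size_cat sz1 sz2; lia.
move=> u v ur2 usub puv.
(* Terms of the wrong size or with a repeated row vanish; the others are products of minors up to a
   scalar. *)
have [sz_u|sz_u] := eqVneq (size (s1 ++ u)) m; last first.
  by rewrite qdet_size ?mul0r ?size_enum_ord //; apply: spanned0.
have [un_u|un_u] := boolP (uniq (s1 ++ u)); last first.
  rewrite (qdet_nonuniq q_neq0 OqM_qmat sorted_enum_ord un_u) mul0r.
  exact: spanned0.
have [un_v|un_v] := boolP (uniq (v ++ s2)); last first.
  rewrite [X in _ * X](qdet_nonuniq q_neq0 OqM_qmat sorted_enum_ord un_v) mulr0.
  exact: spanned0.
have pIJ : perm_eq ((s1 ++ u) ++ (v ++ s2)) (rows I ++ rows J).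
  rewrite IE JE -!catA perm_cat2l !catA perm_cat2r.
  by rewrite (perm_trans puv) // perm_catC.
have sz_v : size (v ++ s2) = m.
  apply/eqP; rewrite -(eqn_add2l m) -{1}sz_u -size_cat (perm_size pIJ).
  by rewrite size_cat !size_rows.
have [K pK] := rowset_of un_u sz_u; have [L pL] := rowset_of un_v sz_v.
have {}pK : perm_eq (s1 ++ u) (rows K) by rewrite perm_sym.
have {}pL : perm_eq (v ++ s2) (rows L) by rewrite perm_sym.
have [c _ ->] := qdet_perm q_neq0 OqM_qmat pK; last exact: sorted_enum_ord.
have [d _ ->] := qdet_perm q_neq0 OqM_qmat pL; last exact: sorted_enum_ord.
rewrite -scalerAl -scalerAr; do 2!apply: spannedZ.
rewrite -!qminorE; apply: (@spanned_gen _ _ _ _ _ (K, L)); split=> /=.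
  rewrite -(rsum_perm pK) !rsum_cat ltn_add2l.
  apply: rsum_subseq_lt r1b r2b usub _ ur2; apply/eqP.
  by rewrite -(eqn_add2l (size s1)) -!size_cat sz_u -IE size_rows.
by rewrite -IE -JE; apply: perm_trans pIJ; apply: perm_cat; rewrite perm_sym.
Qed.

Lemma rsum_perm2 (I J K L : rowset m n) :
  perm_eq (rows I ++ rows J) (rows K ++ rows L) ->
  (rsum (rows I) + rsum (rows J) = rsum (rows K) + rsum (rows L))%N.
Proof. by move=> /rsum_perm; rewrite !rsum_cat. Qed.

Definition content (s : seq (rowset m n)) : seq 'I_n :=
  flatten [seq rows K | K <- s].

Lemma content_cat s1 s2 : content (s1 ++ s2) = content s1 ++ content s2.
Proof. by rewrite /content map_cat flatten_cat. Qed.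

Definition mprod (s : seq (rowset m n)) : OqM n m q := \prod_(K <- s) qminor q K.

Lemma mprod_cat s1 s2 : mprod (s1 ++ s2) = mprod s1 * mprod s2.
Proof. exact: big_cat. Qed.

Lemma mprod2 I J : mprod [:: I; J] = qminor q I * qminor q J.
Proof. by rewrite /mprod big_cons big_seq1. Qed.

(** Earlier factors count more, so shifting row sum from the left to the right factor of a
    neighbouring pair lowers the measure. *)
Fixpoint std_measure (s : seq (rowset m n)) : nat :=
  if s is K :: s' then (size s * rsum (rows K) + std_measure s')%N else 0%N.

Lemma std_measure_lt s1 s2 (I J K L : rowset m n) :
  (rsum (rows K) < rsum (rows I))%N ->
  (rsum (rows K) + rsum (rows L) = rsum (rows I) + rsum (rows J))%N ->
  (std_measure (s1 ++ K :: L :: s2) < std_measure (s1 ++ I :: J :: s2))%N.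
Proof.
move=> KI KL; elim: s1 => [|H s1 IH] /=; last by rewrite !size_cat /= ltn_add2l.
by nia.
Qed.

Lemma unsorted_split (s : seq (rowset m n)) : ~~ sorted <=%O s ->
  exists s1 I J s2, s = s1 ++ [:: I, J & s2] /\ ~~ (I <= J)%O.
Proof.
elim: s => // I [|J s] IH //=; rewrite negb_and.
case/orP=> [IJ|/IH[s1 [I' [J' [s2 [-> nle]]]]]].
  by exists [::], I, J, s.
by exists (I :: s1), I', J', s2.
Qed.

Lemma std_spanned d (s : seq (rowset m n)) : size s = d ->
  spanned (fun t : d.-tuple (rowset m n) =>
      sorted <=%O t /\ perm_eq (content t) (content s))
    (fun t : d.-tuple (rowset m n) => mprod t) (mprod s).
Proof.
have [M] := ubnP (std_measure s); elim: M s => // M IH s; rewrite ltnS => sM szs.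
have [ss|/unsorted_split[s1 [I [J [s2 [sE nle]]]]]] := boolP (sorted <=%O s).
  move: szs => /eqP szs.
  by apply: (@spanned_gen _ _ _ _ _ (Tuple szs)).
have mE K L : mprod (s1 ++ [:: K, L & s2]) =
    mprod s1 * (qminor q K * qminor q L) * mprod s2.
  by rewrite -mprod2 -mprod_cat -mprod_cat -catA.
rewrite sE mE.
have [c cP ->] := plucker_pair nle.
rewrite mulr_sumr mulr_suml; apply: spanned_sum => -[K L] /=.
rewrite -scalerAr -scalerAl.
have [->|/cP/= [KI pKL]] := eqVneq (c (K, L)) 0.
  by rewrite scale0r; apply: spanned0.
apply: spannedZ; rewrite -mE.
have [||e eP ->] := IH (s1 ++ [:: K, L & s2]).
- apply: leq_trans sM; rewrite sE; apply: std_measure_lt => //.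
  exact: rsum_perm2.
- by rewrite -szs sE !size_cat.
exists e => // t /eP[st pt]; split=> //; apply: perm_trans pt _.
rewrite !content_cat perm_cat2l /content /= !catA perm_cat2r.
exact: pKL.
Qed.
End QuantumMinors.

(** * Products of two minors *)

Section RowLattice.
Variables (m n : nat).
Implicit Types I J K : rowset m n.

Fact mktuple_sorted (f : 'I_m -> 'I_n) : {homo f : r s / (r < s)%N} ->
  sorted <%O (mktuple f : seq 'I_n).
Proof.
move=> f_homo; rewrite [mktuple f : seq _]/= sorted_map.
have := iota_ltn_sorted 0 m; rewrite -val_enum_ord sorted_map.
by apply: sub_sorted => r s /= rs; rewrite ltEord f_homo.
Qed.

Definition rowset_fun (f : 'I_m -> 'I_n) (fh : {homo f : r s / (r < s)%N}) :
  rowset m n := Sub (mktuple f : m.-tupleprod 'I_n) (mktuple_sorted fh).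

Lemma row_of_fun f fh r : row_of (@rowset_fun f fh) r = f r.
Proof. by rewrite /row_of /= tnth_mktuple. Qed.

Fact row_meet_homo I J :
  {homo (fun r => if (row_of I r <= row_of J r)%N then row_of I r else row_of J r) :
    r s / (r < s)%N}.
Proof.
move=> r s rs; have hI := row_of_lt I rs; have hJ := row_of_lt J rs.
have [h1|h1] := leqP (row_of I r) (row_of J r);
  have [h2|h2] := leqP (row_of I s) (row_of J s); lia.
Qed.

Fact row_join_homo I J :
  {homo (fun r => if (row_of I r <= row_of J r)%N then row_of J r else row_of I r) :
    r s / (r < s)%N}.
Proof.
move=> r s rs; have hI := row_of_lt I rs; have hJ := row_of_lt J rs.
have [h1|h1] := leqP (row_of I r) (row_of J r);
  have [h2|h2] := leqP (row_of I s) (row_of J s); lia.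
Qed.

Definition row_meet I J : rowset m n := rowset_fun (row_meet_homo I J).
Definition row_join I J : rowset m n := rowset_fun (row_join_homo I J).

Lemma row_of_meet I J r :
  row_of (row_meet I J) r = minn (row_of I r) (row_of J r) :> nat.
Proof. by rewrite row_of_fun; case: leqP. Qed.

Lemma row_of_join I J r :
  row_of (row_join I J) r = maxn (row_of I r) (row_of J r) :> nat.
Proof. by rewrite row_of_fun; case: leqP. Qed.

Lemma row_le_meet K I J : (K <= row_meet I J)%O = (K <= I)%O && (K <= J)%O.
Proof.
rewrite !rowset_leE; apply/forallP/andP => [H|[/forallP HI /forallP HJ] r].
  by split; apply/forallP => r; have := H r; rewrite row_of_meet leq_min => /andP[].
by rewrite row_of_meet leq_min HI HJ.
Qed.

Lemma row_join_le I J K : (row_join I J <= K)%O = (I <= K)%O && (J <= K)%O.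
Proof.
rewrite !rowset_leE; apply/forallP/andP => [H|[/forallP HI /forallP HJ] r].
  by split; apply/forallP => r; have := H r; rewrite row_of_join geq_max => /andP[].
by rewrite row_of_join geq_max HI HJ.
Qed.

Lemma row_meetDl : left_distributive row_meet row_join.
Proof.
move=> I J K; apply: row_of_inj => r; apply: val_inj => /=.
by rewrite row_of_meet !row_of_join !row_of_meet minn_maxl.
Qed.
End RowLattice.

Section IntervalImage.
Variables (k : fieldType) (disp : Order.disp_t) (P : finPOrderType disp).
Variables (B : algType k) (ga de : P) (f : P -> B).
Hypothesis f_out : forall K, ~~ (ga <= K <= de)%O -> f K = 0.
Variables (c : P * P -> k) (I J : P).
Hypothesis IJE : f I * f J = \sum_p c p *: (f p.1 * f p.2).

(* If [(ga, de)] occurs in the expansion of a product and [f] kills one of the two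
   factors, then its coefficient appears in a linear relation among the images of
   the standard products on the interval, which are independent. *)
Lemma interval_support :
  (forall p, c p != 0 -> (p.1 <= p.2)%O) ->
  (forall (S : seq (seq P)) (e : seq P -> k), uniq S -> all (sorted <=%O) S ->
    all (all (fun K => ga <= K <= de)%O) S ->
    \sum_(s <- S) e s *: \prod_(K <- s) f K = 0 -> {in S, forall s, e s = 0}) ->
  c (ga, de) != 0 -> (ga <= I <= de)%O && (ga <= J <= de)%O.
Proof.
move=> cle f_free cp; have gd := cle _ cp; apply: contraNT cp => nIJ.
pose in_p (K : P) := (ga <= K <= de)%O.
pose good (r : P * P) := [&& (r.1 <= r.2)%O, in_p r.1 & in_p r.2].
have := IJE.
have -> : f I * f J = 0.
  move: nIJ; rewrite negb_and => /orP[nr|nr].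
    by rewrite (f_out nr) mul0r.
  by rewrite [X in _ * X](f_out nr) mulr0.
rewrite (bigID good) /= [X in _ + X]big1 ?addr0; last first.
  move=> r; rewrite /good; have [->|/cle->] := eqVneq (c r) 0.
    by rewrite scale0r.
  rewrite /= negb_and => /orP[nr|nr].
    by rewrite (f_out nr) mul0r scaler0.
  by rewrite [X in _ * X](f_out nr) mulr0 scaler0.
pose S := [seq [:: r.1; r.2] | r <- enum good].
pose e (s : seq P) := if s is [:: K; L] then c (K, L) else 0.
have -> : \sum_(r | good r) c r *: (f r.1 * f r.2) =
    \sum_(s <- S) e s *: \prod_(K <- s) f K.
  rewrite big_map big_enum_cond /=; apply: eq_big => [r|r _].
    by rewrite andbT.
  by rewrite big_cons big_seq1; case: r.
move=> /esym sum0.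
have inS : [:: ga; de] \in S.
  apply/mapP; exists (ga, de) => //; rewrite mem_enum.
  by rewrite unfold_in /good /in_p /= gd !lexx.
apply/eqP; change (e [:: ga; de] = 0); apply: (f_free S e _ _ _ sum0) => //.
- by rewrite map_inj_uniq ?enum_uniq // => -[K L] [K' L'] /= [-> ->].
- apply/allP => s /mapP[r]; rewrite mem_enum => /and3P[r12 _ _] ->.
  by rewrite /= r12.
- apply/allP => s /mapP[r]; rewrite mem_enum => /and3P[_ r1 r2] ->.
  by rewrite /= -/(in_p _) -/(in_p _) r1 r2.
Qed.

(** A product that [f] does not kill has both factors in the interval; with [p.1 <= ga] and
    [de <= p.2] this leaves only [(ga, de)]. *)
Lemma interval_lead_coef :
  (forall p, c p != 0 -> (p.1 <= ga)%O && (de <= p.2)%O) ->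
  f I * f J != 0 -> c (ga, de) != 0.
Proof.
move=> cle; rewrite IJE; apply: contraNneq => c0; rewrite big1 // => p _.
have [->|cp] := eqVneq (c p) 0; first by rewrite scale0r.
have /andP[p1 p2] := cle _ cp.
have [pg1|/f_out->] := boolP (ga <= p.1 <= de)%O; last by rewrite mul0r scaler0.
have [pg2|/f_out->] := boolP (ga <= p.2 <= de)%O; last by rewrite mulr0 scaler0.
have eq1 : p.1 = ga by apply/le_anti; rewrite p1; case/andP: pg1.
have eq2 : p.2 = de by apply/le_anti; rewrite p2 andbT; case/andP: pg2.
by move: cp; rewrite [p]surjective_pairing eq1 eq2 c0 eqxx.
Qed.
End IntervalImage.

Section MinorProducts.
Variables (k : fieldType) (q : k) (n m : nat).
Hypotheses (q_neq0 : q != 0) (m_gt0 : (0 < m)%N).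

Lemma torus_domain (x y : torus n m q_neq0) : x * y = 0 -> x = 0 \/ y = 0.
Proof. exact: (twalg_domain (@lexlt_order _) (@lexlt_total _)). Qed.

Lemma ivphi_sum ga de (J : finType) (P : pred J) (F : J -> OqM n m q) :
  ivphi q_neq0 ga de (\sum_(j | P j) F j) = \sum_(j | P j) ivphi q_neq0 ga de (F j).
Proof. exact: raddf_sum. Qed.

Lemma ivphiM ga de (x y : OqM n m q) :
  ivphi q_neq0 ga de (x * y) = ivphi q_neq0 ga de x * ivphi q_neq0 ga de y.
Proof. exact: rmorphM. Qed.

Lemma ivphi_mprod ga de (s : seq (rowset m n)) :
  ivphi q_neq0 ga de (mprod q s) = \prod_(K <- s) ivphi q_neq0 ga de (qminor q K).
Proof. exact: rmorph_prod. Qed.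

Lemma minor_mul (I J : rowset m n) : exists c : rowset m n * rowset m n -> k,
  [/\ qminor q I * qminor q J = \sum_p c p *: (qminor q p.1 * qminor q p.2),
      forall p, c p != 0 -> [/\ (p.1 <= row_meet I J)%O, (row_join I J <= p.2)%O &
        perm_eq (rows p.1 ++ rows p.2) (rows I ++ rows J)]
    & c (row_meet I J, row_join I J) != 0].
Proof.
have [c0 c0P] := std_spanned q_neq0 (erefl (size [:: I; J])).
rewrite mprod2 => IJE.
pose h (p : rowset m n * rowset m n) : 2.-tuple (rowset m n) := [tuple p.1; p.2].
have h_bij : bijective h.
  exists (fun t : 2.-tuple _ => (tnth t ord0, tnth t (lift ord0 ord0))).
    by case.
  by move=> t; apply/val_inj; case/tupleP: t => K t; case/tupleP: t => L t; rewrite tuple0.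
pose c p := c0 (h p).
have IJE' : qminor q I * qminor q J = \sum_p c p *: (qminor q p.1 * qminor q p.2).
  apply: etrans IJE _; rewrite (reindex h); last exact/onW_bij.
  by apply: eq_bigr => p _; rewrite mprod2.
have ivE ga de : ivphi q_neq0 ga de (qminor q I) * ivphi q_neq0 ga de (qminor q J) =
    \sum_p c p *: (ivphi q_neq0 ga de (qminor q p.1) * ivphi q_neq0 ga de (qminor q p.2)).
  apply: etrans (esym (ivphiM _ _ _ _)) _; rewrite IJE'.
  apply: etrans (ivphi_sum _ _ _ _) _; apply: eq_bigr => p _.
  by rewrite ivphiZ ivphiM.
have cP p : c p != 0 -> [/\ (p.1 <= row_meet I J)%O, (row_join I J <= p.2)%O &
        perm_eq (rows p.1 ++ rows p.2) (rows I ++ rows J)].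
  move=> cp; have [_] := c0P _ cp; rewrite /content /= !cats0 => pc.
  suff /andP[/andP[p1I Ip2] /andP[p1J Jp2]] :
      (p.1 <= I <= p.2)%O && (p.1 <= J <= p.2)%O.
    by rewrite row_le_meet row_join_le p1I p1J Ip2 Jp2.
  apply: (interval_support (ivphi_zero q_neq0 (de := p.2)) (ivE p.1 p.2)).
  - by move=> r /c0P[] /=; rewrite andbT.
  - by move=> S e; apply: ivphi_free.
  - by rewrite -surjective_pairing.
exists c; split=> //.
set ga := row_meet I J; set de := row_join I J.
have /andP[gaI gaJ] : (ga <= I)%O && (ga <= J)%O by rewrite -row_le_meet le_refl.
have /andP[Ide Jde] : (I <= de)%O && (J <= de)%O by rewrite -row_join_le le_refl.
apply: (interval_lead_coef (ivphi_zero q_neq0 (de := de)) (ivE ga de)).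
  by move=> p /cP[-> ->].
have nI : ivphi q_neq0 ga de (qminor q I) != 0 by apply: ivphi_neq0; rewrite gaI.
have nJ : ivphi q_neq0 ga de (qminor q J) != 0 by apply: ivphi_neq0; rewrite gaJ.
by apply/eqP => /torus_domain[H|H]; [move: nI | move: nJ]; rewrite H eqxx.
Qed.
End MinorProducts.

(** * Criteria for algebras with a straightening law *)

Section Criteria.
Variables (k : fieldType) (A : algType k) (disp : Order.disp_t)
  (P : finPOrderType disp) (iota : P -> A).

Local Notation std := (std_monomial iota).

Lemma std_cat s t : std (s ++ t) = std s * std t.
Proof. exact: big_cat. Qed.

Hypothesis iota_gen : forall x, x \in genSubalg (range iota).
Hypothesis iota_straight : forall d (s : seq P), size s = d ->
  spanned (fun t : d.-tuple P => sorted <=%O t) (fun t : d.-tuple P => std t) (std s).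

Lemma word_form x : exists r : seq (k * seq P), x = \sum_(p <- r) p.1 *: std p.2.
Proof.
have /asboolP := iota_gen x.
pose W : {pred A} := fun y => `[< exists r : seq (k * seq P), y = \sum_(p <- r) p.1 *: std p.2 >].
move=> /(_ W) WP; apply/asboolP; apply: WP.
  split=> [|c y z|y z].
  - by apply/asboolP; exists [:: (1, [::])]; rewrite big_seq1 scale1r /std big_nil.
  - move=> /asboolP[r ->] /asboolP[s ->]; apply/asboolP.
    exists ([seq (c * p.1, p.2) | p <- r] ++ s).
    rewrite big_cat big_map scaler_sumr; congr (_ + _).
    by apply: eq_bigr => p _; rewrite scalerA.
  - move=> /asboolP[r ->] /asboolP[s ->]; apply/asboolP.
    exists [seq (p.1 * p'.1, p.2 ++ p'.2) | p <- r, p' <- s].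
    rewrite big_allpairs_dep mulr_suml; apply: eq_bigr => p _.
    rewrite mulr_sumr; apply: eq_bigr => p' _.
    by rewrite std_cat -scalerAl -scalerAr scalerA.
move=> _ [c _ <-]; apply/asboolP; exists [:: (1, [:: c])].
by rewrite big_seq1 scale1r /std big_seq1.
Qed.

Lemma sorted_form x : exists r : seq (k * seq P),
  all (fun p => sorted <=%O p.2) r /\ x = \sum_(p <- r) p.1 *: std p.2.
Proof.
have [r ->] := word_form x; elim: r => [|[a s] r [r' [sr' rE]]].
  by exists [::]; rewrite !big_nil.
have [c cP sE] := iota_straight (erefl (size s)).
exists ([seq (a * c t, tval t) | t <- enum {: (size s).-tuple P} & sorted <=%O (tval t)] ++ r').
split.
  rewrite all_cat sr' andbT; apply/allP => _ /mapP[t + ->] /=.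
  by rewrite mem_filter => /andP[].
rewrite big_cons rE big_cat; congr (_ + _) => /=.
rewrite sE big_map big_filter big_enum_cond scaler_sumr /= [RHS]big_mkcond.
apply: eq_bigr => t _ /=; case: ifP => [_|/negP st]; first by rewrite scalerA.
by have [->|/cP] := eqVneq (c t) 0; first by rewrite scale0r scaler0.
Qed.

Lemma normal_form x : exists (S : seq (seq P)) (c : seq P -> k),
  [/\ uniq S, all (sorted <=%O) S & x = \sum_(s <- S) c s *: std s].
Proof.
have [r [sr ->]] := sorted_form x.
exists (undup [seq p.2 | p <- r]), (fun s => \sum_(p <- r | p.2 == s) p.1).
split; first exact: undup_uniq.
  by apply/allP => s; rewrite mem_undup => /mapP[p pr ->]; apply: (allP sr).
under [RHS]eq_bigr => s _ do rewrite scaler_suml.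
rewrite (exchange_big_dep xpredT) //= !big_seq; apply: eq_bigr => p pr.
have p2 : p.2 \in undup [seq p.2 | p <- r] by rewrite mem_undup map_f.
rewrite (eq_bigl (pred1 p.2)) => [|s]; last by rewrite /= eq_sym.
by rewrite -big_filter filter_pred1_uniq ?undup_uniq // big_seq1.
Qed.

Lemma domain_criterion (B : algType k) (rho : {rmorphism A -> B}) :
  (forall c x, rho (c *: x) = c *: rho x) ->
  (forall (S : seq (seq P)) (c : seq P -> k), uniq S -> all (sorted <=%O) S ->
    \sum_(s <- S) c s *: rho (std s) = 0 -> {in S, forall s, c s = 0}) ->
  (forall x y : B, x * y = 0 -> x = 0 \/ y = 0) ->
  std_monomials_free iota /\ integral_domain A.
Proof.
move=> rhoZ rho_free B_domain.
have rho_sum (S : seq (seq P)) (c : seq P -> k) :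
    rho (\sum_(s <- S) c s *: std s) = \sum_(s <- S) c s *: rho (std s).
  by rewrite rmorph_sum; apply: eq_bigr => s _; rewrite rhoZ.
have rho_inj x : rho x = 0 -> x = 0.
  have [S [c [uS sS ->]]] := normal_form x.
  rewrite rho_sum => /(rho_free _ _ uS sS) c0.
  by rewrite big_seq big1 // => s /c0 ->; rewrite scale0r.
split=> [S c uS sS S0|].
  by apply: rho_free => //; rewrite -rho_sum S0 rmorph0.
split=> [|x y xy0]; first exact: oner_neq0.
by case: (B_domain (rho x) (rho y)); rewrite -?rmorphM ?xy0 ?rmorph0 //;
  move=> /rho_inj; auto.
Qed.

Section Grading.
Variable D : nat -> set A.
Hypotheses (D0 : forall d, D d 0)
  (DZD : forall d c x y, D d x -> D d y -> D d (c *: x + y))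
  (D1 : D 0%N 1) (DM : forall d e x y, D d x -> D e y -> D (d + e)%N (x * y))
  (D_iota : forall c, D 1%N (iota c))
  (D_spanned : forall d x, D d x ->
     spanned (fun t : d.-tuple P => sorted <=%O t) (fun t : d.-tuple P => std t) x)
  (free : std_monomials_free iota).

Lemma D_std s : D (size s) (std s).
Proof.
elim: s => [|c s IH]; rewrite /std_monomial ?big_nil //.
by rewrite big_cons -[size _]add1n; apply: DM.
Qed.

Lemma D_sum d (r : seq (k * seq P)) : all (fun p => size p.2 == d) r ->
  D d (\sum_(p <- r) p.1 *: std p.2).
Proof.
elim: r => [|p r IH] /=; first by rewrite big_nil.
move=> /andP[/eqP pd rd]; rewrite big_cons; apply: DZD; last exact: IH.
by rewrite -pd; apply: D_std.
Qed.

Definition sorted_words d : seq (seq P) :=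
  [seq tval t | t <- enum {: d.-tuple P} & sorted <=%O (tval t)].

Lemma size_sorted_words d s : s \in sorted_words d -> size s = d /\ sorted <=%O s.
Proof.
by case/mapP => t; rewrite mem_filter => /andP[st _] ->; rewrite size_tuple.
Qed.

Lemma D_words d x : D d x -> exists c : seq P -> k,
  x = \sum_(s <- sorted_words d) c s *: std s.
Proof.
case/D_spanned => c cP ->.
exists (fun s => if insub s is Some t then c t else 0).
rewrite big_map big_filter big_enum_cond /= [RHS]big_mkcond.
apply: eq_bigr => t _; rewrite /= valK; case: ifP => // /negP st.
by have [->|/cP] := eqVneq (c t) 0; first by rewrite scale0r.
Qed.

Definition words_lt N : seq (seq P) :=
  flatten [seq sorted_words i | i <- seq.iota 0 N].

Lemma words_ltS N : words_lt N.+1 = words_lt N ++ sorted_words N.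
Proof.
by rewrite /words_lt -addn1 iotaD map_cat flatten_cat /= cats0.
Qed.

Lemma size_words_lt N s : s \in words_lt N -> (size s < N)%N /\ sorted <=%O s.
Proof.
move=> /flattenP[_ /mapP[i + ->]]; rewrite mem_iota => iN.
by case/size_sorted_words => -> ->.
Qed.

Lemma uniq_words_lt N : uniq (words_lt N).
Proof.
elim: N => // N IH; rewrite words_ltS cat_uniq IH /=; apply/andP; split.
  apply/hasPn => s /size_sorted_words[sN _]; apply/negP => /size_words_lt[].
  by rewrite sN ltnn.
rewrite map_inj_uniq; last exact: val_inj.
by rewrite filter_uniq // enum_uniq.
Qed.

(** Different degrees involve words of different lengths, so the coefficients glue to one function
    [e] and the sum becomes a single relation among distinct standard monomials. *)
Lemma D_direct N (f : nat -> A) : (forall i, D i (f i)) ->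
  \sum_(i < N) f i = 0 -> forall i, (i < N)%N -> f i = 0.
Proof.
move=> fD f0.
have /choice[c cE] i : exists c : seq P -> k,
    f i = \sum_(s <- sorted_words i) c s *: std s by apply: D_words.
pose e s := c (size s) s.
have sumE : \sum_(s <- words_lt N) e s *: std s = \sum_(i < N) f i.
  elim: N {f0} => [|N IH]; first by rewrite big_nil big_ord0.
  rewrite words_ltS big_cat big_ord_recr IH /= cE; congr (_ + _).
  by rewrite !big_seq; apply: eq_bigr => s /size_sorted_words[sN _]; rewrite /e sN.
have e0 := free (uniq_words_lt N) (introT allP (fun s H => (size_words_lt H).2))
  (etrans sumE f0).
move=> i iN; rewrite cE big_seq big1 // => s si.
have [sN _] := size_sorted_words si.
have -> : c i s = e s by rewrite /e sN.
rewrite e0 ?scale0r //; apply/flattenP; exists (sorted_words i) => //.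
by apply: map_f; rewrite mem_iota.
Qed.

Lemma grading_criterion : algebra_grading D.
Proof.
split=> [d|||N f].
- by split; [apply: D0 | apply: DZD].
- by split; [apply: D1 | apply: DM].
- move=> x; have [S [c [uS _ ->]]] := normal_form x.
  pose N := (\max_(s <- S) size s).+1.
  exists N, (fun i => \sum_(s <- S | size s == i) c s *: std s); split=> [i|].
    rewrite -big_filter -(big_map (fun s => (c s, s)) xpredT (fun p => p.1 *: std p.2)).
    apply: D_sum; apply/allP => _ /mapP[s + ->]; rewrite mem_filter.
    by case/andP.
  rewrite (exchange_big_dep xpredT) //= !big_seq; apply: eq_bigr => s sS.
  have sN : (size s < N)%N by rewrite ltnS; apply: leq_bigmax_seq.
  rewrite (bigD1 (Ordinal sN)) //= big1 ?addr0 // => i /andP[/eqP si].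
  by case/eqP; apply: val_inj.
- exact: D_direct.
Qed.
End Grading.

Section ConditionC.
Variables (meet join : P -> P -> P) (d : nat) (ns : d.-tuple nat)
  (e : P -> d.-tuple nat).
Hypotheses (free : std_monomials_free iota)
  (lattice : distributive_lattice meet join)
  (d_gt0 : (0 < d)%N) (ns_ge2 : all (leq 2) ns)
  (embedding : chain_embedding meet join ns e)
  (iota_mul : forall a b, exists c : P * P -> k,
    [/\ iota a * iota b = \sum_p c p *: (iota p.1 * iota p.2),
        forall p, c p != 0 -> [/\ (p.1 <= meet a b)%O, (join a b <= p.2)%O &
          perm_eq (e p.1 ++ e p.2) (e a ++ e b)]
      & c (meet a b, join a b) != 0]).

Lemma meet_leE a b c : (c <= meet a b)%O = (c <= a)%O && (c <= b)%O.
Proof. by case: lattice. Qed.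

Lemma join_leE a b c : (join a b <= c)%O = (a <= c)%O && (b <= c)%O.
Proof. by case: lattice. Qed.

(* The content [e a ++ e b] determines [b] once [a] is known, which turns weak
   inequalities into strict ones. *)
Lemma content_inj a b c d' : perm_eq (e a ++ e b) (e c ++ e d') ->
  (a = c -> b = d') /\ (b = d' -> a = c).
Proof.
have [e_inj _ _ _ e_sorted] := embedding.
have key x y : perm_eq (e x) (e y) -> x = y.
  move=> xy; apply/e_inj/val_inj; apply: (sorted_eq leq_trans) xy; rewrite ?e_sorted //.
  by move=> i j; rewrite -eqn_leq => /eqP.
move=> p; split=> E; apply: key; move: p; rewrite E.
  by rewrite perm_cat2l.
by rewrite perm_cat2r.
Qed.

Lemma meet_lb a b : (meet a b <= a)%O /\ (meet a b <= b)%O.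
Proof. by apply/andP; rewrite -meet_leE. Qed.

Lemma join_ub a b : (a <= join a b)%O /\ (b <= join a b)%O.
Proof. by apply/andP; rewrite -join_leE. Qed.

Lemma meetC a b : meet a b = meet b a.
Proof.
have [ab_a ab_b] := meet_lb a b; have [ba_b ba_a] := meet_lb b a.
by apply/le_anti; rewrite !meet_leE ab_a ab_b ba_a ba_b.
Qed.

Lemma joinC a b : join a b = join b a.
Proof.
have [a_ab b_ab] := join_ub a b; have [b_ba a_ba] := join_ub b a.
by apply/le_anti; rewrite !join_leE a_ab b_ab a_ba b_ba.
Qed.

(** An equality such as p.1 = a forces p.2 = b by content, hence a <= b and p = (meet a b, join a
    b), which is excluded. *)
Lemma outer_support a b p : (p.1 <= meet a b)%O -> (join a b <= p.2)%O ->
  perm_eq (e p.1 ++ e p.2) (e a ++ e b) -> p <> (meet a b, join a b) -> outer a b p.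
Proof.
rewrite meet_leE join_leE => /andP[p1a p1b] /andP[ap2 bp2] pe np.
have meet_l x y : (x <= y)%O -> meet x y = x.
  by move=> xy; apply/le_anti; rewrite meet_leE lexx xy (meet_lb x y).1.
have join_r x y : (x <= y)%O -> join x y = y.
  by move=> xy; apply/le_anti; rewrite join_leE lexx xy (join_ub x y).2.
have key x y : (p.1 <= y)%O -> p.1 = x /\ p.2 = y -> p = (meet x y, join x y).
  move=> p1y [px py]; rewrite px in p1y.
  by rewrite meet_l // join_r // -px -py; case: (p).
have pe' : perm_eq (e p.1 ++ e p.2) (e b ++ e a).
  by apply: perm_trans pe _; rewrite perm_catC.
have nab : ~ (p.1 = a /\ p.2 = b) by move/(key _ _ p1b).
have nba : ~ (p.1 = b /\ p.2 = a).
  by move/(key _ _ p1a); rewrite meetC joinC.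
have [E1 E2] := content_inj pe; have [E3 E4] := content_inj pe'.
rewrite /outer !lt_neqAle p1a p1b ap2 bp2 !andbT.
apply/and4P; split; apply/eqP => E.
- by apply: nab; auto.
- by apply: nba; auto.
- by apply: nba; have := esym E; auto.
- by apply: nab; have := esym E; auto.
Qed.

Lemma outer_meet_join a b : ~~ (a >=< b)%O -> outer a b (meet a b, join a b).
Proof.
move=> nab; rewrite /outer /=.
have [ma mb] := meet_lb a b; have [aj bj] := join_ub a b.
rewrite !lt_neqAle ma mb aj bj !andbT.
apply/and4P; split; apply: contraNneq nab => E; rewrite /Order.comparable.
- by rewrite -{1}E mb.
- by rewrite -{2}E ma orbT.
- by rewrite {2}E bj orbT.
- by rewrite {1}E aj.
Qed.

Lemma outer_sum_support a b (c : P * P -> k) : (forall p, c p != 0 -> outer a b p) ->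
  \sum_p c p *: (iota p.1 * iota p.2) = outer_sum iota a b c.
Proof.
move=> co; rewrite /outer_sum [RHS]big_mkcond; apply: eq_bigr => p _.
case: ifP => // /negP no.
by have [->|/co] := eqVneq (c p) 0; first by rewrite scale0r.
Qed.

Lemma straightening_exists a b : ~~ (a >=< b)%O -> exists c,
  [/\ straightening iota a b c, c (meet a b, join a b) != 0
    & forall p, c p != 0 -> perm_eq (e a ++ e b) (e p.1 ++ e p.2)].
Proof.
move=> nab; have [c [cE cP c0]] := iota_mul a b.
exists c; split=> // [|p /cP[_ _]]; last by rewrite perm_sym.
rewrite /straightening cE; apply: outer_sum_support => p /cP[p1 p2 pe].
have [->|/eqP np] := eqVneq p (meet a b, join a b); first exact: outer_meet_join.
exact: outer_support.
Qed.

(** Pairs in [outer a b] satisfy p.1 < a < p.2, so their products are distinct standard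
    monomials. *)
Lemma straightening_unique a b c c' : straightening iota a b c ->
  straightening iota a b c' -> {in outer a b, c =1 c'}.
Proof.
move=> cE c'E p0 p0o; apply/eqP; rewrite -subr_eq0; apply/eqP.
pose S := [seq [:: p.1; p.2] | p <- enum (outer a b)].
pose f (s : seq P) := if s is [:: x; y] then c (x, y) - c' (x, y) else 0.
have := free (S := S) (c := f).
have -> : \sum_(s <- S) f s *: std s = 0.
  rewrite big_map big_enum /=.
  transitivity (outer_sum iota a b c - outer_sum iota a b c'); last first.
    by rewrite -[outer_sum _ _ _ c]cE -[outer_sum _ _ _ c']c'E subrr.
  rewrite /outer_sum -sumrB; apply: eq_bigr => -[x y] _ /=.
  by rewrite scalerBl /std_monomial big_cons big_seq1.
move=> H; have inS : [:: p0.1; p0.2] \in S by apply: map_f; rewrite mem_enum.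
have := H _ _ erefl _ inS; rewrite /f -surjective_pairing; apply.
  by rewrite map_inj_uniq ?enum_uniq // => -[x y] [x' y'] /= [-> ->].
apply/allP => s /mapP[p]; rewrite mem_enum => /and4P[p1 _ p2 _] ->.
by rewrite /= andbT (ltW (lt_trans p1 p2)).
Qed.

(** The ratio [t] of the two coefficients at the meet and join cancels that term, and all other
    terms are outer pairs. For comparable [a] and [b] the cancelled pair is not outer itself. *)
Lemma commutation_exists a b : exists t c,
  [/\ commutation iota a b t c, c (meet a b, join a b) = 0
    & forall p, outer a b p -> c p != 0 -> perm_eq (e a ++ e b) (e p.1 ++ e p.2)].
Proof.
have [c [cE cP c0]] := iota_mul a b; have [c' [c'E c'P c'0]] := iota_mul b a.
rewrite meetC joinC in c'0.
have {}c'P p : c' p != 0 -> [/\ (p.1 <= meet a b)%O, (join a b <= p.2)%O &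
    perm_eq (e p.1 ++ e p.2) (e a ++ e b)].
  move=> /c'P[]; rewrite meetC joinC => ? ? pe; split=> //.
  by apply: perm_trans pe _; rewrite perm_catC.
pose t := c (meet a b, join a b) / c' (meet a b, join a b).
pose f p := c p - t * c' p.
have f0 : f (meet a b, join a b) = 0 by rewrite /f /t divfK ?subrr.
have fP p : f p != 0 -> [/\ (p.1 <= meet a b)%O, (join a b <= p.2)%O &
    perm_eq (e p.1 ++ e p.2) (e a ++ e b)].
  have [cp|/cP //] := eqVneq (c p) 0.
  by rewrite /f cp sub0r oppr_eq0 mulf_eq0 negb_or => /andP[_ /c'P].
exists t, f; split=> // [|p _ /fP[_ _]]; last by rewrite perm_sym.
split; first by rewrite mulf_neq0 ?invr_eq0.
rewrite -outer_sum_support => [|p fp].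
  rewrite cE c'E scaler_sumr -sumrB; apply: eq_bigr => p _.
  by rewrite scalerA scalerBl.
have [p1 p2 pe] := fP _ fp; apply: outer_support => // pE.
by move: fp; rewrite pE f0 eqxx.
Qed.

Lemma conditionC_criterion : conditionC iota.
Proof.
exists meet, join, d, ns, e; split=> // [a b c nab cE|a b].
  have [c' [c'E c'0 c'P]] := straightening_exists nab.
  have cc' := straightening_unique cE c'E.
  split=> [|p po]; first by rewrite cc' //; apply: outer_meet_join.
  by rewrite cc' //; apply: c'P.
exact: commutation_exists.
Qed.

Lemma ASL_criterion (D : nat -> set A) : algebra_grading D ->
  (forall c, D 1%N (iota c)) -> symmetric_quantum_graded_ASL iota D.
Proof.
move=> gD D_iota; split=> // [c|a b nab|a b].
- by exists 1%N.
- by have [c []] := straightening_exists nab; exists c.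
- by have [t [c []]] := commutation_exists a b; exists t, c.
Qed.
End ConditionC.
End Criteria.

(** * Quantum Richardson varieties *)

Section IntervalLattice.
Variables (m n : nat) (a b : rowset m n).
Local Notation P := (order_interval a b).

Fact imeet_subproof (x y : P) : (a <= row_meet (val x) (val y) <= b)%O.
Proof.
have /andP[ax xb] := valP x; have /andP[ay yb] := valP y.
rewrite row_le_meet ax ay /=; apply: le_trans xb.
by have := le_refl (row_meet (val x) (val y)); rewrite row_le_meet => /andP[].
Qed.

Fact ijoin_subproof (x y : P) : (a <= row_join (val x) (val y) <= b)%O.
Proof.
have /andP[ax xb] := valP x; have /andP[ay yb] := valP y.
rewrite row_join_le xb yb !andbT; apply: le_trans ax _.
by have := le_refl (row_join (val x) (val y)); rewrite row_join_le => /andP[].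
Qed.

Definition imeet (x y : P) : P := Sub (row_meet (val x) (val y)) (imeet_subproof x y).
Definition ijoin (x y : P) : P := Sub (row_join (val x) (val y)) (ijoin_subproof x y).

Lemma interval_lattice : distributive_lattice imeet ijoin.
Proof.
split=> [x y z|x y z|x y z].
- by rewrite !leEsub; apply: row_le_meet.
- by rewrite !leEsub; apply: row_join_le.
- by apply: val_inj; apply: row_meetDl.
Qed.

Definition row_tuple (x : P) : m.-tuple nat := [tuple (row_of (val x) r).+1 | r < m].

Lemma row_tupleE x : row_tuple x = [seq (val i).+1 | i <- rows (val x)] :> seq nat.
Proof.
have -> : rows (val x) = [seq row_of (val x) r | r <- enum 'I_m].
  by rewrite /row_of map_tnth_enum.
by rewrite -map_comp.
Qed.

(** The entries are at most [n], but the chains have length [n.+1]: condition (C) asks for at least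
    2, and [n] may be 1. *)
Lemma row_tuple_embedding : chain_embedding imeet ijoin (nseq_tuple m n.+1) row_tuple.
Proof.
split=> [x y|x j|x y j|x y j|x].
- move=> xy; apply/val_inj/row_of_inj => r; apply: val_inj => /=.
  by have := congr1 (fun t => tnth t r) xy; rewrite !tnth_mktuple => -[].
- rewrite !tnth_mktuple (tnth_nth 0%N) nth_nseq ltn_ord.
  by have := ltn_ord (row_of (val x) j); lia.
- by rewrite !tnth_mktuple row_of_meet minnSS.
- by rewrite !tnth_mktuple row_of_join maxnSS.
- rewrite row_tupleE sorted_map; apply: sub_sorted (rows_sorted (val x)) => i j.
  by rewrite ltEord /= => /ltnW.
Qed.
End IntervalLattice.

Section Grassmannian.
Variables (k : fieldType) (n m : nat) (q : k).
Local Notation G := (OqG n m q).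

Definition OqG_val (x : G) : OqM n m q := val x.

Lemma OqG_valM x y : OqG_val (x * y) = OqG_val x * OqG_val y.
Proof. exact: rmorphM. Qed.

Lemma OqG_valZ c x : OqG_val (c *: x) = c *: OqG_val x.
Proof. exact: linearZ. Qed.

Lemma OqG_val1 : OqG_val 1 = 1.
Proof. exact: rmorph1. Qed.

Lemma OqG_valD x y : OqG_val (x + y) = OqG_val x + OqG_val y.
Proof. exact: raddfD. Qed.

Lemma OqG_val_sum (J : finType) (F : J -> G) :
  OqG_val (\sum_j F j) = \sum_j OqG_val (F j).
Proof. exact: raddf_sum. Qed.

Lemma OqG_val_minor K : OqG_val (gminor q K) = qminor q K.
Proof. exact: SubK. Qed.

Lemma OqG_val_inj : injective OqG_val.
Proof. exact: val_inj. Qed.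

Lemma OqG_val_prod (s : seq (rowset m n)) :
  OqG_val (\prod_(K <- s) gminor q K) = mprod q s.
Proof.
elim: s => [|K s IH]; rewrite /mprod ?big_nil ?OqG_val1 // !big_cons.
by rewrite OqG_valM OqG_val_minor IH.
Qed.

(** The images in [OqM] of the subalgebra generated inside [OqG] form a subalgebra that contains the
    minors, hence all of [OqG]. *)
Lemma OqG_gen (y : G) : y \in genSubalg (range (gminor q)).
Proof.
have /asboolP := valP y.
pose W : {pred OqM n m q} := fun x =>
  `[< exists2 z : G, z \in genSubalg (range (gminor q)) & OqG_val z = x >].
move=> WP; suff /WP : subalg_closed W.
  move=> H; have /H/asboolP[z zg /OqG_val_inj <- //] : forall x, range (qminor q) x -> x \in W.
  move=> _ [K _ <-]; apply/asboolP; exists (gminor q K); last exact: OqG_val_minor.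
  by apply: mem_genSubalg; exists K.
have [g1 gZ gM] := genSubalg_closed (range (@gminor k n m q)).
split=> [|c x z|x z].
- rewrite unfold_in; apply/asboolP; exists 1; [exact: g1 | exact: OqG_val1].
- move=> /asboolP[x' gx <-] /asboolP[z' gz <-]; apply/asboolP.
  by exists (c *: x' + z'); rewrite ?OqG_valD ?OqG_valZ //; apply: gZ.
- move=> /asboolP[x' gx <-] /asboolP[z' gz <-]; apply/asboolP.
  by exists (x' * z'); rewrite ?OqG_valM //; apply: gM.
Qed.

Hypotheses (q_neq0 : q != 0) (m_gt0 : (0 < m)%N).

Lemma OqG_words d (s : seq (rowset m n)) : size s = d ->
  spanned (fun t : d.-tuple (rowset m n) => sorted <=%O t)
    (fun t : d.-tuple (rowset m n) => \prod_(K <- t) gminor q K) (\prod_(K <- s) gminor q K).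
Proof.
move=> /(std_spanned q_neq0)[c cP sE]; exists c => [t /cP[] //|].
apply: OqG_val_inj; rewrite OqG_val_prod sE OqG_val_sum.
by apply: eq_bigr => t _; rewrite OqG_valZ OqG_val_prod.
Qed.

Lemma OqG_mul (I J : rowset m n) : exists c : rowset m n * rowset m n -> k,
  [/\ gminor q I * gminor q J = \sum_p c p *: (gminor q p.1 * gminor q p.2),
      forall p, c p != 0 -> [/\ (p.1 <= row_meet I J)%O, (row_join I J <= p.2)%O &
        perm_eq (rows p.1 ++ rows p.2) (rows I ++ rows J)]
    & c (row_meet I J, row_join I J) != 0].
Proof.
have [c [cE cP c0]] := minor_mul q_neq0 m_gt0 I J; exists c; split=> //.
apply: OqG_val_inj; rewrite OqG_valM !OqG_val_minor cE OqG_val_sum.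
by apply: eq_bigr => p _; rewrite OqG_valZ OqG_valM !OqG_val_minor.
Qed.

Section Quotient.
Variables a b : rowset m n.
Local Notation R := (richardson q m_gt0 a b).
Local Notation P := (order_interval a b).

Definition rproj (x : G) : R := richardson_proj m_gt0 a b x.

Lemma rprojM x y : rproj (x * y) = rproj x * rproj y.
Proof. exact: rmorphM. Qed.
Lemma rprojZ c x : rproj (c *: x) = c *: rproj x.
Proof. exact: linearZ. Qed.
Lemma rprojD x y : rproj (x + y) = rproj x + rproj y.
Proof. exact: raddfD. Qed.
Lemma rproj0 : rproj 0 = 0.
Proof. exact: raddf0. Qed.
Lemma rproj1 : rproj 1 = 1.
Proof. by []. Qed.
Lemma rproj_sum (J : finType) (F : J -> G) :
  rproj (\sum_j F j) = \sum_j rproj (F j).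
Proof. exact: raddf_sum. Qed.
Lemma rprojP (Q : R -> Prop) : (forall x, Q (rproj x)) -> forall x, Q x.
Proof. by move=> H x; rewrite -[x]qreprK; apply: H. Qed.

Lemma rproj_off K : ~~ (a <= K <= b)%O -> rproj (gminor q K) = 0.
Proof.
move=> Kab; apply/eqP; rewrite qproj_eq0; apply: mem_genIdeal.
by exists K.
Qed.

Definition rgen (K : rowset m n) : R := rproj (gminor q K).
Local Notation iota := (richardson_map q m_gt0 a b).

Lemma rgenE (c : P) : iota c = rgen (val c).
Proof. by []. Qed.

Lemma rproj_prod (s : seq (rowset m n)) :
  rproj (\prod_(K <- s) gminor q K) = \prod_(K <- s) rgen K.
Proof.
elim: s => [|K s IH]; rewrite ?big_nil ?rproj1 // !big_cons.
by rewrite rprojM IH.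
Qed.

Lemma prod_rgen_iota (s : seq P) :
  \prod_(K <- [seq val c | c <- s]) rgen K = std_monomial iota s.
Proof. by rewrite big_map. Qed.

Lemma prod_rgen (s : seq (rowset m n)) :
  \prod_(K <- s) rgen K = 0 \/
  exists2 u : seq P, [seq val c | c <- u] = s & \prod_(K <- s) rgen K = std_monomial iota u.
Proof.
elim: s => [|K s IH]; first by right; exists [::]; rewrite // /std_monomial !big_nil.
rewrite big_cons; have [Kab|/rproj_off Kab] := boolP (a <= K <= b)%O; last first.
  by left; rewrite [rgen K]Kab mul0r.
case: IH => [->|[u us ->]]; first by left; rewrite mulr0.
right; exists ((Sub K Kab : P) :: u); first by rewrite /= us.
by rewrite /std_monomial big_cons.
Qed.

Lemma sorted_val (u : seq P) : sorted <=%O [seq val c | c <- u] = sorted <=%O u.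
Proof. by rewrite sorted_map. Qed.

(** Straightening takes place in [OqG] and is then projected: a word with a row set off the interval
    becomes 0, any other is a word on the interval in the same order. *)
Lemma rgen_words d (s : seq (rowset m n)) : size s = d ->
  spanned (fun t : d.-tuple P => sorted <=%O t) (fun t : d.-tuple P => std_monomial iota t)
    (\prod_(K <- s) rgen K).
Proof.
move=> /OqG_words[c cP sE]; rewrite -rproj_prod sE rproj_sum.
apply: spanned_sum => t; rewrite rprojZ rproj_prod.
have [->|/cP st] := eqVneq (c t) 0; first by rewrite scale0r; apply: spanned0.
apply: spannedZ; case: (prod_rgen t) => [->|[u ut ->]]; first exact: spanned0.
have szu : size u == d by rewrite -(size_map val) ut size_tuple.
apply: (@spanned_gen _ _ _ _ _ (Tuple szu)).
by move: st; rewrite -ut sorted_val.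
Qed.

Lemma iota_gen (x : R) : x \in genSubalg (range iota).
Proof.
elim/rprojP: x => y; have /asboolP := OqG_gen y.
have [g1 gZ gM] := genSubalg_closed (range iota).
pose W : {pred G} := fun x => rproj x \in genSubalg (range iota).
move=> /(_ W); apply.
  split=> [|c x z|x z]; rewrite !unfold_in -/(rproj _) ?rproj1 //.
  - by rewrite rprojD rprojZ; apply: gZ.
  - by rewrite rprojM; apply: gM.
move=> _ [K _ <-]; rewrite unfold_in.
have [Kab|Kab] := boolP (a <= K <= b)%O; last first.
  by rewrite rproj_off // rpred0.
by apply: mem_genSubalg; exists (Sub K Kab : P).
Qed.

Lemma iota_words d (s : seq P) : size s = d ->
  spanned (fun t : d.-tuple P => sorted <=%O t)
    (fun t : d.-tuple P => std_monomial iota t) (std_monomial iota s).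
Proof.
by move=> sd; rewrite -prod_rgen_iota; apply: rgen_words; rewrite size_map.
Qed.

Definition gphi (x : G) : torus n m q_neq0 := ivphi q_neq0 a b (OqG_val x).

Fact gphi_zmod : zmod_morphism gphi.
Proof. by move=> x y; rewrite /gphi -raddfB; congr ivphi; apply: raddfB. Qed.
HB.instance Definition _ := GRing.isZmodMorphism.Build G (torus n m q_neq0) gphi gphi_zmod.

Fact gphi_monoid : monoid_morphism gphi.
Proof.
split=> [|x y]; first by rewrite /gphi OqG_val1; apply: rmorph1.
by rewrite /gphi OqG_valM ivphiM.
Qed.
HB.instance Definition _ := GRing.isMonoidMorphism.Build G (torus n m q_neq0) gphi gphi_monoid.

Lemma gphi_off x : minors_off (q := q) a b x -> gphi x = 0.
Proof. by case=> K Kab <-; rewrite /gphi OqG_val_minor ivphi_zero. Qed.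

Definition rphi (x : R) : torus n m q_neq0 := qlift gphi_off x.
HB.instance Definition _ := GRing.RMorphism.copy rphi (qlift gphi_off).

Lemma rphi_proj x : rphi (rproj x) = ivphi q_neq0 a b (OqG_val x).
Proof. exact: qliftE. Qed.

Lemma rphiZ c x : rphi (c *: x) = c *: rphi x.
Proof.
elim/rprojP: x => y; rewrite -rprojZ !rphi_proj OqG_valZ.
exact: ivphiZ.
Qed.

Lemma rphi_std (s : seq P) :
  rphi (std_monomial iota s) = \prod_(K <- [seq val c | c <- s]) ivphi q_neq0 a b (qminor q K).
Proof.
by rewrite -prod_rgen_iota -rproj_prod rphi_proj OqG_val_prod ivphi_mprod.
Qed.

Lemma rphi_free (S : seq (seq P)) (c : seq P -> k) : uniq S -> all (sorted <=%O) S ->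
  \sum_(s <- S) c s *: rphi (std_monomial iota s) = 0 -> {in S, forall s, c s = 0}.
Proof.
move=> uS sS sum0 s sinS.
pose vs (u : seq P) : seq (rowset m n) := [seq val c | c <- u].
have vs_inj : injective vs by apply/inj_map/val_inj.
(* [pmap insub] is a left inverse of [vs], which transports the coefficients to words of row
   sets. *)
pose c' (t : seq (rowset m n)) := c (pmap (insub : rowset m n -> option P) t).
have c'E u : c' (vs u) = c u by rewrite /c' map_pK //; apply: valK.
rewrite -c'E; apply: (@ivphi_free _ _ _ _ q_neq0 a b m_gt0 [seq vs u | u <- S]).
- by rewrite map_inj_uniq.
- by apply/allP => _ /mapP[u uS' ->]; rewrite sorted_val (allP sS).
- by apply/allP => _ /mapP[u uS' ->]; apply/allP => _ /mapP[z _ ->]; apply: (valP z).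
- by rewrite big_map -[RHS]sum0; apply: eq_bigr => u _; rewrite c'E rphi_std.
- exact: map_f.
Qed.

Lemma rphi_domain : std_monomials_free iota /\ integral_domain R.
Proof.
apply: (domain_criterion iota_gen iota_words (rho := rphi)).
- exact: rphiZ.
- exact: rphi_free.
- exact: torus_domain.
Qed.

Lemma OqG_deg0 d : OqG_deg d (0 : G).
Proof. by exists [::]; rewrite big_nil. Qed.

Lemma OqG_degZD d c (x y : G) : OqG_deg d x -> OqG_deg d y -> OqG_deg d (c *: x + y).
Proof.
move=> [r ->] [s ->]; exists ([seq (c * p.1, p.2) | p <- r] ++ s).
rewrite big_cat big_map scaler_sumr; congr (_ + _).
by apply: eq_bigr => p _; rewrite scalerA.
Qed.

Lemma OqG_deg1 : OqG_deg 0 (1 : G).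
Proof. by exists [:: (1, [tuple])]; rewrite big_seq1 big_nil scale1r. Qed.

Lemma OqG_degM d e (x y : G) : OqG_deg d x -> OqG_deg e y -> OqG_deg (d + e) (x * y).
Proof.
move=> [r ->] [s ->].
exists [seq (p.1 * p'.1, cat_tuple p.2 p'.2) | p <- r, p' <- s].
rewrite big_allpairs_dep mulr_suml; apply: eq_bigr => p _.
rewrite mulr_sumr; apply: eq_bigr => p' _.
by rewrite big_cat /= -scalerAl -scalerAr scalerA.
Qed.

Local Notation D := (richardson_deg q m_gt0 a b).

Lemma richardson_grading : algebra_grading D.
Proof.
apply: (grading_criterion iota_gen iota_words).
- by move=> d; exists 0; [apply: OqG_deg0 | apply: rproj0].
- move=> d c _ _ [x dx <-] [y dy <-]; exists (c *: x + y); first exact: OqG_degZD.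
  by rewrite -!/(rproj _) rprojD rprojZ.
- by exists 1; [apply: OqG_deg1 | apply: rproj1].
- move=> d e _ _ [x dx <-] [y dy <-]; exists (x * y); first exact: OqG_degM.
  by rewrite -!/(rproj _) rprojM.
- move=> c; exists (gminor q (val c)) => //.
  by exists [:: (1, [tuple val c])]; rewrite !big_seq1 scale1r.
- move=> d _ [_ [r ->] <-]; rewrite -/(rproj _).
  elim: r => [|p r IH]; first by rewrite big_nil rproj0; apply: spanned0.
  rewrite big_cons rprojD rprojZ rproj_prod; apply: spannedD; last exact: IH.
  by apply/spannedZ/rgen_words; rewrite size_tuple.
- exact: rphi_domain.1.
Qed.

Lemma D_iota c : D 1%N (iota c).
Proof.
exists (gminor q (val c)) => //.
by exists [:: (1, [tuple val c])]; rewrite !big_seq1 scale1r.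
Qed.

Lemma iota_mul (x y : P) : exists c : P * P -> k,
  [/\ iota x * iota y = \sum_p c p *: (iota p.1 * iota p.2),
      forall p, c p != 0 -> [/\ (p.1 <= imeet x y)%O, (ijoin x y <= p.2)%O &
        perm_eq (row_tuple p.1 ++ row_tuple p.2) (row_tuple x ++ row_tuple y)]
    & c (imeet x y, ijoin x y) != 0].
Proof.
have [c [cE cP c0]] := OqG_mul (val x) (val y).
exists (fun p => c (val p.1, val p.2)); split=> [|p /cP[p1 p2 pe]|//]; last first.
  by split; rewrite ?leEsub // !row_tupleE -!map_cat; apply: perm_map.
rewrite !rgenE /rgen -rprojM cE rproj_sum.
pose h (p : P * P) := (val p.1, val p.2).
pose in_ab (K : rowset m n) := (a <= K <= b)%O.
rewrite (bigID (fun p => in_ab p.1 && in_ab p.2)) /= [X in _ + X]big1 ?addr0; last first.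
  move=> p; rewrite rprojZ rprojM negb_and => /orP[] /rproj_off ->.
    by rewrite mul0r scaler0.
  by rewrite mulr0 scaler0.
(* [insubd x] inverts [val] on the interval, where its default [x] is never reached. *)
rewrite (reindex_onto h (fun p => (insubd x p.1, insubd x p.2))) /=; last first.
  by move=> [K L] /= /andP[Kab Lab]; rewrite /h /= !insubdK.
apply: eq_big => [[z w]|[z w] _] /=; last by rewrite rprojZ rprojM.
rewrite /h /= !valKd eqxx andbT; apply/andP; split; [exact: (valP z)|exact: (valP w)].
Qed.
End Quotient.
End Grassmannian.

Theorem theorem5p2p2 (k : fieldType) (m n : nat) (q : k)
    (m_gt0 : (0 < m)%N) (le_mn : (m <= n)%N) (q_neq0 : (q != 0)%R)
    (alpha beta : rowset m n) (le_ab : (alpha <= beta)%O) :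
  [/\ symmetric_quantum_graded_ASL (richardson_map q m_gt0 alpha beta)
        (richardson_deg q m_gt0 alpha beta),
      conditionC (richardson_map q m_gt0 alpha beta)
    & integral_domain (richardson q m_gt0 alpha beta)].
Proof.
have [free domain] := rphi_domain q_neq0 m_gt0 alpha beta.
have lattice := interval_lattice alpha beta.
have embedding := row_tuple_embedding alpha beta.
have mul := @iota_mul _ _ _ _ q_neq0 m_gt0 alpha beta.
split=> //.
  apply: (ASL_criterion (@iota_gen _ _ _ _ _ _ _) free lattice embedding mul).
    exact: richardson_grading.
  exact: D_iota.
apply: (conditionC_criterion free lattice m_gt0 _ embedding mul).
by rewrite all_nseq ltnS (leq_trans m_gt0 le_mn) orbT.
Qed.
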